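(* Let $n\ge1$, let $D\subset\mathbb{R}^n$ be a domain, and let $\mathcal{D}:=(0,1)\times D$. Let $c\in\left[\frac{n-1}{2}\pi,\frac{n+1}{2}\pi\right)$. If $u\in\mathcal{F}_c(\mathcal{D})$, then $$v(x):=\inf_{t\in(0,1)}u(t,x)\in F_{c-\frac{\pi}{2}}(D).$$
   Context: $\mathrm{Sym}^2(\mathbb{R}^k)$ is the space of real symmetric $k\times k$ matrices. A domain is a connected open set. Lifted Lagrangian angle: for $B\in\mathrm{Sym}^2(\mathbb{R}^n)$ with eigenvalues $\lambda_1(B),\dots,\lambda_n(B)$, $\widetilde\theta(B):=\sum_{i=1}^n\tan^{-1}\lambda_i(B)$, with $\tan^{-1}:\mathbb{R}\to(-\frac{\pi}{2},\frac{\pi}{2})$. For real $a$, $F_a:=\{B\in\mathrm{Sym}^2(\mathbb{R}^n):\widetilde\theta(B)\ge a\}$. Lifted space-time Lagrangian angle: for $A\in\mathrm{Sym}^2(\mathbb{R}^{n+1})$ let $A^+\in\mathrm{Sym}^2(\mathbb{R}^n)$ be the lower-right $n\times n$ block. Let $I_n:=\mathrm{diag}(0,1,\dots,1)\in\mathrm{Sym}^2(\mathbb{R}^{n+1})$ and $\mathcal{S}:=\{\mathrm{diag}(0,A^+):A^+\in\mathrm{Sym}^2(\mathbb{R}^n)\}$. Define $\widetilde\Theta(A):=\sum_{i=1}^{n+1}\arg\big(\lambda_i(I_n+\sqrt{-1}A)\big)$ for $A\notin\mathcal{S}$ (eigenvalues counted with multiplicity; for $A\notin\mathcal{S}$ they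 lie in $\mathbb{C}\setminus(-\infty,0]$, and $\arg:\mathbb{C}\setminus(-\infty,0]\to(-\pi,\pi)$ is the angle with the positive real axis), and $\widetilde\Theta(A):=\widetilde\theta(A^+)+\frac{\pi}{2}$ for $A\in\mathcal{S}$. Set $\mathcal{F}_c:=\{A\in\mathrm{Sym}^2(\mathbb{R}^{n+1}):\widetilde\Theta(A)\ge c\}$. The first coordinate of $\mathbb{R}^{n+1}=\mathbb{R}\times\mathbb{R}^n$ is $t$ and the remaining ones are $x$. Viscosity subsolutions: for a closed set $F\subset\mathrm{Sym}^2(\mathbb{R}^k)$ and an open set $\Omega\subset\mathbb{R}^k$, $F(\Omega)$ is the set of upper semi-continuous functions $u:\Omega\to\mathbb{R}$ such that for every $x_0\in\Omega$ and every $\varphi\in C^2(\Omega)$ with $\varphi\ge u$ on $\Omega$ and $\varphi(x_0)=u(x_0)$, one has $D^2\varphi(x_0)\in F$. *)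

(* Defs.v *)
From HB Require Import structures.
From mathcomp Require Import all_boot all_order all_algebra.
From mathcomp Require Import complex.
From mathcomp Require Import all_classical all_reals all_analysis.

Set Implicit Arguments.
Unset Strict Implicit.
Unset Printing Implicit Defensive.

Import Order.TTheory GRing.Theory Num.Theory.
Import numFieldNormedType.Exports.

Local Open Scope classical_set_scope.
Local Open Scope ring_scope.
Local Open Scope complex_scope.

Section LagrangianAngles.
Context {R : realType}.

(* Roots of the characteristic polynomial, listed with algebraic multiplicity,
   in an unspecified order. *)
Definition eigenvalues m (M : 'M[R[i]]_m) : seq R[i] :=
  sval (closed_field_poly_normal (char_poly M)).

Lemma char_poly_eigenvalues m (M : 'M[R[i]]_m) :
  char_poly M = \prod_(z <- eigenvalues M) ('X - z%:P).
Proof.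
rewrite /eigenvalues; case: closed_field_poly_normal => r /= E; rewrite {1}E.
by rewrite (eqP (char_poly_monic M)) scale1r.
Qed.

Definition complex_mx m (A : 'M[R]_m) : 'M[R[i]]_m := map_mx (real_complex R) A.

(* Principal argument, in ]-pi, pi[ off the closed negative real axis; only the
   values there are used. *)
Definition arg (z : R[i]) : R :=
  let theta := acos (complex.Re z /
                     Num.sqrt (complex.Re z ^+ 2 + complex.Im z ^+ 2)) in
  if 0 <= complex.Im z then theta else - theta.

(* The eigenvalues of a real symmetric matrix are real, so that Re only casts
   them back to R. *)
Definition lagrangian_angle n (B : 'M[R]_n) : R :=
  \sum_(z <- eigenvalues (complex_mx B)) atan (complex.Re z).

Definition space_block n (A : 'M[R]_(1 + n)) : 'M[R]_n := drsubmx A.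

Definition space_id n : 'M[R]_(1 + n) := block_mx 0 0 0 1%:M.

Definition degenerate n (A : 'M[R]_(1 + n)) : bool :=
  A == block_mx 0 0 0 (space_block A).

Definition spacetime_angle n (A : 'M[R]_(1 + n)) : R :=
  if degenerate A then lagrangian_angle (space_block A) + pi / 2
  else \sum_(z <- eigenvalues (\matrix_(i, j) (space_id n i j +i* A i j))) arg z.

Definition F_ n (a : R) : set 'M[R]_n :=
  [set B | B^T = B /\ a <= lagrangian_angle B].

Definition calF n (c : R) : set 'M[R]_(1 + n) :=
  [set A | A^T = A /\ c <= spacetime_angle A].

End LagrangianAngles.

Section Subsolutions.
Context {R : realType}.

Definition partial k (i : 'I_k) (f : 'rV[R]_k -> R) : 'rV[R]_k -> R :=
  fun x => 'D_(delta_mx 0 i) f x.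

Definition hessian k (f : 'rV[R]_k -> R) (x : 'rV[R]_k) : 'M[R]_k :=
  \matrix_(i, j) partial i (partial j f) x.

(* For open Omega: the partial derivatives of order at most 2 exist and are
   continuous on Omega. *)
Definition C2 k (Omega : set 'rV[R]_k) (f : 'rV[R]_k -> R) : Prop :=
  forall x, Omega x ->
    {for x, continuous f} /\
    (forall i, derivable f x (delta_mx 0 i) /\
               {for x, continuous (partial i f)}) /\
    (forall i j, derivable (partial j f) x (delta_mx 0 i) /\
                 {for x, continuous (partial i (partial j f))}).

Definition upper_semicontinuous_on k (Omega : set 'rV[R]_k)
    (u : 'rV[R]_k -> R) : Prop :=
  forall x, Omega x -> forall a, u x < a -> \forall y \near x, Omega y -> u y < a.

(* Functions on Omega are represented by total functions; their values outside
   the open set Omega are irrelevant. *)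
Definition subsolutions k (F : set 'M[R]_k) (Omega : set 'rV[R]_k) :
    set ('rV[R]_k -> R) :=
  [set u | upper_semicontinuous_on Omega u /\
    forall x0 phi, Omega x0 -> C2 Omega phi ->
      (forall x, Omega x -> u x <= phi x) -> phi x0 = u x0 ->
      F (hessian phi x0)].

(* The point (t, x) of R^(1+n). *)
Definition spacetime n (t : R) (x : 'rV[R]_n) : 'rV[R]_(1 + n) :=
  row_mx t%:M x.

Definition cylinder n (D : set 'rV[R]_n) : set 'rV[R]_(1 + n) :=
  [set p | exists t x, [/\ 0 < t < 1, D x & p = spacetime t x]].

End Subsolutions.

(* Main.v *)
(** The subequation [calF c] lies in explicit half-spaces. If [Q] is orthogonal and
    [\sum_i atan (m i) = c - pi / 2], then every [A] in [calF c] satisfies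
    [\sum_i (A[b_i, Q_i] - m i) / (1 + m i ^+ 2) >= 0] for all reals [b_i], where
    [A[b, v]] is the value of the quadratic form of [A] at the vector [(b, v)]: a
    Schur complement reduces this to the Lagrangian angle of a spatial matrix, the
    angle grows under pinching to the diagonal, and the sets [\sum_i atan x_i >= a]
    are convex for [a >= (n - 2) * pi / 2]. The branches of the arguments are
    controlled by deforming [I_n + i A] to [I_n + s + i A] with [s] going from
    infinity to 0. The time-time entry of [A] is nonnegative, so [u] is convex in
    [t].

    Suppose that [phi] touches [v] from above at [x0]. Fix an invertible [V], a small
    ellipsoid [{ell <= 1}] centred at [x0] that is a ball for the metric in which
    [P := tr (V^T V D^2)] is the Laplacian, and [d > 0]. By convexity in [t], on the
    boundary of the ellipsoid there is a polynomial [tau] with values in [(0, 1)] and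
    [u (tau x, x) < phi x + d]; replace it by the [P]-harmonic polynomial [H] with the
    same boundary values. For a large [C], the function
    [phi x + d * ell x + C * (t - H x)^2] touches [u] from above, up to a constant,
    at some point. The term in [C] has no effect on the vectors [(V_i . grad H, V_i)]:
    its rank-one part vanishes there and the remaining part is a multiple of
    [P H = 0]. The half-space inequality thus bounds [P phi] from below near [x0].
    If the Lagrangian angle of [D^2 phi x0] were less than [c - pi / 2], this would
    fail for [V] made of the eigenvectors of [D^2 phi x0], suitably weighted. *)

From HB Require Import structures.
Require Import Defs.
From mathcomp Require Import all_boot all_order all_algebra finmap.
From mathcomp Require Import complex.
From mathcomp Require Import all_classical all_reals all_analysis.
From mathcomp Require Import ring lra.
Import Order.TTheory GRing.Theory Num.Theory.
Import numFieldNormedType.Exports.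
Local Open Scope classical_set_scope.
Local Open Scope ring_scope.
Set Implicit Arguments.
Unset Strict Implicit.
Unset Printing Implicit Defensive.

(** * Sums of arguments *)

(** The infimum over t need not be attained in (0, 1) and near-minimizing times need not vary
    continuously with x, so [phi] cannot be tested at a minimizer; the graph of [H] stands in for
    one, and [d] is the margin that makes suitable times available on the boundary. The penalty
    constant [C] comes from compactness without any bound, so its Hessian error -2 C (t - H) D^2 H
    cannot be absorbed; it has to vanish. A harmonic [H] achieves this for one operator [P] fixed
    beforehand, which is why the subequation is used one half-space at a time. The weights 1 / (1 +
    m_i^2) are the derivatives of atan at m_i, so each half-space is bounded by the tangent plane at
    m of the level set. The lower bound on c says c - pi / 2 >= (n - 2) pi / 2, the convexity
    threshold; the upper bound makes the level c - pi / 2 attainable. For n = 1 and c = 0 the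
    half-spaces fail, but then the angle bound -pi / 2 is no condition. Symmetry of D^2 [phi] is not
    taken from calculus: it is inherited from the symmetry of the matrices in [calF c]. *)

Section Argument.
Context {R : realType}.
Implicit Types (z w : R[i]) (r g s : R).
Local Open Scope complex_scope.

(** The complement of the closed negative real axis. *)
Definition slit z := (complex.Im z != 0) || (0 < complex.Re z).

Definition cis g : R[i] := cos g +i* sin g.

Lemma cisD g h : cis (g + h) = cis g * cis h.
Proof.
rewrite /cis; apply/eqP; rewrite eq_complex /= cosD sinD; apply/andP; split; apply/eqP; ring.
Qed.

Lemma arg_cis r g : 0 < r -> - pi < g < pi -> arg (r%:C * cis g) = g.
Proof.
move=> r0 /andP[g1 g2]; rewrite /arg /cis /= !mul0r subr0 addr0.
have -> : (r * cos g) ^+ 2 + (r * sin g) ^+ 2 = r ^+ 2.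
  by rewrite !exprMn -mulrDr cos2Dsin2 mulr1.
rewrite sqrtr_sqr gtr0_norm // mulrAC divff ?gt_eqF // mul1r pmulr_rge0 //.
have [g0|g0] := leP 0 g.
  by rewrite sin_ge0_pi ?g0 ?ltW // cosK // in_itv /= g0 ltW.
have : 0 < sin (- g) by apply: sin_gt0_pi; rewrite oppr_gt0 g0 ltrNl.
rewrite sinN oppr_gt0 => /lt_geF ->.
by rewrite -cosN cosK ?opprK // in_itv /= oppr_ge0 ltW //= lerNl ltW.
Qed.

(** Written as an arccotangent of Re z / |Im z|, the angle is visibly continuous in Re z for fixed
    Im z. On the positive real axis the factor [Num.sg] is 0. *)
Lemma slit_arg z : slit z ->
  arg z = Num.sg (complex.Im z) *
          (pi / 2 - atan (complex.Re z / `|complex.Im z|)).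
Proof.
case: z => x y; rewrite /slit /= => h.
have [y0|y0|y0] := ltgtP y 0; last first.
- rewrite y0 eqxx /= in h; rewrite y0 sgr0 mul0r.
  have -> : x +i* 0 = x%:C * cis 0.
    rewrite /cis cos0 sin0; apply/eqP; rewrite eq_complex /=.
    by apply/andP; split; apply/eqP; ring.
  by rewrite arg_cis // oppr_lt0 pi_gt0.
- rewrite gtr0_sg // mul1r gtr0_norm //.
  set a := atan _; have a1 := atan_gtNpi2 (x / y); have a2 := atan_ltpi2 (x / y).
  have ca : 0 < cos a by rewrite cos_gt0_pihalf // a1.
  have := atanK (x / y); rewrite -/a in a1 a2 * => Ha.
  have -> : x +i* y = (y / cos a)%:C * cis (pi / 2 - a).
    have : x = y / cos a * sin a by rewrite mulrAC -mulrA -/(tan a) Ha mulrC divfK // gt_eqF.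
    rewrite /cis cosB sinB cos_pihalf sin_pihalf => Ex.
    apply/eqP; rewrite eq_complex /= !mul0r !mul1r add0r !subr0 addr0 (divfK (lt0r_neq0 ca)).
    by rewrite -Ex !eqxx.
  have pp := @pi_gt0 R.
  by rewrite arg_cis ?divr_gt0 //; apply/andP; split; lra.
- rewrite ltr0_sg // ltr0_norm // mulN1r.
  set a := atan _; have a1 := atan_gtNpi2 (x / - y); have a2 := atan_ltpi2 (x / - y).
  have ca : 0 < cos a by rewrite cos_gt0_pihalf // a1.
  have := atanK (x / - y); rewrite -/a in a1 a2 * => Ha.
  have ny : 0 < - y by rewrite oppr_gt0.
  have -> : x +i* y = (- y / cos a)%:C * cis (- (pi / 2 - a)).
    have : x = - y / cos a * sin a by rewrite mulrAC -mulrA -/(tan a) Ha mulrC divfK // gt_eqF.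
    rewrite /cis cosN sinN cosB sinB cos_pihalf sin_pihalf => Ex.
    apply/eqP; rewrite eq_complex /= !mul0r !mul1r add0r !subr0 addr0 mulrN (divfK (lt0r_neq0 ca)).
    by rewrite opprK -Ex !eqxx.
  have pp := @pi_gt0 R.
  by rewrite arg_cis ?divr_gt0 //; apply/andP; split; lra.
Qed.

Lemma arg_right (x y : R) : 0 < x -> arg (x +i* y) = atan (y / x).
Proof.
move=> x0; set a := atan _.
have a1 := atan_gtNpi2 (y / x); have a2 := atan_ltpi2 (y / x).
rewrite -/a in a1 a2.
have ca : 0 < cos a by rewrite cos_gt0_pihalf // a1.
have -> : x +i* y = (x / cos a)%:C * cis a.
  have : y = x / cos a * sin a.
    by rewrite mulrAC -mulrA -/(tan a) atanK mulrC divfK // gt_eqF.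
  rewrite /cis => Ey; apply/eqP; rewrite eq_complex /= !mul0r subr0 addr0.
  by rewrite (divfK (lt0r_neq0 ca)) -Ey !eqxx.
have pp := @pi_gt0 R.
by rewrite arg_cis ?divr_gt0 //; apply/andP; split; lra.
Qed.

Lemma slit_polar z : slit z -> exists2 r, 0 < r & z = r%:C * cis (arg z).
Proof.
case: z => x y; rewrite /slit /= => h.
set q := x ^+ 2 + y ^+ 2.
have q0 : 0 < q.
  case/orP: h => [y0|x0].
    by rewrite ltr_wpDl ?sqr_ge0 // lt_def sqr_ge0 sqrf_eq0 y0.
  by rewrite ltr_wpDr ?sqr_ge0 // lt_def sqr_ge0 sqrf_eq0 gt_eqF.
have s0 : 0 < Num.sqrt q by rewrite sqrtr_gt0.
have t1 : (x / Num.sqrt q) ^+ 2 = 1 - (y / Num.sqrt q) ^+ 2.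
  rewrite !exprMn exprVn sqr_sqrtr ?ltW //.
  by apply: (mulIf (lt0r_neq0 q0)); rewrite mulrBl !divfK ?lt0r_neq0 // /q; ring.
have tl : -1 <= x / Num.sqrt q <= 1.
  rewrite -ler_norml -(@expr_le1 _ 2) // real_normK ?num_real //.
  by rewrite t1 lerBlDr lerDl sqr_ge0.
exists (Num.sqrt q) => //.
have key : (Num.sqrt q)%:C * cis (arg (x +i* y)) =
   (Num.sqrt q * cos (arg (x +i* y))) +i* (Num.sqrt q * sin (arg (x +i* y))).
  by apply/eqP; rewrite eq_complex /= !mul0r subr0 addr0 !eqxx.
rewrite key /arg /= -/q.
have sa : sin (acos (x / Num.sqrt q)) = `|y| / Num.sqrt q.
  rewrite sin_acos // t1 opprB addrCA subrr addr0 sqrtr_sqr normrM.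
  by rewrite [X in _ * X]ger0_norm // invr_ge0 ltW.
have ca : cos (acos (x / Num.sqrt q)) = x / Num.sqrt q by rewrite acosK.
have sn := lt0r_neq0 s0.
case: leP => y0.
  rewrite ca sa ger0_norm // ![Num.sqrt q * _]mulrC !divfK //.
rewrite cosN sinN ca sa ltr0_norm // mulNr opprK ![Num.sqrt q * _]mulrC !divfK //.
Qed.

Lemma prod_polar (zs : seq R[i]) : (forall z, z \in zs -> slit z) ->
  exists2 r, 0 < r & \prod_(z <- zs) z = r%:C * cis (\sum_(z <- zs) arg z).
Proof.
elim: zs => [|z zs IH] h.
  exists 1 => //; rewrite !big_nil /cis cos0 sin0.
  by apply/eqP; rewrite eq_complex /= !mul0r !mulr0 mulr1 subr0 addr0 !eqxx.
have [|r r0 E] := IH; first by move=> w hw; apply: h; rewrite inE hw orbT.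
have [|q q0 Ez] := @slit_polar z; first by apply: h; rewrite inE eqxx.
exists (q * r); first by rewrite mulr_gt0.
rewrite !big_cons E {1}Ez cisD rmorphM /=.
by rewrite -!mulrA; congr (_ * _); rewrite mulrCA.
Qed.

(** The formula of [slit_arg] at z + s: it equals the argument of z + s wherever that point is in
    the slit plane, and is continuous in s on the whole line. *)
Definition shift_arg z s : R :=
  Num.sg (complex.Im z) * (pi / 2 - atan ((complex.Re z + s) / `|complex.Im z|)).

Lemma shift_arg_cont z : continuous (shift_arg z).
Proof.
move=> s; apply: cvgM; first exact: cvg_cst.
apply: cvgB; first exact: cvg_cst.
apply: (continuous_comp (f := fun t => (complex.Re z + t) / `|complex.Im z|)).
  by apply: cvgMl; apply: cvgD; [exact: cvg_cst | exact: cvg_id].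
exact: continuous_atan.
Qed.

Lemma shift_arg_lim z : shift_arg z s @[s --> +oo] --> 0.
Proof.
rewrite /shift_arg; have [y0|y0] := eqVneq (complex.Im z) 0.
  rewrite y0 sgr0; under eq_fun do rewrite mul0r; exact: cvg_cst.
rewrite -[X in _ --> X](mulr0 (Num.sg (complex.Im z))).
apply: cvgM; first exact: cvg_cst.
rewrite -[X in _ --> X](subrr (pi / 2)).
apply: cvgB; first exact: cvg_cst.
have yp : 0 < `|complex.Im z| by rewrite normr_gt0.
apply: (@cvg_comp _ _ _ (fun t => (complex.Re z + t) / `|complex.Im z|) atan _ +oo);
  last exact: cvgy_atan.
apply/cvgryPge => A; near=> s.
rewrite ler_pdivlMr // -lerBlDl.
by near: s; apply: nbhs_pinfty_ge; rewrite num_real.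
Unshelve. all: by end_near. Qed.

Lemma arg_shift z s : slit (z + s%:C) -> arg (z + s%:C) = shift_arg z s.
Proof. by move/slit_arg ->; rewrite /shift_arg; case: z => x y /=; rewrite addr0. Qed.

(** A point z + s on the closed negative axis would reach 0 when moved further to the right. *)
Lemma slit_shift z : (forall s, 0 <= s -> z + s%:C != 0) ->
  forall s, 0 <= s -> slit (z + s%:C).
Proof.
case: z => x y h s s0; rewrite /slit /= addr0.
have [y0|//] := eqVneq y 0; rewrite /= ltNge; apply/negP => h1.
have x0 : 0 <= - x by rewrite /= in h1; lra.
by have := h _ x0; rewrite eq_complex /= y0 !addr0 addrN eqxx.
Qed.

(* Along [s >= 0] the difference of the two sums of arguments is continuous,
   vanishes at infinity and never meets [+pi] or [-pi]; it is thus the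
   principal argument of [rho s]. *)
Lemma sum_arg_ratio (zs ws : seq R[i]) (rho : R -> R[i]) :
  (forall s z, 0 <= s -> z \in zs -> z + s%:C != 0) ->
  (forall s z, 0 <= s -> z \in ws -> z + s%:C != 0) ->
  (forall s, 0 <= s -> slit (rho s)) ->
  (forall s, 0 <= s ->
    \prod_(z <- zs) (z + s%:C) = \prod_(w <- ws) (w + s%:C) * rho s) ->
  \sum_(z <- zs) arg z = \sum_(w <- ws) arg w + arg (rho 0).
Proof.
move=> hz hw hr hp.
have sz z s : z \in zs -> 0 <= s -> slit (z + s%:C).
  by move=> zi; apply: slit_shift => t t0; exact: hz.
have sw z s : z \in ws -> 0 <= s -> slit (z + s%:C).
  by move=> zi; apply: slit_shift => t t0; exact: hw.
pose g s := \sum_(z <- zs) shift_arg z s - \sum_(w <- ws) shift_arg w s.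
have gE (l : seq R[i]) s : (forall z t, z \in l -> 0 <= t -> slit (z + t%:C)) ->
    0 <= s -> \sum_(z <- [seq z + s%:C | z <- l]) arg z = \sum_(z <- l) shift_arg z s.
  move=> sl s0; rewrite big_map; apply: eq_big_seq => z zi.
  by rewrite arg_shift // sl.
have key s : 0 <= s -> exists2 r, 0 < r & rho s = r%:C * cis (g s).
  move=> s0.
  have [|r r0 Er] := @prod_polar [seq z + s%:C | z <- zs].
    by move=> _ /mapP[z zi ->]; exact: sz.
  have [|q q0 Eq] := @prod_polar [seq z + s%:C | z <- ws].
    by move=> _ /mapP[z zi ->]; exact: sw.
  rewrite !gE // in Er Eq.
  exists (r / q); first by rewrite divr_gt0.
  have := hp _ s0.
  rewrite -[X in X = _](big_map (fun z => z + s%:C) predT id) Er.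
  rewrite -[X in _ = X * _](big_map (fun z => z + s%:C) predT id) Eq => E.
  have qn : q%:C != 0 by rewrite eq_complex /= eqxx andbT gt_eqF.
  have cn h : cis h * cis (- h) = 1.
    by rewrite -cisD subrr /cis cos0 sin0.
  have -> : rho s = (q%:C)^-1 * cis (- \sum_(z <- ws) shift_arg z s) *
     (q%:C * cis (\sum_(z <- ws) shift_arg z s) * rho s).
    rewrite mulrA [X in X * rho s](_ : _ = 1) ?mul1r //.
    by rewrite mulrACA mulVf // mul1r mulrC cn.
  rewrite -E /g cisD fmorph_div /=; move: (cis _) (cis _) => u v.
  by rewrite [RHS]mulrACA mulrC.
have addc : continuous (fun z : R * R => z.1 + z.2) by exact: add_continuous.
have gc : continuous g.
  move=> s; apply: cvgB; apply: (cvg_big addc (Ff := fun z => shift_arg z));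
    by move=> z _; exact: shift_arg_cont.
have g0 : g s @[s --> +oo] --> 0.
  have lim0 (l : seq R[i]) : \sum_(z <- l) shift_arg z s @[s --> +oo] --> 0.
    have E : \sum_(z <- l) (0 : R) = 0 by rewrite big1_eq.
    rewrite -[X in _ --> X]E.
    by apply: (cvg_big addc (Ff := fun z => shift_arg z)) => z _; exact: shift_arg_lim.
  by rewrite -[X in _ --> X](subrr 0); apply: cvgB; exact: lim0.
have pp := @pi_gt0 R.
have [b b0 gb] : exists2 b, 0 <= b & `|g b| < pi.
  have : \forall s \near +oo, 0 <= s /\ `|g s| < pi.
    near=> s; split; first by near: s; apply: nbhs_pinfty_ge; rewrite num_real.
    near: s; move/cvgrPdist_lt : g0 => /(_ _ pp).
    by apply: filterS => s; rewrite sub0r normrN.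
  by case/filter_ex => b [b0 hb]; exists b.
have gn s : 0 <= s -> `|g s| != pi.
  move=> s0; apply/eqP => E.
  have [r r0 Er] := key _ s0.
  have := hr _ s0; rewrite Er /slit.
  have cg : cos (g s) = -1 by rewrite -cos_norm E cospi.
  have sg : sin (g s) = 0 by apply: cos1sin0; rewrite cg normrN normr1.
  by rewrite /cis cg sg /= !(mulr0, mul0r) addr0 eqxx subr0 /= mulrN1 oppr_gt0 ltNge ltW.
have gpi : `|g 0| < pi.
  rewrite ltNge; apply/negP => hg.
  have [||s] := @IVT R (fun s => `|g s|) 0 b pi b0.
  - apply: continuous_subspaceT => s.
    by apply: (continuous_comp (gc s)); exact: norm_continuous.
  - by rewrite ge_min le_max (ltW gb) hg orbT.
  by rewrite in_itv /= => /andP[s0 _] E; move: (gn _ s0); rewrite E eqxx.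
have [r r0 Er] := key 0 (lexx 0).
have E0 (l : seq R[i]) : (forall z t, z \in l -> 0 <= t -> slit (z + t%:C)) ->
   \sum_(z <- l) arg z = \sum_(z <- l) shift_arg z 0.
  move=> sl; rewrite -gE // big_map; apply: eq_bigr => z _; congr arg.
  by case: z => x y; apply/eqP; rewrite eq_complex /= !addr0 !eqxx.
by rewrite Er arg_cis // -?ltr_norml // !E0 // /g addrC subrK.
Unshelve. all: by end_near. Qed.

End Argument.

(** * Determinants and angles of bordered matrices *)

Section Schur.
Variable F : fieldType.

Lemma det_schur n (d : F) (r : 'rV[F]_n) (c : 'cV[F]_n) (E : 'M[F]_n) :
  E \in unitmx ->
  \det (block_mx d%:M r c E) = \det E * (d - (r *m invmx E *m c) 0 0).
Proof.
move=> Eu.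
have -> : block_mx d%:M r c E =
    block_mx 1%:M (r *m invmx E) 0 1%:M *m
    block_mx (d%:M - r *m invmx E *m c) 0 c E.
  by rewrite mulmx_block !mul1mx !mul0mx !add0r subrK mulmxKV.
rewrite det_mulmx det_ublock !det1 !mul1r det_lblock mulrC; congr (_ * _).
by rewrite det_mx11 !mxE eqxx mulr1n.
Qed.

(** The scalar corner is eliminated instead of the block [E]; [lagrangian_angle_schur] compares the
    two eliminations. *)
Lemma det_schurl n (d : F) (r : 'rV[F]_n) (c : 'cV[F]_n) (E : 'M[F]_n) :
  d != 0 -> \det (block_mx d%:M r c E) = d * \det (E - d^-1 *: (c *m r)).
Proof.
move=> d0.
have -> : block_mx d%:M r c E =
    block_mx 1%:M 0 (d^-1 *: c) 1%:M *m
    block_mx d%:M r 0 (E - d^-1 *: (c *m r)).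
  rewrite mulmx_block !mul1mx !mul0mx !addr0.
  by rewrite mul_mx_scalar scalerA divff // scale1r -scalemxAl addrC subrK.
by rewrite det_mulmx det_lblock !det1 !mul1r det_ublock det_scalar1.
Qed.

End Schur.

(** * Spectral theorem for real symmetric matrices *)

Section Spectral.
Context {R : realType}.
Local Notation C := R[i].
Local Open Scope complex_scope.

(** The orthonormal eigenvectors are the rows of [Q]. *)
Definition diagonalizes n (Q : 'M[R]_n) (d : 'rV[R]_n) (B : 'M[R]_n) :=
  Q *m Q^T = 1%:M /\ B = Q^T *m diag_mx d *m Q.

Lemma mulmx_tr_self n (v : 'rV[R]_n) : (v *m v^T) 0 0 = \sum_i v 0 i ^+ 2.
Proof. by rewrite mxE; apply: eq_bigr => i _; rewrite mxE expr2. Qed.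

Lemma row_norm_gt0 n (v : 'rV[R]_n) : v != 0 -> 0 < (v *m v^T) 0 0.
Proof.
move=> v0; rewrite mulmx_tr_self lt_def sumr_ge0 ?andbT; last by move=> i _; exact: sqr_ge0.
apply: contraNneq v0 => /eqP; rewrite psumr_eq0; last by move=> i _; exact: sqr_ge0.
move/allP => h; apply/eqP/rowP => i; rewrite mxE.
by have := h i (mem_index_enum _); rewrite sqrf_eq0 => /eqP.
Qed.

(** Let x + i y be a complex eigenvector with eigenvalue a + i b. Comparing x B y^T with y B x^T
    gives b (|x|^2 + |y|^2) = 0, so b = 0 and whichever of x, y is nonzero is a real eigenvector. *)
Lemma symmetric_eigenvector n (B : 'M[R]_n.+1) : B^T = B ->
  exists a, exists2 v : 'rV[R]_n.+1, v != 0 & v *m B = a *: v.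
Proof.
move=> sB.
have [z /eigenvalueP[w wB w0]] := eigenvalue_closed (complex_mx B) (ltn0Sn n).
set a := complex.Re z; set b := complex.Im z.
pose x : 'rV[R]_n.+1 := \row_i complex.Re (w 0 i).
pose y : 'rV[R]_n.+1 := \row_i complex.Im (w 0 i).
have comp i : (x *m B) 0 i = a * x 0 i - b * y 0 i /\
              (y *m B) 0 i = b * x 0 i + a * y 0 i.
  have := congr1 (fun M : 'rV[C]_n.+1 => M 0 i) wB.
  rewrite !mxE => E.
  have Esum : \sum_j w 0 j * complex_mx B j i =
     (\sum_j complex.Re (w 0 j) * B j i) +i* (\sum_j complex.Im (w 0 j) * B j i).
    apply/eqP; rewrite eq_complex !raddf_sum /=; apply/andP; split; apply/eqP.
      by apply: eq_bigr => j _; rewrite mxE; case: (w 0 j) => p q /=; ring.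
    by apply: eq_bigr => j _; rewrite mxE; case: (w 0 j) => p q /=; ring.
  rewrite Esum {Esum} in E.
  have E1 := congr1 (@complex.Re R) E; have E2 := congr1 (@complex.Im R) E.
  split; [rewrite -[RHS](_ : complex.Re (z * w 0 i) = _) | rewrite -[RHS](_ : complex.Im (z * w 0 i) = _)].
  - by rewrite -E1; apply: eq_bigr => j _; rewrite ?mxE.
  - by rewrite /a /b ?mxE; case: (z) => p q; case: (w 0 i) => p' q' /=; ring.
  - by rewrite -E2; apply: eq_bigr => j _; rewrite ?mxE.
  - by rewrite /a /b ?mxE; case: (z) => p q; case: (w 0 i) => p' q' /=; ring.
have xB : x *m B = a *: x - b *: y.
  by apply/rowP => i; rewrite (comp i).1 !mxE.
have yB : y *m B = b *: x + a *: y.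
  by apply/rowP => i; rewrite (comp i).2 !mxE.
have xyT : (x *m B *m y^T) 0 0 = (y *m B *m x^T) 0 0.
  rewrite -[in RHS](trmxK (y *m B *m x^T)) [RHS]mxE.
  by rewrite !trmx_mul trmxK sB mulmxA.
have dot : (x *m y^T) 0 0 = (y *m x^T) 0 0.
  by rewrite -[in RHS](trmxK (y *m x^T)) [RHS]mxE trmx_mul trmxK.
have xy0 : (x != 0) || (y != 0).
  rewrite -negb_and; apply: contra w0 => /andP[/eqP x0 /eqP y0].
  apply/eqP/rowP => i; rewrite mxE.
  have := congr1 (fun M : 'rV[R]_n.+1 => M 0 i) x0.
  have := congr1 (fun M : 'rV[R]_n.+1 => M 0 i) y0.
  by rewrite !mxE; case: (w 0 i) => p q /= -> ->.
have b0 : b = 0.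
  move: xyT; rewrite xB yB mulmxBl mulmxDl -!scalemxAl !mxE => E.
  have E' : b * ((x *m x^T) 0 0 + (y *m y^T) 0 0) = 0.
    move: dot E; rewrite !mxE => ->; lra.
  have x_ge : 0 <= (x *m x^T) 0 0.
    by rewrite mulmx_tr_self sumr_ge0 // => i _; exact: sqr_ge0.
  have y_ge : 0 <= (y *m y^T) 0 0.
    by rewrite mulmx_tr_self sumr_ge0 // => i _; exact: sqr_ge0.
  have sum0 : 0 < (x *m x^T) 0 0 + (y *m y^T) 0 0.
    case/orP: xy0 => /row_norm_gt0 h; first by rewrite ltr_wpDr.
    by rewrite ltr_wpDl.
  by move/eqP: E'; rewrite mulf_eq0 (gt_eqF sum0) orbF => /eqP.
exists a; case/orP: xy0 => h; [exists x | exists y] => //.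
  by rewrite xB b0 scale0r subr0.
by rewrite yB b0 scale0r add0r.
Qed.

(* A Householder reflection. *)
Lemma orthogonal_first_row n (v : 'rV[R]_n.+1) : v != 0 ->
  exists2 H : 'M[R]_n.+1, H *m H^T = 1%:M & exists k, row 0 H = k *: v.
Proof.
move=> v0; pose k := (Num.sqrt ((v *m v^T) 0 0))^-1.
have vv := row_norm_gt0 v0.
pose e : 'rV[R]_n.+1 := k *: v.
have ee : (e *m e^T) = 1%:M.
  rewrite /e linearZ /= -scalemxAl -scalemxAr scalerA.
  rewrite [v *m v^T]mx11_scalar scale_scalar_mx; congr (_%:M).
  by rewrite /k -invfM -expr2 sqr_sqrtr ?ltW // mulVf // gt_eqF.
pose f : 'rV[R]_n.+1 := delta_mx 0 0.
have ff : f *m f^T = 1%:M.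
  by apply/matrixP => i j; rewrite !ord1 trmx_delta mul_delta_mx !mxE !eqxx.
pose w := f - e.
have [w0|w0] := eqVneq w 0.
  exists 1%:M; first by rewrite trmx1 mulmx1.
  exists k; rewrite -/e row1; apply/eqP; by rewrite -subr_eq0 -/f -/w w0.
have ww := row_norm_gt0 w0; set m := (w *m w^T) 0 0 in ww.
have wwE : w *m w^T = m%:M by rewrite [LHS]mx11_scalar.
pose S := (2 / m) *: (w^T *m w).
have SS : S *m S = S + S.
  have DD : w^T *m w *m (w^T *m w) = m *: (w^T *m w).
    by rewrite -mulmxA [w *m (_ *m _)]mulmxA wwE mul_scalar_mx -scalemxAr.
  rewrite /S -scalemxAl -scalemxAr DD !scalerA -scalerDl; congr (_ *: _).
  by rewrite -mulrA divfK ?gt_eqF // mulrDr mulr1 mulrC.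
pose H := 1%:M - S.
exists H.
  have HT : H^T = H.
    by rewrite /H linearB /= trmx1 linearZ /= trmx_mul trmxK.
  by rewrite HT /H mulmxBl mul1mx mulmxBr mulmx1 SS opprB addrK subrK.
exists k; rewrite -/e rowE /H mulmxBr mulmx1 -/f /S -scalemxAr mulmxA.
have fw : f *m w^T = (m / 2)%:M.
  have mE : m%:M = f *m w^T - e *m w^T by rewrite -mulmxBl -/w wwE.
  have eE : e *m w^T = - (f *m w^T).
    apply/eqP; rewrite -addr_eq0 -mulmxDl /w linearB /= mulmxDl !mulmxBr ff ee.
    have -> : f *m e^T = e *m f^T.
      by rewrite [LHS]mx11_scalar -tr_scalar_mx -mx11_scalar trmx_mul trmxK.
    by rewrite addrA subrK subrr.
  rewrite eE opprK -mulr2n -scaler_nat in mE.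
  have -> : (m / 2)%:M = 2^-1 *: (m%:M : 'M[R]_1).
    by rewrite scale_scalar_mx mulrC.
  by rewrite mE scalerA mulVf ?scale1r // pnatr_eq0.
rewrite fw mul_scalar_mx scalerA.
have -> : 2 / m * (m / 2) = 1 by rewrite mulrA divfK ?gt_eqF // divff // pnatr_eq0.
by rewrite scale1r /w opprB addrC subrK.
Qed.

(** Conjugating by a reflection whose first row is along an eigenvector makes the first row of the
    matrix a multiple of e_0; by symmetry the matrix is then block diagonal, and induction treats
    the remaining block. *)
Lemma symmetric_diagonalizes n (B : 'M[R]_n) : B^T = B ->
  exists Q d, diagonalizes Q d B.
Proof.
elim: n B => [|n IH] B sB.
  by exists 1%:M, 0; split; apply/matrixP => -[].
have [a [v v0 vB]] := symmetric_eigenvector sB.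
have [H HH [k Hk]] := orthogonal_first_row v0.
have [A AE0] : {A | A = H *m B *m H^T} by exists (H *m B *m H^T).
have sA : A^T = A by rewrite AE0 !trmx_mul trmxK sB mulmxA.
have rA : row 0 A = a *: delta_mx 0 0.
  rewrite AE0 !row_mul Hk -scalemxAl vB scalerA mulrC -scalerA -Hk -scalemxAl.
  by rewrite -row_mul HH row1.
have A0j j : A 0 j = a *+ (j == 0).
  have := congr1 (fun M : 'rV[R]_(n.+1) => M 0 j) rA.
  by rewrite !mxE eqxx /= mulr_natr.
pose A' : 'M[R]_n := drsubmx (A : 'M[R]_(1 + n)).
have sA' : A'^T = A' by rewrite /A' trmx_drsub sA.
pose A1 : 'M[R]_(1 + n) := A.
have l0 : lshift n 0 = 0 :> 'I_(1 + n) by exact: val_inj.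
have E0 j : A1 0 (rshift 1 j) = 0 by exact: etrans (A0j _) _.
have Eul : ulsubmx A1 = a%:M.
  by apply/matrixP => i j; rewrite !ord1 !mxE l0; exact: etrans (A0j _) _.
have Eur : ursubmx A1 = 0.
  by apply/matrixP => i j; rewrite !ord1 !mxE l0 E0.
have Edl : dlsubmx A1 = 0.
  apply/matrixP => i j; rewrite !ord1 !mxE l0 -(E0 i).
  by rewrite /A1 -[in LHS]sA mxE.
have AE : A1 = block_mx a%:M 0 0 A'.
  by rewrite -[LHS](submxK A1) Eul Eur Edl.
have [Q [d [QQ Bd]]] := IH A' sA'.
pose Q1 : 'M[R]_(1 + n) := block_mx 1%:M 0 0 Q.
pose d1 : 'rV[R]_(1 + n) := row_mx (a%:M : 'M[R]_1) d.
have QQ1 : Q1 *m Q1^T = 1%:M.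
  rewrite /Q1 tr_block_mx !trmx0 trmx1 mulmx_block !(mul0mx, mulmx0) !addr0 mulmx1.
  by rewrite add0r QQ -scalar_mx_block.
have AQ : A1 = Q1^T *m diag_mx d1 *m Q1.
  have D1 : diag_mx (a%:M : 'M[R]_1) = a%:M.
    by apply/matrixP => i j; rewrite !ord1 !mxE.
  rewrite AE diag_mx_row D1 /Q1 tr_block_mx !trmx0 trmx1.
  rewrite !mulmx_block !(mul0mx, mulmx0, mulmx1, mul1mx) !(add0r, addr0) -Bd.
  by rewrite ?mul0mx.
exists ((Q1 : 'M[R]_n.+1) *m H), (d1 : 'rV[R]_n.+1); split.
  rewrite trmx_mul mulmxA -[_ *m H *m _]mulmxA HH mulmx1; exact: QQ1.
have HH' : H^T *m H = 1%:M by exact: mulmx1C.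
have -> : B = H^T *m A *m H.
  by rewrite AE0 !mulmxA HH' mul1mx -mulmxA HH' mulmx1.
have -> : A = (Q1 : 'M[R]_n.+1)^T *m diag_mx (d1 : 'rV[R]_n.+1) *m Q1 by exact: AQ.
by rewrite trmx_mul !mulmxA.
Qed.

End Spectral.

(** * Determinants of I + i B and of its borderings *)

Section Angles.
Context {R : realType}.
Local Notation C := R[i].
Local Notation cmx := (map_mx (real_complex R)).
Local Open Scope complex_scope.

Lemma char_poly_conj (F : fieldType) n (Q D : 'M[F]_n) : Q *m Q^T = 1%:M ->
  char_poly (Q^T *m D *m Q) = char_poly D.
Proof.
move=> QQ; have QQ' := mulmx1C QQ.
rewrite /char_poly /char_poly_mx !map_mxM /=; set P := map_mx polyC Q.
have PP : P *m map_mx polyC Q^T = 1%:M by rewrite -map_mxM QQ map_mx1.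
have PP' : map_mx polyC Q^T *m P = 1%:M by exact: mulmx1C.
have -> : 'X%:M - map_mx polyC Q^T *m map_mx polyC D *m P =
    map_mx polyC Q^T *m ('X%:M - map_mx polyC D) *m P.
  by rewrite mulmxBr mulmxBl mul_mx_scalar -scalemxAl PP' scalemx1.
rewrite !det_mulmx mulrAC -det_mulmx PP' det1 mul1r //.
Qed.

Lemma complex_mx_diagonalizes n (Q : 'M[R]_n) d B : diagonalizes Q d B ->
  complex_mx Q *m (complex_mx Q)^T = 1%:M /\
  complex_mx B = (complex_mx Q)^T *m diag_mx (map_mx (real_complex R) d) *m complex_mx Q.
Proof.
move=> [QQ ->]; rewrite /complex_mx; split.
  by rewrite map_trmx -map_mxM QQ map_mx1.
by rewrite !map_mxM map_diag_mx map_trmx.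
Qed.

(** The roots of the characteristic polynomial are unique up to order, so every diagonalization
    computes the same angle. *)
Lemma lagrangian_angle_diag n (Q : 'M[R]_n) d B : diagonalizes Q d B ->
  lagrangian_angle B = \sum_i atan (d 0 i).
Proof.
move/complex_mx_diagonalizes => [QQ BE].
have : char_poly (complex_mx B) = \prod_(z <- [seq (d 0 i)%:C | i <- enum 'I_n]) ('X - z%:P).
  rewrite BE char_poly_conj // char_poly_trig ?diag_mx_is_trig // big_map big_enum /=.
  by apply: eq_bigr => i _; rewrite !mxE eqxx mulr1n.
rewrite char_poly_eigenvalues => /prod_XsubC_eq E.
rewrite /lagrangian_angle (perm_big _ E) big_map big_enum /=.
by apply: eq_bigr.
Qed.

(** Both sides are the characteristic polynomial at -s, up to the sign (-1)^n. *)
Lemma prod_eigenvalues_shift n (M : 'M[C]_n) (s : C) :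
  \prod_(z <- eigenvalues M) (z + s) = \det (s%:M + M).
Proof.
have : (char_poly M).[- s] = \det (- (s%:M + M)).
  rewrite /char_poly -horner_evalE -det_map_mx; congr (\det _).
  by apply/matrixP => i j; rewrite !mxE /= /horner_eval !hornerE hornerMn hornerX opprD mulNrn.
rewrite char_poly_eigenvalues horner_prod -[- (s%:M + M)]scaleN1r detZ.
have -> : \prod_(z <- eigenvalues M) ('X - z%:P).[- s] =
    (-1) ^+ n * \prod_(z <- eigenvalues M) (z + s).
  have sz : size (eigenvalues M) = n.
    apply: succn_inj; rewrite -(size_char_poly M) char_poly_eigenvalues.
    by rewrite size_prod_XsubC.
  rewrite -[in (-1) ^+ n]sz.
  elim: (eigenvalues M) => [|z l IH]; first by rewrite !big_nil mulr1.
  rewrite !big_cons IH /= exprS hornerXsubC -opprD [s + z]addrC.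
  by rewrite mulN1r !mulNr mulrCA.
by apply: mulfI; rewrite signr_eq0.
Qed.

(* [(1 + s) I + i B] *)
Definition shifted n (B : 'M[R]_n) (s : R) : 'M[C]_n :=
  (1 + s)%:C%:M + (0 +i* 1) *: complex_mx B.

Definition shifted_eig n (d : 'rV[R]_n) (s : R) : 'rV[C]_n :=
  \row_i ((1 + s) +i* d 0 i).

Lemma shifted_diag n (Q : 'M[R]_n) d B s : diagonalizes Q d B ->
  shifted B s = (complex_mx Q)^T *m diag_mx (shifted_eig d s) *m complex_mx Q.
Proof.
move/complex_mx_diagonalizes => [QQ BE]; have QQ' := mulmx1C QQ.
have -> : diag_mx (shifted_eig d s) =
    (1 + s)%:C%:M + (0 +i* 1) *: diag_mx (map_mx (real_complex R) d).
  apply/matrixP => i j; rewrite !mxE; case: eqP => [->|_]; last by rewrite !mulr0n mulr0 addr0.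
  by rewrite !mulr1n; apply/eqP; rewrite eq_complex /=; apply/andP; split; apply/eqP; ring.
rewrite /shifted BE mulmxDr mulmxDl mul_mx_scalar -scalemxAl QQ' scalemx1.
by rewrite -scalemxAr -scalemxAl.
Qed.

Lemma det_shifted n (Q : 'M[R]_n) d B s : diagonalizes Q d B ->
  \det (shifted B s) = \prod_i ((1 + s) +i* d 0 i).
Proof.
move=> h; rewrite (shifted_diag s h); have [QQ _] := complex_mx_diagonalizes h.
rewrite !det_mulmx mulrAC -det_mulmx (mulmx1C QQ) det1 mul1r det_diag.
by apply: eq_bigr => i _; rewrite mxE.
Qed.

(** This is a ((1 + s) I + i B)^-1 a^T, where [c] lists the eigenvalues of B and y = a Q^T the
    coordinates of a in the eigenbasis. *)
Definition resolvent_form n (c y : 'rV[R]_n) (s : R) : C :=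
  \sum_k (y 0 k ^+ 2)%:C / ((1 + s) +i* c 0 k).

(** Elimination of the lower block; the two factors i of the border multiply to -1, so the resolvent
    term is added to [delta] rather than subtracted. *)
Lemma det_bordered n (Q : 'M[R]_n) c B (a : 'rV[R]_n) (s : R) (delta : C) :
  diagonalizes Q c B -> 0 <= s ->
  \det (block_mx delta%:M ((0 +i* 1) *: cmx a) ((0 +i* 1) *: cmx a^T)
          (shifted B s)) =
  \prod_k ((1 + s) +i* c 0 k) * (delta + resolvent_form c (a *m Q^T) s).
Proof.
move=> h s0; have [QQ _] := complex_mx_diagonalizes h; have QQ' := mulmx1C QQ.
have s1 : 0 < 1 + s by lra.
have en k : ((1 + s) +i* c 0 k) != 0.
  by rewrite eq_complex /= negb_and gt_eqF.
pose W : 'M[C]_n := (complex_mx Q)^T *m diag_mx (\row_k ((1 + s) +i* c 0 k)^-1) *m complex_mx Q.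
have SW : shifted B s *m W = 1%:M.
  rewrite (shifted_diag s h) /W !mulmxA.
  rewrite -[_ *m complex_mx Q *m _]mulmxA QQ mulmx1.
  rewrite -[X in X *m _]mulmxA mulmx_diag.
  rewrite (_ : diag_mx _ = 1%:M) ?mulmx1 //.
  by apply/matrixP => i j; rewrite !mxE mulfV.
have Su : shifted B s \in unitmx by have /mulmx1_unit[] := SW.
have WE : invmx (shifted B s) = W.
  by rewrite -[LHS]mulmx1 -SW mulKmx.
rewrite det_schur // (det_shifted s h) WE; congr (_ * (_ + _)).
rewrite -scalemxAl -scalemxAr -scalemxAl scalerA.
have -> : (0 +i* 1) * (0 +i* 1) = -1 :> C.
  by apply/eqP; rewrite eq_complex /=; apply/andP; split; apply/eqP; ring.
rewrite scaleN1r [X in - X]mxE opprK /W.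
have -> : cmx a *m ((complex_mx Q)^T *m diag_mx (\row_k ((1 + s) +i* c 0 k)^-1) *m
    complex_mx Q) *m cmx a^T =
    cmx (a *m Q^T) *m diag_mx (\row_k ((1 + s) +i* c 0 k)^-1) *m (cmx (a *m Q^T))^T.
  by rewrite /complex_mx !map_trmx !trmx_mul !trmxK !map_mxM !mulmxA.
rewrite mxE /resolvent_form; apply: eq_bigr => k _.
rewrite mul_mx_diag !mxE -mulrA [_^-1 * _]mulrC mulrA; congr (_ / _).
by rewrite expr2 rmorphM.
Qed.

Lemma resolvent_formE n (c y : 'rV[R]_n) (s : R) : 0 <= s ->
  resolvent_form c y s =
  (\sum_k y 0 k ^+ 2 * (1 + s) / ((1 + s) ^+ 2 + c 0 k ^+ 2)) +i*
  (- \sum_k y 0 k ^+ 2 * c 0 k / ((1 + s) ^+ 2 + c 0 k ^+ 2)).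
Proof.
move=> s0; apply/eqP; rewrite eq_complex !raddf_sum /=.
by apply/andP; split; apply/eqP; apply: eq_bigr => k _ /=; ring.
Qed.

End Angles.

(** * Angles of bordered matrices *)

Section Borders.
Context {R : realType}.
Local Notation C := R[i].
Local Notation cmx := (map_mx (real_complex R)).
Local Open Scope complex_scope.

(** The eigenvalues of I + i B when [d] lists those of B. Their arguments are the atan of the
    eigenvalues of B, so the Lagrangian angle is a sum of arguments too. *)
Definition one_plus_i n (d : 'rV[R]_n) : seq C := [seq 1 +i* d 0 i | i <- enum 'I_n].

Lemma prod_one_plus_i n (d : 'rV[R]_n) (s : R) :
  \prod_(z <- one_plus_i d) (z + s%:C) = \prod_i ((1 + s) +i* d 0 i).
Proof.
rewrite big_map big_enum /=; apply: eq_bigr => i _.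
by apply/eqP; rewrite eq_complex /= addr0 !eqxx.
Qed.

Lemma sum_arg_one_plus_i n (d : 'rV[R]_n) :
  \sum_(z <- one_plus_i d) arg z = \sum_i atan (d 0 i).
Proof.
by rewrite big_map big_enum /=; apply: eq_bigr => i _; rewrite arg_right // divr1.
Qed.

Lemma one_plus_i_neq0 n (d : 'rV[R]_n) (s : R) z : 0 <= s ->
  z \in one_plus_i d -> z + s%:C != 0.
Proof.
move=> s0 /mapP[i _ ->]; rewrite eq_complex /= negb_and gt_eqF //.
by rewrite ltr_wpDr.
Qed.

Lemma shifted_block n (beta : R) (b : 'rV[R]_n) B s :
  shifted (block_mx beta%:M b b^T B) s =
  block_mx (((1 + s) +i* beta)%:M) ((0 +i* 1) *: cmx b) ((0 +i* 1) *: cmx b^T)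
    (shifted B s).
Proof.
rewrite /shifted /complex_mx map_block_mx scale_block_mx scalar_mx_block add_block_mx !add0r.
congr block_mx; apply/matrixP => i j; rewrite !ord1 !mxE eqxx !mulr1n.
by apply/eqP; rewrite eq_complex /=; apply/andP; split; apply/eqP; ring.
Qed.

Lemma sym_block n (beta : R) (b : 'rV[R]_n) B : B^T = B ->
  (block_mx beta%:M b b^T B)^T = block_mx beta%:M b b^T B.
Proof. by move=> sB; rewrite tr_block_mx trmxK sB tr_scalar_mx. Qed.

Lemma diagonalizes_sym n (Q : 'M[R]_n) d B : diagonalizes Q d B -> B^T = B.
Proof. by move=> [_ ->]; rewrite !trmx_mul trmxK tr_diag_mx mulmxA. Qed.

(** [re_form] is the real part of [resolvent_form], and [im_form] is minus its imaginary part. *)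
Definition re_form n (c y : 'rV[R]_n) s :=
  \sum_k y 0 k ^+ 2 * (1 + s) / ((1 + s) ^+ 2 + c 0 k ^+ 2).
Definition im_form n (c y : 'rV[R]_n) s :=
  \sum_k y 0 k ^+ 2 * c 0 k / ((1 + s) ^+ 2 + c 0 k ^+ 2).

Lemma form_den_gt0 (s x : R) : 0 <= s -> 0 < (1 + s) ^+ 2 + x ^+ 2.
Proof. by move=> s0; rewrite ltr_wpDr ?sqr_ge0 // exprn_gt0 // ltr_wpDr. Qed.

Lemma re_form_ge0 n (c y : 'rV[R]_n) s : 0 <= s -> 0 <= re_form c y s.
Proof.
move=> s0; apply: sumr_ge0 => k _; apply: divr_ge0; last exact: ltW (form_den_gt0 _ s0).
by rewrite mulr_ge0 ?sqr_ge0 // addr_ge0.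
Qed.

Lemma re_form_gt0 n (c y : 'rV[R]_n) s : 0 <= s -> y != 0 -> 0 < re_form c y s.
Proof.
move=> s0 y0; rewrite lt_def re_form_ge0 // andbT.
apply: contraNneq y0 => /eqP; rewrite psumr_eq0; last first.
  move=> k _; apply: divr_ge0; last exact: ltW (form_den_gt0 _ s0).
  by rewrite mulr_ge0 ?sqr_ge0 // addr_ge0.
move/allP => h; apply/eqP/rowP => k; rewrite mxE.
have := h k (mem_index_enum _); rewrite mulf_eq0 invr_eq0.
rewrite (gt_eqF (form_den_gt0 _ s0)) orbF mulf_eq0 sqrf_eq0.
by rewrite [1 + s == 0]gt_eqF ?ltr_wpDr // orbF => /eqP.
Qed.

(** By [det_bordered] the ratio of the shifted determinants is 1 + s + i beta plus the resolvent
    term. Its real part is positive, so [sum_arg_ratio] applies. *)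
Lemma lagrangian_angle_border n (Q : 'M[R]_n) c B (beta : R) (b : 'rV[R]_n) :
  diagonalizes Q c B ->
  lagrangian_angle (block_mx beta%:M b b^T B) = lagrangian_angle B +
    atan ((beta - im_form c (b *m Q^T) 0) / (1 + re_form c (b *m Q^T) 0)).
Proof.
move=> h; have [U [l hU]] := symmetric_diagonalizes (sym_block beta b (diagonalizes_sym h)).
rewrite (lagrangian_angle_diag hU) (lagrangian_angle_diag h) -!sum_arg_one_plus_i.
pose rho s := ((1 + s) +i* beta) + resolvent_form c (b *m Q^T) s.
have rhoE s : 0 <= s -> rho s = (1 + s + re_form c (b *m Q^T) s) +i* (beta - im_form c (b *m Q^T) s).
  by move=> s0; rewrite /rho resolvent_formE.
have rp s : 0 <= s -> 0 < 1 + s + re_form c (b *m Q^T) s.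
  by move=> s0; have := re_form_ge0 c (b *m Q^T) s0; lra.
rewrite (@sum_arg_ratio R _ (one_plus_i c) rho).
- by rewrite rhoE // arg_right ?addr0 //; have := rp 0 (lexx 0); rewrite addr0.
- by move=> s z s0; exact: one_plus_i_neq0.
- by move=> s z s0; exact: one_plus_i_neq0.
- by move=> s s0; rewrite rhoE // /slit /= rp ?orbT.
- move=> s s0; rewrite !prod_one_plus_i -(det_shifted s hU) shifted_block.
  by rewrite (det_bordered _ _ h s0).
Qed.

Lemma space_block_mx n (alpha : R) (a : 'rV[R]_n) B :
  space_block (block_mx alpha%:M a a^T B) = B.
Proof. exact: block_mxKdr. Qed.

Lemma degenerate_block n (alpha : R) (a : 'rV[R]_n) B :
  degenerate (block_mx alpha%:M a a^T B) = (alpha == 0) && (a == 0).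
Proof.
rewrite /degenerate space_block_mx; apply/eqP/andP => [/eq_block_mx[E1 E2 _ _]|[/eqP-> /eqP->]].
  split; last exact/eqP.
  by have := congr1 (fun M : 'M[R]_1 => M 0 0) E1; rewrite !mxE eqxx mulr1n => ->.
by rewrite trmx0; congr block_mx; apply/matrixP => i j; rewrite !mxE mul0rn.
Qed.

Lemma mulmx_orthogonal_eq0 n (Q : 'M[R]_n) (a : 'rV[R]_n) :
  Q *m Q^T = 1%:M -> (a *m Q^T == 0) = (a == 0).
Proof.
move=> QQ; apply/eqP/eqP => [E|->]; last by rewrite mul0mx.
by rewrite -[a]mulmx1 -(mulmx1C QQ) mulmxA E mul0mx.
Qed.

Lemma shift_block_space_time n (alpha : R) (a : 'rV[R]_n) B (s : R) :
  s%:C%:M + \matrix_(i, j) (space_id n i j +i* block_mx alpha%:M a a^T B i j) =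
  block_mx (s +i* alpha)%:M ((0 +i* 1) *: cmx a) ((0 +i* 1) *: cmx a^T) (shifted B s).
Proof.
have -> : \matrix_(i, j) (space_id n i j +i* block_mx alpha%:M a a^T B i j) =
    cmx (space_id n) + (0 +i* 1) *: cmx (block_mx alpha%:M a a^T B).
  apply/matrixP => i j; rewrite !mxE.
  by apply/eqP; rewrite eq_complex /=; apply/andP; split; apply/eqP; ring.
rewrite /space_id !map_block_mx scale_block_mx !map_mx0 map_mx1.
rewrite scalar_mx_block !add_block_mx !add0r; congr block_mx.
  apply/matrixP => i j; rewrite !ord1 !mxE eqxx !mulr1n.
  by apply/eqP; rewrite eq_complex /=; apply/andP; split; apply/eqP; ring.
rewrite /shifted addrA; congr (_ + _); apply/matrixP => i j; rewrite !mxE.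
by case: eqP => _; rewrite ?mulr0n ?addr0 // !mulr1n rmorphD addrC.
Qed.

(** The ratio is now s + i alpha plus the resolvent term. If a is nonzero its real part is positive;
    if a = 0 its imaginary part is alpha, nonzero off the degenerate matrices. *)
Lemma spacetime_angle_border n (Q : 'M[R]_n) c B (alpha : R) (a : 'rV[R]_n) :
  diagonalizes Q c B -> (alpha != 0) || (a != 0) ->
  spacetime_angle (block_mx alpha%:M a a^T B) = lagrangian_angle B +
    arg (re_form c (a *m Q^T) 0 +i* (alpha - im_form c (a *m Q^T) 0)).
Proof.
move=> h nd; rewrite /spacetime_angle degenerate_block.
rewrite (negbTE (_ : ~~ ((alpha == 0) && (a == 0)))) ?negb_and //.
pose rho s := (s +i* alpha) + resolvent_form c (a *m Q^T) s.
have rhoE s : 0 <= s -> rho s = (s + re_form c (a *m Q^T) s) +i* (alpha - im_form c (a *m Q^T) s).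
  by move=> s0; rewrite /rho resolvent_formE.
set M := \matrix_(i, j) _.
have prodE s : 0 <= s -> \prod_(z <- eigenvalues M) (z + s%:C) =
    \prod_(w <- one_plus_i c) (w + s%:C) * rho s.
  move=> s0; rewrite prod_eigenvalues_shift shift_block_space_time.
  by rewrite (det_bordered _ _ h s0) prod_one_plus_i.
have rho_slit s : 0 <= s -> slit (rho s).
  move=> s0; rewrite rhoE // /slit /=.
  have [a0|a0] := eqVneq a 0; last first.
    by rewrite ltr_wpDl ?orbT // re_form_gt0 // mulmx_orthogonal_eq0 ?h.1.
  move: nd; rewrite a0 eqxx orbF mul0mx => nd.
  rewrite [im_form _ _ _]big1 ?subr0 ?nd // => k _.
  by rewrite mxE expr0n mul0r mul0r.
have ws0 s z : 0 <= s -> z \in one_plus_i c -> z + s%:C != 0.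
  by move=> s0; exact: one_plus_i_neq0.
rewrite (@sum_arg_ratio R _ (one_plus_i c) rho) //.
- by rewrite sum_arg_one_plus_i (lagrangian_angle_diag h) rhoE // add0r.
(* The factorization of the determinant also shows that no eigenvalue of I_n + i A lies on the
   closed negative axis. *)
move=> s z s0 zi; have : \prod_(z <- eigenvalues M) (z + s%:C) != 0.
  rewrite prodE // mulf_neq0 //.
    by rewrite prodf_seq_neq0; apply/allP => w /ws0 ->.
  by have := rho_slit _ s0; apply: contraTneq => ->; rewrite /slit /= eqxx ltxx.
by rewrite prodf_seq_neq0 => /allP /(_ _ zi).
Qed.

(* [block_mx alpha a a^T B] with [alpha] replaced by the imaginary pivot
   [i alpha], eliminated first. *)
Lemma lagrangian_angle_schur n (B : 'M[R]_n) (alpha : R) (a : 'rV[R]_n) :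
  B^T = B -> 0 < alpha ->
  spacetime_angle (block_mx alpha%:M a a^T B) =
  lagrangian_angle (B - alpha^-1 *: (a^T *m a)) + pi / 2.
Proof.
move=> sB a_gt0; have [Q [c h]] := symmetric_diagonalizes sB.
rewrite (spacetime_angle_border h) ?gt_eqF //.
have pp := @pi_gt0 R.
have [a0|a0] := eqVneq a 0.
  rewrite a0 trmx0 mul0mx mul0mx scaler0 subr0; congr (_ + _).
  rewrite [im_form _ _ _]big1 => [|k _]; last by rewrite mxE expr0n !mul0r.
  rewrite [re_form _ _ _]big1 => [|k _]; last by rewrite mxE expr0n !mul0r.
  by rewrite slit_arg /slit /= ?subr0 ?gt_eqF // gtr0_sg // mul0r atan0 subr0 mul1r.
set S := B - _.
have sS : S^T = S.
  by rewrite /S linearB /= sB linearZ /= trmx_mul trmxK.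
have [U [l hU]] := symmetric_diagonalizes sS.
set p := re_form c (a *m Q^T) 0; set q := im_form c (a *m Q^T) 0.
have p0 : 0 < p by rewrite re_form_gt0 // mulmx_orthogonal_eq0 ?h.1.
(* The bordered determinant with corner i alpha, the same for all s, divided by this pivot and by
   the determinant of [shifted B s]. *)
pose rho s : C := 1 + resolvent_form c (a *m Q^T) s / (0 +i* alpha).
have rhoE s : 0 <= s -> rho s =
   (1 - im_form c (a *m Q^T) s / alpha) +i* - (re_form c (a *m Q^T) s / alpha).
  move=> s0; rewrite /rho resolvent_formE // -/(re_form _ _ _) -/(im_form _ _ _).
  apply/eqP; rewrite eq_complex /=; apply/andP; split; apply/eqP; field; by rewrite gt_eqF.
have prodE s : 0 <= s -> \prod_(z <- one_plus_i l) (z + s%:C) =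
    \prod_(w <- one_plus_i c) (w + s%:C) * rho s.
  move=> s0; rewrite !prod_one_plus_i -(det_shifted s hU).
  have ia0 : 0 +i* alpha != 0 by rewrite eq_complex /= negb_and (gt_eqF a_gt0) orbT.
  have := det_schurl ((0 +i* 1) *: cmx a) ((0 +i* 1) *: cmx a^T) (shifted B s) ia0.
  rewrite (det_bordered _ _ h s0).
  have -> : shifted B s - (0 +i* alpha)^-1 *: ((0 +i* 1) *: cmx a^T *m ((0 +i* 1) *: cmx a)) =
      shifted S s.
    rewrite /shifted /S /complex_mx -addrA; congr (_ + _).
    rewrite -scalemxAl -scalemxAr !scalerA map_mxB map_mxZ map_mxM scalerBr scalerA.
    congr (_ - _ *: _); apply/eqP; rewrite eq_complex /=.
    by apply/andP; split; apply/eqP; field; rewrite gt_eqF.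
  move=> E; apply: (mulfI ia0); rewrite -E [RHS]mulrCA; congr (_ * _).
  by rewrite /rho mulrDr mulr1 mulrCA divff // mulr1.
have rho_slit s : 0 <= s -> slit (rho s).
  move=> s0; rewrite rhoE // /slit /= oppr_eq0 gt_eqF // divr_gt0 //.
  by rewrite re_form_gt0 // mulmx_orthogonal_eq0 ?h.1.
rewrite (lagrangian_angle_diag hU) -sum_arg_one_plus_i.
rewrite (@sum_arg_ratio R _ (one_plus_i c) rho) //; first last.
- by move=> s z s0; exact: one_plus_i_neq0.
- by move=> s z s0; exact: one_plus_i_neq0.
rewrite sum_arg_one_plus_i (lagrangian_angle_diag h) -addrA; congr (_ + _).
rewrite arg_right // rhoE // -/p -/q.
set g := atan _.
have g1 := atan_gtNpi2 ((alpha - q) / p); have g2 := atan_ltpi2 ((alpha - q) / p).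
rewrite -/g in g1 g2.
have cg : 0 < cos g by rewrite cos_gt0_pihalf // g1.
(* The left side is (p + i (alpha - q)) / (i alpha): the numerator has argument g, and the division
   by i alpha subtracts pi / 2. *)
have -> : (1 - q / alpha) +i* - (p / alpha) = (p / (alpha * cos g))%:C * cis (g - pi / 2).
  have tg : tan g = (alpha - q) / p by exact: atanK.
  have sg : sin g = (alpha - q) / p * cos g.
    by rewrite -tg /tan divfK // gt_eqF.
  rewrite /cis cosBpihalf sinBpihalf; apply/eqP; rewrite eq_complex /= sg.
  by apply/andP; split; apply/eqP; field; rewrite !gt_eqF.
rewrite arg_cis ?subrK //; first by rewrite divr_gt0 // mulr_gt0.
by apply/andP; split; lra.
Qed.

End Borders.

(** * Supporting half-spaces *)

Section Trigonometry.
Context {R : realType}.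
Implicit Types (g e : R).

(* This is [(x - m) / (1 + m ^+ 2)] for [x = cot g] and [m = cot e]. *)
Definition cot_gap g e : R := sin e * sin (e - g) / sin g.

(** The difference of the two sides is the explicit expression in [key]: a square and a multiple of
    1 - cos, both with nonnegative factors. *)
Lemma cot_gap_merge g1 g2 e1 e2 :
  0 < g1 -> 0 < g2 -> g1 + g2 < pi -> 0 < e1 -> 0 < e2 -> e1 + e2 <= pi ->
  cot_gap (g1 + g2) (e1 + e2) <= cot_gap g1 e1 + cot_gap g2 e2.
Proof.
move=> g1p g2p gpi e1p e2p epi.
have a0 : 0 < sin g1 by apply: sin_gt0_pi; apply/andP; split; lra.
have c0 : 0 < sin g2 by apply: sin_gt0_pi; apply/andP; split; lra.
have s0 : 0 < sin (g1 + g2) by apply: sin_gt0_pi; apply/andP; split; lra.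
have x0 : 0 <= sin e1 by apply: sin_ge0_pi; apply/andP; split; lra.
have y0 : 0 <= sin e2 by apply: sin_ge0_pi; apply/andP; split; lra.
have key : cot_gap g1 e1 + cot_gap g2 e2 - cot_gap (g1 + g2) (e1 + e2) =
    ((sin e1 * sin g2 - sin e2 * sin g1) ^+ 2 / (sin g1 * sin g2) +
     2 * (sin e1 * sin e2) * (1 - cos (e1 + e2 - (g1 + g2)))) / sin (g1 + g2).
  have r1 := cos2Dsin2 g1; have r2 := cos2Dsin2 g2.
  have r3 := cos2Dsin2 e1; have r4 := cos2Dsin2 e2.
  have an := lt0r_neq0 a0; have cn := lt0r_neq0 c0; have sn := lt0r_neq0 s0.
  rewrite /cot_gap !(sinB, cosB).
  have sE := sinD g1 g2; have GE := cosD g1 g2.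
  have SE := sinD e1 e2; have CE := cosD e1 e2.
  move: (sin (g1 + g2)) (cos (g1 + g2)) (sin (e1 + e2)) (cos (e1 + e2)) sE GE SE CE s0 sn.
  move: (sin g1) (cos g1) (sin g2) (cos g2) (sin e1) (cos e1) (sin e2) (cos e2) r1 r2 r3 r4 an cn {a0 c0 x0 y0}.
  move=> a b c d x X y Y r1 r2 r3 r4 an cn s G S C sE GE SE CE _ sn.
  (* With the sines and cosines generalized to variables, cot g1 and cot g2 are both expressed
     through cot (g1 + g2); what remains is an identity of rational functions. *)
  have h1 : b / a = G / s + c / (a * s).
    have : b * s - G * a = c by rewrite sE GE -[RHS]mulr1 -r1; ring.
    by move=> <-; field; rewrite an sn.
  have h2 : d / c = G / s + a / (c * s).
    have : d * s - G * c = a by rewrite sE GE -[RHS]mulr1 -r2; ring.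
    by move=> <-; field; rewrite cn sn.
  have S2 : S ^+ 2 = x ^+ 2 + y ^+ 2 + 2 * (x * y) * C.
    rewrite SE CE -[x ^+ 2 in RHS]mulr1 -[in X in _ = X + _ + _]r4.
    by rewrite -[y ^+ 2 in RHS]mulr1 -[in X in _ = _ + X + _]r3; ring.
  have SC : x * X + y * Y = S * (X * Y + x * y).
    rewrite SE -[x * X in LHS]mulr1 -[in X in X + _ = _]r4.
    by rewrite -[y * Y in LHS]mulr1 -[in X in _ + X = _]r3; ring.
  have -> : x * (x * b - X * a) / a + y * (y * d - Y * c) / c - S * (S * G - C * s) / s =
     x ^+ 2 * (b / a) + y ^+ 2 * (d / c) - (x * X + y * Y) - S ^+ 2 * (G / s) + S * C.
    by field; rewrite an cn sn.
  rewrite h1 h2 SC S2 -[S * C]mulr1.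
  have -> : S * (X * Y + x * y) = S * C + 2 * (x * y) * S by rewrite CE; ring.
  by field; rewrite an cn sn.
rewrite -subr_ge0 key divr_ge0 ?(ltW s0) // addr_ge0 //.
  by rewrite divr_ge0 ?sqr_ge0 // mulr_ge0 ?ltW.
by rewrite mulr_ge0 // ?subr_ge0 ?cos_le1 // !mulr_ge0.
Qed.

Lemma cot_gap_sum (p : R * R) (l : seq (R * R)) :
  (forall q, q \in p :: l -> 0 < q.1 /\ 0 < q.2) ->
  \sum_(q <- p :: l) q.1 < pi -> \sum_(q <- p :: l) q.2 <= pi ->
  cot_gap (\sum_(q <- p :: l) q.1) (\sum_(q <- p :: l) q.2) <=
  \sum_(q <- p :: l) cot_gap q.1 q.2.
Proof.
elim: l p => [|p' l IH] p h G H; first by rewrite !big_seq1.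
have [p1 p2] := h p (mem_head _ _).
have h' q : q \in p' :: l -> 0 < q.1 /\ 0 < q.2 by move=> qi; apply: h; rewrite inE qi orbT.
rewrite ![\sum_(q <- p :: _) _]big_cons in G H *.
have pos1 : 0 < \sum_(q <- p' :: l) q.1.
  rewrite big_cons ltr_wpDr ?(h' _ (mem_head _ _)).1 // big_seq sumr_ge0 // => q qi.
  by apply/ltW; apply: (h' _ _).1; rewrite inE qi orbT.
have pos2 : 0 < \sum_(q <- p' :: l) q.2.
  rewrite big_cons ltr_wpDr ?(h' _ (mem_head _ _)).2 // big_seq sumr_ge0 // => q qi.
  by apply/ltW; apply: (h' _ _).2; rewrite inE qi orbT.
apply: (le_trans (cot_gap_merge _ _ _ _ _ _)) => //.
by rewrite lerD2l IH //; lra.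
Qed.

Lemma cot_gap_atan (x m : R) :
  cot_gap (pi / 2 - atan x) (pi / 2 - atan m) = (x - m) / (1 + m ^+ 2).
Proof.
have ca (y : R) : 0 < cos (atan y) by rewrite cos_gt0_pihalf // atan_gtNpi2 atan_ltpi2.
have sa (y : R) : sin (atan y) = y * cos (atan y).
  by have /(congr1 (fun t => t * cos (atan y))) := atanK y; rewrite /tan divfK // gt_eqF.
have c2 (y : R) : cos (atan y) ^+ 2 = (1 + y ^+ 2)^-1.
  have := cos2Dsin2 (atan y); rewrite sa exprMn -[X in X + _]mul1r -mulrDl => E.
  have h : 1 + y ^+ 2 != 0 by rewrite gt_eqF // ltr_wpDr ?sqr_ge0.
  by apply: (mulfI h); rewrite E divff.
rewrite /cot_gap !(sinB, cosB) sin_pihalf cos_pihalf !mul0r !mul1r !subr0 !add0r.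
rewrite -c2 !sa; field; by rewrite gt_eqF.
Qed.

(** Put g_i = pi / 2 - atan x_i and e_i = pi / 2 - atan m_i. The lower bound on the level says that
    the e_i sum to at most pi, so the gaps can be merged into one with 0 < g <= e <= pi, which is
    nonnegative. *)
Lemma atan_level_halfspace n (x m : 'I_n -> R) :
  (n%:R - 2) * (pi / 2) <= \sum_i atan (m i) <= \sum_i atan (x i) ->
  0 <= \sum_i (x i - m i) / (1 + m i ^+ 2).
Proof.
case: n x m => [|n] x m /andP[hm hx]; first by rewrite big_ord0.
have den i : 0 < 1 + m i ^+ 2 by rewrite ltr_wpDr ?sqr_ge0.
(* Raising every x_i by e makes the sum of the g_i strictly less than pi, so that its sine is
   positive. *)
suff step e : 0 < e -> 0 <= \sum_i (x i + e - m i) / (1 + m i ^+ 2).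
  have sE e : \sum_i (x i + e - m i) / (1 + m i ^+ 2) =
      \sum_i (x i - m i) / (1 + m i ^+ 2) + e * \sum_i (1 + m i ^+ 2)^-1.
    rewrite mulr_sumr -big_split; apply: eq_bigr => i _ /=.
    by field; rewrite gt_eqF.
  have k0 : 0 < \sum_i (1 + m i ^+ 2)^-1.
    by rewrite big_ord_recl ltr_wpDr ?invr_gt0 // sumr_ge0 // => i _; rewrite invr_ge0 ltW.
  rewrite leNgt; apply/negP => neg.
  (* This e raises a negative sum to only half of its value, which is still negative. *)
  pose e := - (\sum_i (x i - m i) / (1 + m i ^+ 2)) / (2 * \sum_i (1 + m i ^+ 2)^-1).
  have e0 : 0 < e by rewrite divr_gt0 ?oppr_gt0 // mulr_gt0.
  have := step e e0; rewrite sE /e invfM -!mulrA mulVf ?gt_eqF // mulr1.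
  by move: neg; move: (\sum_i _) => t; lra.
move=> e0.
pose f i := (pi / 2 - atan (x i + e), pi / 2 - atan (m i)).
have -> : \sum_i (x i + e - m i) / (1 + m i ^+ 2) = \sum_i cot_gap (f i).1 (f i).2.
  by apply: eq_bigr => i _; rewrite cot_gap_atan.
have SE (F : R * R -> R) : \sum_i F (f i) = \sum_(q <- f ord0 :: [seq f (lift ord0 i) | i <- enum 'I_n]) F q.
  by rewrite big_ord_recl big_cons big_map big_enum.
have S1 : \sum_i (f i).1 = n.+1%:R * (pi / 2) - \sum_i atan (x i + e).
  by rewrite big_split /= sumrN sumr_const card_ord mulr_natl.
have S2 : \sum_i (f i).2 = n.+1%:R * (pi / 2) - \sum_i atan (m i).
  by rewrite big_split /= sumrN sumr_const card_ord mulr_natl.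
have lt12 : \sum_i (f i).1 < \sum_i (f i).2.
  rewrite S1 S2 ltrD2l ltrN2; apply: (le_lt_trans hx).
  rewrite !big_ord_recl ltr_leD ?lt_atan ?ltrDl //.
  by apply: ler_sum => i _; rewrite le_atan // lerDl ltW.
have le2 : \sum_i (f i).2 <= pi by rewrite S2; lra.
have pos q : q \in f ord0 :: [seq f (lift ord0 i) | i <- enum 'I_n] -> 0 < q.1 /\ 0 < q.2.
  suff P i : 0 < (f i).1 /\ 0 < (f i).2.
    by rewrite inE => /predU1P[->|/mapP[i _ ->]]; exact: P.
  by rewrite /f /= !subr_gt0; split; exact: atan_ltpi2.
have := cot_gap_sum pos; rewrite -!SE => /(_ (lt_le_trans lt12 le2) le2).
apply: le_trans.
have g0 : 0 < \sum_i (f i).1.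
  rewrite SE big_cons ltr_wpDr ?(pos _ (mem_head _ _)).1 // big_seq sumr_ge0 // => q qi.
  by apply/ltW; apply: (pos _ _).1; rewrite inE qi orbT.
rewrite /cot_gap divr_ge0 //; last first.
  by apply: sin_ge0_pi; apply/andP; split; lra.
by rewrite mulr_ge0 //; apply: sin_ge0_pi; apply/andP; split; lra.
Qed.

End Trigonometry.

(** * Half-spaces containing the subequation *)

Section MatrixInequalities.
Context {R : realType}.

Lemma pi_half_gt0 : 0 < pi / 2 :> R.
Proof. by rewrite divr_gt0 // pi_gt0. Qed.

(** Each atan is strictly below pi / 2, so equality occurs only for the empty sum, that is, for n =
    1. *)
Lemma sum_atan_others n (c : 'rV[R]_n) k :
  \sum_(i | i != k) atan (c 0 i) <= (n%:R - 1) * (pi / 2) ?= iff (n == 1%N).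
Proof.
have card : #|[pred i : 'I_n | i != k]| = n.-1.
  by rewrite -[RHS](congr1 predn (card_ord n)) -(cardC1 k); apply: eq_card.
case: n c k card => [c []//|n] c k card.
have -> : (n.+1%:R - 1) * (pi / 2) = \sum_(i | i != k) (pi / 2 : R).
  by rewrite sumr_const card /= -natr1 addrK mulr_natl.
split; first by apply: ler_sum => i _; apply/ltW/atan_ltpi2.
rewrite eqSS; case: n c k card => [|n] c k card.
  by rewrite !big_pred0 ?eqxx // => i; rewrite !ord1 eqxx.
apply/negbTE; rewrite lt_eqF //.
have [j jk] : exists j : 'I_n.+2, j != k.
  have /card_gt0P[j hj] : (0 < #|[pred i : 'I_n.+2 | i != k]|)%N by rewrite card.
  by exists j.
rewrite (bigD1 j) //= [ltRHS](bigD1 j) //= ltr_leD ?atan_ltpi2 //.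
by apply: ler_sum => i _; apply/ltW/atan_ltpi2.
Qed.

(** If c_k + r < 0 then atan c_k + atan r < 0, and the other n - 1 terms cannot make up for it. *)
Lemma atan_sum_le n (c : 'rV[R]_n) r :
  (n%:R - 1) * (pi / 2) <= \sum_i atan (c 0 i) + atan r -> forall k, 0 <= c 0 k + r.
Proof.
move=> h k; rewrite -lerBlDr sub0r leNgt; apply/negP => /lt_atan.
rewrite atanN => lt; move: h; rewrite (bigD1 k) //= leNgt => /negP; apply.
by have := (sum_atan_others c k).1; lra.
Qed.

(** For n >= 2 the other terms lose strictly. For n = 1 there are none, and strictness must come
    from the hypothesis: atan c + atan (- c) = 0 attains the bound. *)
Lemma atan_sum_lt n (c : 'rV[R]_n) r :
  (2 <= n)%N \/ (n%:R - 1) * (pi / 2) < \sum_i atan (c 0 i) + atan r ->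
  (n%:R - 1) * (pi / 2) <= \sum_i atan (c 0 i) + atan r -> forall k, 0 < c 0 k + r.
Proof.
move=> hs h k; rewrite -ltrBlDr sub0r ltNge; apply/negP => /le_atan.
rewrite atanN => le; move: h hs; rewrite (bigD1 k) //= => h [n2|lt].
  have : \sum_(i | i != k) atan (c 0 i) < (n%:R - 1) * (pi / 2).
    by rewrite (lt_leif (sum_atan_others c k)); case: n n2 {c k h le} => [|[]].
  lra.
by have := (sum_atan_others c k).1; lra.
Qed.

(** The combination is the sum of y_k^2 (c_k + r) / (1 + c_k^2). *)
Lemma im_re_form_ge0 n (c y : 'rV[R]_n) r : (forall k, 0 <= c 0 k + r) ->
  0 <= im_form c y 0 + r * re_form c y 0.
Proof.
move=> h; rewrite mulr_sumr -big_split sumr_ge0 // => k _ /=.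
have -> : y 0 k ^+ 2 * c 0 k / ((1 + 0) ^+ 2 + c 0 k ^+ 2) +
    r * (y 0 k ^+ 2 * (1 + 0) / ((1 + 0) ^+ 2 + c 0 k ^+ 2)) =
    y 0 k ^+ 2 * (c 0 k + r) / ((1 + 0) ^+ 2 + c 0 k ^+ 2) by ring.
apply: divr_ge0; last exact: ltW (form_den_gt0 _ (lexx 0)).
by rewrite mulr_ge0 ?sqr_ge0.
Qed.

Lemma im_re_form_gt0 n (c y : 'rV[R]_n) r : (forall k, 0 < c 0 k + r) -> y != 0 ->
  0 < im_form c y 0 + r * re_form c y 0.
Proof.
move=> h y0; rewrite lt_def im_re_form_ge0 ?andbT; last by move=> k; apply: ltW.
apply: contraNneq y0; rewrite mulr_sumr -big_split /= => /eqP.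
have E k : y 0 k ^+ 2 * c 0 k / ((1 + 0) ^+ 2 + c 0 k ^+ 2) +
    r * (y 0 k ^+ 2 * (1 + 0) / ((1 + 0) ^+ 2 + c 0 k ^+ 2)) =
    y 0 k ^+ 2 * (c 0 k + r) / ((1 + 0) ^+ 2 + c 0 k ^+ 2) by ring.
under eq_bigr => k _ do rewrite E.
rewrite psumr_eq0 => [|k _]; last first.
  apply: divr_ge0; last exact: ltW (form_den_gt0 _ (lexx 0)).
  by rewrite mulr_ge0 ?sqr_ge0 // ltW.
move/allP => hk; apply/eqP/rowP => k; rewrite mxE.
have := hk k (mem_index_enum _); rewrite mulf_eq0 invr_eq0.
rewrite (gt_eqF (form_den_gt0 _ (lexx 0))) orbF mulf_eq0 sqrf_eq0.
by rewrite (gt_eqF (h k)) orbF => /eqP.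
Qed.

Lemma lagrangian_angle_lt n (B : 'M[R]_n.+1) : B^T = B ->
  lagrangian_angle B < n.+1%:R * (pi / 2).
Proof.
move=> sB; have [Q [d h]] := symmetric_diagonalizes sB.
rewrite (lagrangian_angle_diag h) big_ord_recl -natr1 mulrDl mul1r addrC.
rewrite ler_ltD ?atan_ltpi2 //.
rewrite mulr_natl -[X in _ *+ X]card_ord -sumr_const.
by apply: ler_sum => i _; apply/ltW/atan_ltpi2.
Qed.

Lemma lagrangian_angle_gt n (B : 'M[R]_n.+1) : B^T = B ->
  - (n.+1%:R * (pi / 2)) < lagrangian_angle B.
Proof.
move=> sB; have [Q [d h]] := symmetric_diagonalizes sB.
rewrite ltrNl (lagrangian_angle_diag h) -sumrN big_ord_recl -natr1 mulrDl mul1r addrC.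
have lt x : - atan x < pi / 2 :> R by rewrite ltrNl atan_gtNpi2.
rewrite ler_ltD //.
rewrite mulr_natl -[X in _ *+ X]card_ord -sumr_const.
by apply: ler_sum => i _; apply/ltW.
Qed.

Lemma symmetric_blockE n (A : 'M[R]_(1 + n)) : A^T = A ->
  A = block_mx (A 0 0)%:M (ursubmx A) (ursubmx A)^T (drsubmx A).
Proof.
move=> sA; rewrite -{1}[A]submxK; congr block_mx.
  by rewrite [LHS]mx11_scalar !mxE; congr ((A _ _)%:M); exact: val_inj.
by rewrite trmx_ursub sA.
Qed.

(* Pinching off one row and column does not decrease the angle: in the border
   formula the numerator [beta - im_form] is at most [beta * (1 + re_form)]. *)
Lemma lagrangian_angle_le_diag n (B : 'M[R]_n) : B^T = B ->
  (n%:R - 2) * (pi / 2) <= lagrangian_angle B ->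
  lagrangian_angle B <= \sum_i atan (B i i).
Proof.
elim: n B => [|n IH] B sB hB.
  have [Q [d h]] := symmetric_diagonalizes sB.
  by rewrite (lagrangian_angle_diag h) !big_ord0.
move: sB hB; change ('M[R]_(1 + n)) in B => sB hB.
set C := drsubmx B; set b := ursubmx B.
have sC : C^T = C by rewrite /C trmx_drsub sB.
have [Q [c h]] := symmetric_diagonalizes sC.
have BE := symmetric_blockE sB; rewrite -/C -/b in BE.
have := lagrangian_angle_border (B 0 0) b h; rewrite -BE.
set p := re_form _ _ _; set q := im_form _ _ _; set r := (_ - _) / _ => E.
have p0 : 0 <= p by exact: re_form_ge0.
have hr : B 0 0 = q + r * p + r.
  have : r * (1 + p) = B 0 0 - q by rewrite /r divfK // gt_eqF // ltr_wpDr.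
  lra.
(* In size n + 1 the hypothesis reads (n - 1) pi / 2 <= angle of C + atan r, exactly what
   [atan_sum_le] asks for. Hence r is at most the corner entry. *)
have cr : 0 <= q + r * p.
  apply/im_re_form_ge0/atan_sum_le; rewrite -(lagrangian_angle_diag h) -E.
  by apply: le_trans hB; rewrite -[n.+1%:R]natr1; lra.
(* Dropping atan r < pi / 2 passes the threshold from size n + 1 to size n. *)
have hC : (n%:R - 2) * (pi / 2) <= lagrangian_angle C.
  have := atan_ltpi2 r; move: hB; rewrite E -natr1; lra.
have -> : \sum_i atan (B i i) = atan (B 0 0) + \sum_i atan (C i i).
  rewrite big_ord_recl; congr (_ + _); apply: eq_bigr => i _.
  by rewrite /C !mxE; congr (atan (B _ _)); exact: val_inj.
rewrite E addrC lerD ?IH // le_atan // hr; lra.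
Qed.

Lemma diagonalizes_conj n (Q U : 'M[R]_n) d B : diagonalizes Q d B ->
  U *m U^T = 1%:M -> diagonalizes (Q *m U^T) d (U *m B *m U^T).
Proof.
move=> [QQ BE] UU; have UU' := mulmx1C UU.
split; first by rewrite trmx_mul trmxK mulmxA -[Q *m _ *m U]mulmxA UU' mulmx1.
by rewrite BE trmx_mul trmxK !mulmxA.
Qed.

Lemma lagrangian_angle_halfspace n (B Q : 'M[R]_n) (m : 'I_n -> R) :
  B^T = B -> Q *m Q^T = 1%:M ->
  (n%:R - 2) * (pi / 2) <= \sum_i atan (m i) <= lagrangian_angle B ->
  0 <= \sum_i ((Q *m B *m Q^T) i i - m i) / (1 + m i ^+ 2).
Proof.
move=> sB QQ /andP[h1 h2].
have [U [d h]] := symmetric_diagonalizes sB.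
have h' := diagonalizes_conj h QQ.
have angE : lagrangian_angle (Q *m B *m Q^T) = lagrangian_angle B.
  by rewrite (lagrangian_angle_diag h) (lagrangian_angle_diag h').
apply: atan_level_halfspace; rewrite h1 /= -angE in h2 *.
apply: (le_trans h2); apply: lagrangian_angle_le_diag.
  exact: diagonalizes_sym h'.
exact: le_trans h2.
Qed.

(** Suppose the corner is negative. If a = 0, its argument is -pi / 2, and the spatial angle would
    have to reach n pi / 2. Otherwise the border term is atan r with r p = A 0 0 - q, and
    [atan_sum_le] gives q + r p >= 0. *)
Lemma calF_time_ge0 n c (A : 'M[R]_(1 + n)) : (1 <= n)%N ->
  (n%:R - 1) / 2 * pi <= c -> calF c A -> 0 <= A 0 0.
Proof.
move=> n1 hc [sA hA].
set a := ursubmx A; set B := drsubmx A.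
have sB : B^T = B by rewrite /B trmx_drsub sA.
have [Q [d h]] := symmetric_diagonalizes sB.
have AE := symmetric_blockE sA; rewrite -/a -/B in AE.
rewrite leNgt; apply/negP => neg.
have := spacetime_angle_border (alpha := A 0 0) (a := a) h; rewrite -AE lt_eqF // => /(_ isT) E.
rewrite E in hA.
have [a0|a0] := eqVneq a 0.
  have S0 (f : 'I_n -> R) : \sum_k (a *m Q^T) 0 k ^+ 2 * f k / ((1 + 0) ^+ 2 + d 0 k ^+ 2) = 0.
    by apply: big1 => k _; rewrite a0 mul0mx mxE expr0n !mul0r.
  move: hA; rewrite /re_form /im_form !S0 subr0 slit_arg /slit /= ?lt_eqF //.
  rewrite ltr0_sg // mul0r atan0 subr0.
  case: n n1 A sA a B sB Q d h AE neg hc E a0 S0 => // n _ A sA a B sB Q d h AE neg hc E a0 S0.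
  by have := lagrangian_angle_lt sB; rewrite -[n.+1%:R]natr1 in hc *; lra.
move: hA; rewrite arg_right; last by rewrite re_form_gt0 // mulmx_orthogonal_eq0 ?h.1.
set p := re_form _ _ _; set q := im_form _ _ _; set r := (_ - _) / _ => hA.
have p0 : 0 < p by rewrite re_form_gt0 // mulmx_orthogonal_eq0 ?h.1.
have rp : r * p = A 0 0 - q by rewrite /r divfK // gt_eqF.
have : 0 <= q + r * p.
  apply/im_re_form_ge0/atan_sum_le; rewrite -(lagrangian_angle_diag h).
  by apply: le_trans hA; lra.
by rewrite rp; lra.
Qed.

(** In each possible case a spatial matrix S of angle at least c - pi / 2 bounds the form of A from
    below, whatever the time components b_i: the Schur complement if A 0 0 > 0, the spatial block if
    A is degenerate. The alternative [2 <= n] or [0 < c] excludes A 0 0 = 0 with a nonzero, where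
    the form would be unbounded below in b. *)
Lemma calF_halfspace n c (A : 'M[R]_(1 + n)) (Q : 'M[R]_n) (m b : 'I_n -> R) :
  (1 <= n)%N -> (n%:R - 1) / 2 * pi <= c -> ((2 <= n)%N \/ 0 < c) ->
  calF c A -> Q *m Q^T = 1%:M -> \sum_i atan (m i) = c - pi / 2 ->
  0 <= \sum_i ((row_mx (b i)%:M (row i Q) *m A *m (row_mx (b i)%:M (row i Q))^T) 0 0 - m i)
     / (1 + m i ^+ 2).
Proof.
move=> n1 hc hs cA QQ hm; have A00 := calF_time_ge0 n1 hc cA.
case: cA => [sA hA].
set a := ursubmx A; set B := drsubmx A.
have sB : B^T = B by rewrite /B trmx_drsub sA.
have [U [d h]] := symmetric_diagonalizes sB.
have AE := symmetric_blockE sA; rewrite -/a -/B in AE.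
have qE i : (row_mx (b i)%:M (row i Q) *m A *m (row_mx (b i)%:M (row i Q))^T) 0 0 =
   A 0 0 * b i ^+ 2 + 2 * b i * (a *m (row i Q)^T) 0 0 + (Q *m B *m Q^T) i i.
  have s11 : (row i Q *m a^T) = (a *m (row i Q)^T).
    by rewrite [RHS]mx11_scalar -tr_scalar_mx -mx11_scalar trmx_mul trmxK.
  have QB : (Q *m B *m Q^T) i i = (row i Q *m B *m (row i Q)^T) 0 0.
    by rewrite -row_mul !mxE; apply: eq_bigr => j _; rewrite !mxE.
  rewrite {1}AE mul_row_block tr_row_mx mul_row_col tr_scalar_mx QB.
  rewrite !mulmxDl s11 -scalar_mxM !mul_mx_scalar !mul_scalar_mx -scalemxAl.
  by rewrite mxE [X in X + _]mxE [X in _ + X]mxE !mxE eqxx !mulr1n; ring.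
have main (S : 'M[R]_n) : S^T = S -> c - pi / 2 <= lagrangian_angle S ->
    (forall i, (Q *m S *m Q^T) i i <= A 0 0 * b i ^+ 2 + 2 * b i * (a *m (row i Q)^T) 0 0 + (Q *m B *m Q^T) i i) ->
    0 <= \sum_i ((row_mx (b i)%:M (row i Q) *m A *m (row_mx (b i)%:M (row i Q))^T) 0 0 - m i)
     / (1 + m i ^+ 2).
  move=> sS hS le; apply: (le_trans (@lagrangian_angle_halfspace _ S Q m sS QQ _)).
    by rewrite hm hS andbT; lra.
  apply: ler_sum => i _; rewrite qE ler_wpM2r ?lerB // invr_ge0.
  by rewrite addr_ge0 ?sqr_ge0.
have [A0|A0] := eqVneq (A 0 0) 0; last first.
  have Ap : 0 < A 0 0 by rewrite lt_def A0.
  apply: (main (B - (A 0 0)^-1 *: (a^T *m a))).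
  - by rewrite linearB /= sB linearZ /= trmx_mul trmxK.
  - have := lagrangian_angle_schur a sB Ap; rewrite -AE => E.
    by move: hA; rewrite E; lra.
  move=> i; rewrite mulmxBr mulmxBl -scalemxAr -scalemxAl.
  have -> : Q *m (a^T *m a) *m Q^T = (a *m Q^T)^T *m (a *m Q^T).
    by rewrite trmx_mul trmxK !mulmxA.
  rewrite [X in X <= _]mxE [X in _ + X <= _]mxE [X in _ - X <= _]mxE.
  have -> : ((a *m Q^T)^T *m (a *m Q^T)) i i = (a *m (row i Q)^T) 0 0 ^+ 2.
    rewrite mxE big_ord1 mxE expr2; congr (_ * _); rewrite !mxE;
      by apply: eq_bigr => j _; rewrite !mxE.
  set t := (a *m _) 0 0; set z := (Q *m B *m Q^T) i i.
  (* Completing the square in the time component. *)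
  rewrite -subr_ge0 (_ : _ - _ = (A 0 0 * b i + t) ^+ 2 / A 0 0).
    by rewrite divr_ge0 ?sqr_ge0.
  by field.
have [a0|a0] := eqVneq a 0.
  apply: (main B) => // [|i].
    have dg : degenerate A by rewrite AE degenerate_block A0 a0 !eqxx.
    by move: hA; rewrite /spacetime_angle dg /space_block -/B; lra.
  by rewrite A0 a0 mul0mx [X in 2 * _ * X]mxE mul0r mulr0 !add0r.
(* Here r p = -q, while the strict bound of [atan_sum_lt] would give q + r p > 0. *)
exfalso.
have := spacetime_angle_border (alpha := A 0 0) (a := a) h; rewrite -AE a0 orbT => /(_ isT) E.
move: hA; rewrite E arg_right; last by rewrite re_form_gt0 // mulmx_orthogonal_eq0 ?h.1.
set p := re_form _ _ _; set q := im_form _ _ _; set r := (_ - _) / _ => hA.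
have p0 : 0 < p by rewrite re_form_gt0 // mulmx_orthogonal_eq0 ?h.1.
have rp : r * p = A 0 0 - q by rewrite /r divfK // gt_eqF.
have : 0 < q + r * p.
  apply/im_re_form_gt0; last by rewrite mulmx_orthogonal_eq0 ?h.1.
  apply/atan_sum_lt; rewrite -(lagrangian_angle_diag h); last by apply: le_trans hA; lra.
  case: hs => [n2|c0]; first by left.
  have [n2|n2] := leqP 2 n; first by left.
  have n0 : n%:R - 1 <= 0 :> R by rewrite subr_le0 lern1 -ltnS.
  right; apply: (le_lt_trans _ (lt_le_trans c0 hA)).
  by rewrite mulr_le0_ge0 // ltW // pi_half_gt0.
by rewrite rp A0; lra.
Qed.

End MatrixInequalities.

(** * Derivatives of order at most two *)

(* Sealed copies of [partial] and [hessian]: otherwise failed unifications unfold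
   derivatives down to filters. *)
HB.lock Definition pd {R : realType} {k : nat} (i : 'I_k) (f : 'rV[R]_k -> R) :
  'rV[R]_k -> R := partial i f.
HB.lock Definition hess {R : realType} {k : nat} (f : 'rV[R]_k -> R) (x : 'rV[R]_k) (i j : 'I_k) : R :=
  hessian f x i j.
HB.lock Definition isC2 {R : realType} {k : nat} (Omega : set 'rV[R]_k) (f : 'rV[R]_k -> R) : Prop :=
  C2 Omega f.

Section Calculus.
Context {R : realType} {k : nat}.
Local Notation E := 'rV[R]_k.
Implicit Types (Omega : set E) (f g : E -> R).

Lemma pdE i f : pd i f = partial i f.
Proof. by rewrite pd.unlock. Qed.

Lemma isC2E Omega f : isC2 Omega f = C2 Omega f.
Proof. by rewrite isC2.unlock. Qed.

Definition C0 Omega f := forall x, Omega x -> {for x, continuous f}.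

Definition C1 Omega f := C0 Omega f /\
  forall i, (forall x, Omega x -> derivable f x (delta_mx 0 i)) /\ C0 Omega (pd i f).

(** In this form each closure property is proved for [C1] and then reused for the first partial
    derivatives. *)
Lemma C2P Omega f : isC2 Omega f <-> C1 Omega f /\ forall j, C1 Omega (pd j f).
Proof.
rewrite isC2E /C1; split=> [h|[[h0 h1] h2] x Ox].
  split; first split; first by move=> x /h[].
    by move=> i; rewrite pdE; split=> x /h[_ [/(_ i)[]]].
  move=> j; rewrite pdE; split; first by move=> x /h[_ [/(_ j)[]]].
  by move=> i; rewrite pdE; split => x /h[_ [_ /(_ i j)[]]].
split; first exact: h0.
split=> [i|i j].
  by have [a b] := h1 i; rewrite pdE in b; split; [exact: a | exact: b].
by have [_ /(_ i)] := h2 j; rewrite !pdE => -[a b]; split; [exact: a | exact: b].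
Qed.

Lemma C0_eq Omega f g : open Omega -> (forall x, Omega x -> f x = g x) ->
  C0 Omega f -> C0 Omega g.
Proof.
move=> oO fg cf x Ox; rewrite /continuous_at /prop_for /= -(fg _ Ox).
have H : \near x, f x = g x.
  by have := open_nbhs_nbhs (conj oO Ox); apply: filterS => y Oy; rewrite fg.
exact: (cvg_trans (near_eq_cvg H) (cf x Ox)).
Qed.

Lemma near_eqO Omega f g x : open Omega -> (forall x, Omega x -> f x = g x) ->
  Omega x -> \near x, f x = g x.
Proof. by move=> oO fg Ox; apply: filterS _ (open_nbhs_nbhs (conj oO Ox)) => y /fg. Qed.

Lemma pd_eq Omega f g : open Omega -> (forall x, Omega x -> f x = g x) ->
  forall i x, Omega x -> pd i f x = pd i g x.
Proof. by move=> oO fg i x Ox; rewrite !pdE; apply: near_eq_derive; exact: near_eqO fg Ox. Qed.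

Lemma C1_eq Omega f g : open Omega -> (forall x, Omega x -> f x = g x) ->
  C1 Omega f -> C1 Omega g.
Proof.
move=> oO fg [cf hf]; split; first exact: (C0_eq oO fg).
move=> i; have [df cdf] := hf i; split.
  by move=> x Ox; apply: near_eq_derivable (df x Ox); exact: near_eqO fg Ox.
by apply: (C0_eq oO _ cdf) => x Ox; exact: pd_eq fg _ _ Ox.
Qed.

Lemma C2_eq Omega f g : open Omega -> (forall x, Omega x -> f x = g x) ->
  isC2 Omega f -> isC2 Omega g.
Proof.
move=> oO fg /C2P[h1 h2]; apply/C2P; split; first exact: (C1_eq oO fg).
by move=> j; apply: (C1_eq oO _ (h2 j)) => x Ox; exact: pd_eq fg _ _ Ox.
Qed.

Lemma C2_subset Omega Omega' f : Omega' `<=` Omega -> isC2 Omega f -> isC2 Omega' f.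
Proof. by rewrite !isC2E => s h x /s /h. Qed.

Lemma C2_local Omega f : (forall x, Omega x -> exists2 U, open U /\ U x & isC2 U f) ->
  isC2 Omega f.
Proof. by move=> h; rewrite isC2E => x /h[U [_ Ux]]; rewrite isC2E => /(_ x Ux). Qed.

Lemma hessE f x i j : hess f x i j = pd i (pd j f) x.
Proof. by rewrite hess.unlock mxE !pdE. Qed.

Lemma hessian_hess f x : hessian f x = \matrix_(i, j) hess f x i j.
Proof. by apply/matrixP => i j; rewrite [RHS]mxE hess.unlock. Qed.

Lemma hess_near f g x i j : (\near x, f x = g x) -> hess f x i j = hess g x i j.
Proof.
move=> fg; rewrite !hessE.
have H : \near x, pd j f x = pd j g x.
  rewrite !pdE; move: fg => /nbhs_interior; apply: filterS => y; exact: near_eq_derive.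
by rewrite (pdE i (pd j f)) (pdE i (pd j g)); exact: (near_eq_derive _ H).
Qed.

Lemma pdD Omega f g : C1 Omega f -> C1 Omega g -> forall i x, Omega x ->
  pd i (f \+ g) x = pd i f x + pd i g x.
Proof. by move=> [_ hf] [_ hg] i x Ox; rewrite !pdE; apply: deriveD; [exact: (hf i).1|exact: (hg i).1]. Qed.

Lemma pdM Omega f g : C1 Omega f -> C1 Omega g -> forall i x, Omega x ->
  pd i (f \* g) x = f x * pd i g x + g x * pd i f x.
Proof. by move=> [_ hf] [_ hg] i x Ox; rewrite !pdE; apply: deriveM; [exact: (hf i).1|exact: (hg i).1]. Qed.

Lemma C0D Omega f g : C0 Omega f -> C0 Omega g -> C0 Omega (f \+ g).
Proof. by move=> hf hg x Ox; exact: (cvgD (hf x Ox) (hg x Ox)). Qed.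

Lemma C0M Omega f g : C0 Omega f -> C0 Omega g -> C0 Omega (f \* g).
Proof. by move=> hf hg x Ox; exact: (cvgM (hf x Ox) (hg x Ox)). Qed.

Lemma C1D Omega f g : open Omega -> C1 Omega f -> C1 Omega g -> C1 Omega (f \+ g).
Proof.
move=> oO hf hg; have [cf df] := hf; have [cg dg] := hg.
split; first exact: C0D.
move=> i; split; first by move=> x Ox; apply: derivableD; [exact: (df i).1|exact: (dg i).1].
apply: (C0_eq oO (f := pd i f \+ pd i g)).
  by move=> x Ox /=; rewrite (pdD hf hg).
by apply: C0D; [exact: (df i).2 | exact: (dg i).2].
Qed.

Lemma C1M Omega f g : open Omega -> C1 Omega f -> C1 Omega g -> C1 Omega (f \* g).
Proof.
move=> oO hf hg; have [cf df] := hf; have [cg dg] := hg.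
split; first exact: C0M.
move=> i; split; first by move=> x Ox; apply: derivableM; [exact: (df i).1|exact: (dg i).1].
apply: (C0_eq oO (f := (f \* pd i g) \+ (g \* pd i f))).
  by move=> x Ox /=; rewrite (pdM hf hg).
by apply: C0D; apply: C0M => //; [exact: (dg i).2 | exact: (df i).2].
Qed.

Lemma C2_C1 Omega f : isC2 Omega f -> C1 Omega f.
Proof. by move/C2P => []. Qed.

Lemma C2D Omega f g : open Omega -> isC2 Omega f -> isC2 Omega g -> isC2 Omega (f \+ g).
Proof.
move=> oO /C2P[f1 f2] /C2P[g1 g2]; apply/C2P; split; first exact: (C1D oO f1 g1).
move=> j; apply: (C1_eq oO (f := pd j f \+ pd j g)).
  by move=> x Ox /=; rewrite (pdD f1 g1).
exact: (C1D oO (f2 j) (g2 j)).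
Qed.

Lemma C2M Omega f g : open Omega -> isC2 Omega f -> isC2 Omega g -> isC2 Omega (f \* g).
Proof.
move=> oO /C2P[f1 f2] /C2P[g1 g2]; apply/C2P; split; first exact: (C1M oO f1 g1).
move=> j; apply: (C1_eq oO (f := (f \* pd j g) \+ (g \* pd j f))).
  by move=> x Ox /=; rewrite (pdM f1 g1).
exact: (C1D oO (C1M oO f1 (g2 j)) (C1M oO g1 (f2 j))).
Qed.

Lemma hessD Omega f g x i j : open Omega -> isC2 Omega f -> isC2 Omega g -> Omega x ->
  hess (f \+ g) x i j = hess f x i j + hess g x i j.
Proof.
move=> oO /C2P[f1 f2] /C2P[g1 g2] Ox; rewrite !hessE.
by rewrite (pd_eq oO (pdD f1 g1 j) i Ox) (pdD (f2 j) (g2 j) i Ox).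
Qed.

Lemma hessM Omega f g x i j : open Omega -> isC2 Omega f -> isC2 Omega g -> Omega x ->
  hess (f \* g) x i j =
  f x * hess g x i j + g x * hess f x i j +
  (pd i f x * pd j g x + pd i g x * pd j f x).
Proof.
move=> oO /C2P[f1 f2] /C2P[g1 g2] Ox; rewrite !hessE.
rewrite (pd_eq oO (pdM f1 g1 j) i Ox).
rewrite (pdD (C1M oO f1 (g2 j)) (C1M oO g1 (f2 j)) i Ox).
by rewrite (pdM f1 (g2 j) i Ox) (pdM g1 (f2 j) i Ox); ring.
Qed.

Lemma pd_cst i (c : R) : pd i (fun _ : E => c) = fun=> 0.
Proof. by apply/funext => x; rewrite pdE; exact: derive_cst. Qed.

Lemma C1_cst Omega (c : R) : C1 Omega (fun=> c).
Proof.
split; first by move=> x _; exact: cst_continuous.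
move=> i; split; first by move=> x _; exact: derivable_cst.
by rewrite pd_cst => x _; exact: cst_continuous.
Qed.

Lemma C2_cst Omega (c : R) : isC2 Omega (fun=> c).
Proof.
by apply/C2P; split=> [|j]; rewrite ?pd_cst; exact: C1_cst.
Qed.

Lemma hess_cst (c : R) (x : E) i j : hess (fun=> c) x i j = 0.
Proof. by rewrite hessE !pd_cst. Qed.

Lemma is_derive_coord (j : 'I_k) (x v : E) : is_derive x v (fun y : E => y 0 j) (v 0 j).
Proof.
have h : (fun t : R => t^-1 *: (((fun y : E => y 0 j) \o shift x) (t *: v) - x 0 j)) @ 0^' --> v 0 j.
  apply: (@cvg_trans _ (v 0 j @[_ --> 0^'])); last exact: cvg_cst.
  apply: near_eq_cvg; near=> t.
  rewrite /= !mxE addrK -[RHS]/(t^-1 * (t * v 0 j)) mulKf //.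
  by near: t; exact: nbhs_dnbhs_neq.
by apply: DeriveDef; [apply/cvg_ex; exists (v 0 j) | exact: cvg_lim h].
Unshelve. all: by end_near. Qed.

Lemma pd_coord i j : pd i (fun y : E => y 0 j) = fun=> (j == i)%:R.
Proof.
by apply/funext => x; rewrite pdE /partial (derive_val (is_derive := is_derive_coord _ _ _)) mxE eqxx.
Qed.

Lemma C2_coord Omega j : isC2 Omega (fun y : E => y 0 j).
Proof.
apply/C2P; split=> [|i]; last by rewrite pd_coord; exact: C1_cst.
split; first by move=> x _; exact: coord_continuous.
move=> i; split; last by rewrite pd_coord; exact: (C1_cst _ _).1.
by move=> x _; have := is_derive_coord j x (delta_mx 0 i); case.
Qed.

Lemma hess_coord l (x : E) i j : hess (fun y : E => y 0 l) x i j = 0.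
Proof. by rewrite hessE pd_coord pd_cst. Qed.

(** Only a directional derivative of [f] is given, so the one-variable chain rule is applied on the
    line through x along v. *)
Lemma is_derive_chain (h : R -> R) (dh : R) f (x v : E) : derivable f x v ->
  is_derive (f x) 1 h dh -> is_derive x v (h \o f) (dh * 'D_v f x).
Proof.
move=> df [hh <-]; pose a t := f (t *: v + x).
have da : derivable a 0 1 := (derivable1P f x v).1 df.
have a0 : a 0 = f x by rewrite /a scale0r add0r.
have lineE (g : E -> R) : 'D_v g x = 'D_1 (fun t : R => g (t *: v + x)) 0.
  rewrite /derive; set g1 := fun t => t^-1 *: _; set g2 := fun t => t^-1 *: _.
  suff -> : g1 = g2 by [].
  by rewrite funeqE /g1 /g2 => t /=; rewrite addr0 scale0r add0r [_%:A]mulr1.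
have hd : derivable h (a 0) 1 := eq_ind_r (fun y : R => derivable h y 1) hh a0.
apply: DeriveDef.
  apply: (derivable1P (h \o f) x v).2; apply: (derivable1_diffP (h \o a) 0).2.
  exact: (differentiable_comp ((derivable1_diffP a 0).1 da) ((derivable1_diffP h (a 0)).1 hd)).
apply: etrans (lineE (h \o f)) _; rewrite (lineE f) -!derive1E.
by have := derive1_comp da hd; rewrite a0.
Qed.

Lemma C1_comp Omega (h h' : R -> R) f : open Omega ->
  (forall s : R, is_derive s (1 : R) h (h' s)) -> continuous h' -> C1 Omega f ->
  C1 Omega (h \o f) /\
  forall i x, Omega x -> pd i (h \o f) x = h' (f x) * pd i f x.
Proof.
move=> oO hh ch' [cf df].
have ch : continuous h.
  move=> s; apply/differentiable_continuous/derivable1_diffP.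
  by have := hh s; case.
have dchain i x : Omega x -> is_derive x (delta_mx 0 i) (h \o f) (h' (f x) * pd i f x).
  by move=> Ox; rewrite pdE; apply: is_derive_chain => //; exact: (df i).1.
have pE i x : Omega x -> pd i (h \o f) x = h' (f x) * pd i f x.
  by move=> Ox; have [_ De] := dchain i x Ox; rewrite (pdE i (h \o f)); exact: De.
split=> //; split; first by move=> x Ox; apply: continuous_comp; [exact: cf | exact: ch].
move=> i; split; first by move=> x Ox; have [] := dchain i x Ox.
apply: (C0_eq oO (f := (h' \o f) \* pd i f)).
  by move=> x Ox; rewrite pE.
apply: C0M; last exact: (df i).2.
by move=> x Ox; apply: continuous_comp; [exact: cf | exact: ch'].
Qed.

Lemma C2_comp Omega (h h' h'' : R -> R) f : open Omega ->
  (forall s : R, is_derive s (1 : R) h (h' s)) -> (forall s : R, is_derive s (1 : R) h' (h'' s)) ->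
  continuous h'' -> isC2 Omega f -> isC2 Omega (h \o f).
Proof.
move=> oO hh hh' ch'' /C2P[f1 f2].
have ch' : continuous h'.
  move=> s; apply/differentiable_continuous/derivable1_diffP.
  by have := hh' s; case.
have [c1 pE] := C1_comp oO hh ch' f1.
apply/C2P; split=> // j; apply: (C1_eq oO (f := (h' \o f) \* pd j f)).
  by move=> x Ox; rewrite pE.
by apply: C1M => //; exact: (C1_comp oO hh' ch'' f1).1.
Qed.

End Calculus.

(** * Localization of test functions *)

Section PositivePowers.
Context {R : realType}.
Implicit Types s : R.

(** The cube of the positive part is already twice continuously differentiable; all bump functions
    are built from it. *)
Definition posn m s : R := Num.max s 0 ^+ m.

Lemma posn_ge0 m s : 0 <= posn m s.
Proof. by rewrite exprn_ge0 // le_max lexx orbT. Qed.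

Lemma posn_le0 m s : s <= 0 -> posn m.+1 s = 0.
Proof. by move=> s0; rewrite /posn max_r // expr0n. Qed.

Lemma posn_gt0 m s : 0 <= s -> posn m s = s ^+ m.
Proof. by move=> s0; rewrite /posn max_l. Qed.

Lemma posn_continuous m : continuous (posn m).
Proof.
move=> s; apply: (continuous_comp (f := fun t : R => Num.max t 0) (g := fun t => t ^+ m)).
  by apply: continuous_max; [exact: cvg_id | exact: cvg_cst].
exact: exprn_continuous.
Qed.

Lemma is_derive_posn m s : is_derive s 1 (posn m.+2) (m.+2%:R * posn m.+1 s).
Proof.
have [s0|s0|->] := ltgtP s 0.
- rewrite posn_le0 ?ltW // mulr0.
  apply: (@near_eq_is_derive R R R (cst (0 : R)) _ s 1 0).
  by near=> t; rewrite posn_le0 // ltW //; near: t; exact: lt_nbhsl.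
- rewrite posn_gt0 ?ltW //.
  apply: (@near_eq_is_derive R R R (fun t : R => t ^+ m.+2) _ s 1).
    by near=> t; rewrite posn_gt0 // ltW //; near: t; exact: lt_nbhsr.
  apply: DeriveDef; first exact: exprn_derivable.
  by rewrite exp_derive [LHS]mulr1.
- have h : (fun t : R => t^-1 *: ((posn m.+2 \o shift 0) (t *: 1) - posn m.+2 0)) @ 0^' --> (0 : R).
    have c : posn m.+1 t @[t --> 0^'] --> (0 : R).
      have := @posn_continuous m.+1 0; rewrite /continuous_at posn_le0 // => H.
      exact: cvg_within_filter H.
    have H : \forall t \near 0^', posn m.+1 t = t^-1 *: ((posn m.+2 \o shift 0) (t *: 1) - posn m.+2 0) :> R.
      near=> t; apply/esym; rewrite posn_le0 // subr0 /= addr0 [t *: 1]mulr1.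
      have t0 : t != 0 by near: t; exact: nbhs_dnbhs_neq.
      rewrite -[LHS]/(t^-1 * _); have [t0'|t0'] := leP t 0.
        by rewrite !posn_le0 // mulr0.
      by rewrite !posn_gt0 ?ltW // exprS mulKf.
    exact: (cvg_trans (near_eq_cvg H) c).
  rewrite posn_le0 // mulr0.
  by apply: DeriveDef; [apply/cvg_ex; exists 0 | exact: cvg_lim h].
Unshelve. all: by end_near. Qed.
End PositivePowers.

(** * Compactness arguments *)

Section Compactness.

(** Compactness as an induction principle: a property that holds locally and passes to subsets and
    to unions of two sets holds on [K]. It replaces explicit finite subcovers below. *)
Lemma compact_ind (T : ptopologicalType) (K : set T) (Q : set T -> Prop) :
  compact K -> Q set0 -> (forall A B, A `<=` B -> Q B -> Q A) ->
  (forall A B, Q A -> Q B -> Q (A `|` B)) ->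
  (forall x, K x -> exists2 U, nbhs x U & Q U) -> Q K.
Proof.
rewrite compact_cover => cK Q0 Qs QU Qx.
have [||D DQ KD] := cK (set T) [set U | open U /\ Q U] id.
- by move=> U [].
- move=> x /Qx[U xU QU']; exists U^°; last exact: xU.
  by split; [exact: open_interior | apply: Qs QU'; exact: interior_subset].
apply: (Qs _ _ KD).
have {}DQ U : U \in enum_fset D -> Q U by move=> /DQ; rewrite inE => -[].
suff H (l : seq (set T)) : (forall U, U \in l -> Q U) -> Q [set x | exists2 U, U \in l & U x].
  by apply: (Qs _ _ _ (H _ DQ)) => x [U UD Ux]; exists U.
elim: l => [_|U l IH h]; first by apply: (Qs _ _ _ Q0) => x [].
apply: (Qs _ (U `|` [set x | exists2 U, U \in l & U x])).
  by move=> x [V]; rewrite inE => /predU1P[->|Vl] Vx; [left | right; exists V].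
by apply: QU; [exact: h (mem_head _ _) | apply: IH => V Vl; apply: h; rewrite inE Vl orbT].
Qed.

Context {R : realType}.

(** Without a maximum each point has a neighbourhood on which f stays below some value f x'. Keeping
    the larger value in unions gives one x in K with f < f x on all of K, including at x. *)
Lemma usc_max (T : ptopologicalType) (K : set T) (f : T -> R) :
  compact K -> K !=set0 ->
  (forall x, K x -> forall a, f x < a -> \forall y \near x, K y -> f y < a) ->
  exists2 x, K x & forall y, K y -> f y <= f x.
Proof.
move=> cK [x0 Kx0] uf; apply: contrapT => nex.
have next x : K x -> exists2 x', K x' & f x < f x'.
  move=> Kx; apply: contrapT => h; apply: nex; exists x => // y Ky.
  by rewrite leNgt; apply/negP => lt; apply: h; exists y.
have [x Kx fx] : exists2 x, K x & forall y, (K `&` K) y -> f y < f x.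
  apply: (compact_ind (Q := fun A => exists2 x, K x & forall y, (K `&` A) y -> f y < f x) cK).
  - by exists x0 => // y [].
  - by move=> A B AB [x Kx fx]; exists x => // y [Ky Ay]; apply: fx; split => //; exact: AB.
  - move=> A B [x Kx fx] [y Ky fy].
    have [xy|yx] := leP (f x) (f y).
      exists y => // z [Kz [Az|Bz]]; last exact: fy.
      by apply: lt_le_trans xy; exact: fx.
    exists x => // z [Kz [Az|Bz]]; first exact: fx.
    by apply: lt_trans yx; exact: fy.
  - move=> x Kx; have [x' Kx' lt] := next x Kx.
    exists [set y | K y -> f y < f x']; first exact: uf.
    by exists x' => // y [Ky]; apply.
by have := fx x (conj Kx Kx); rewrite ltxx.
Qed.

(** Near a zero of g the bound f < m already holds; elsewhere g is locally bounded below and f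
    above, so a large C works locally. For unions the constants are added. *)
Lemma penalization (T : ptopologicalType) (K : set T) (f g : T -> R) (m : R) :
  compact K ->
  (forall x, K x -> forall a, f x < a -> \forall y \near x, K y -> f y < a) ->
  (forall x, K x -> {for x, continuous g}) -> (forall x, K x -> 0 <= g x) ->
  (forall x, K x -> g x = 0 -> f x < m) ->
  exists2 C, 0 < C & forall x, K x -> f x - C * g x < m.
Proof.
move=> cK uf cg g0 fm.
have [C C0 h] : exists2 C, 0 < C & forall x, (K `&` K) x -> f x - C * g x < m.
  apply: (compact_ind (Q := fun A => exists2 C, 0 < C & forall x, (K `&` A) x -> f x - C * g x < m) cK).
  - by exists 1 => // x [].
  - by move=> A B AB [C C0 h]; exists C => // x [Kx Ax]; apply: h; split => //; exact: AB.
  - move=> A B [C C0 h] [D D0 h']; exists (C + D); first exact: addr_gt0.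
    move=> x [Kx [Ax|Bx]].
      apply: le_lt_trans (h x (conj Kx Ax)).
      by rewrite lerD2l lerN2 ler_wpM2r ?g0 // lerDl ltW.
    apply: le_lt_trans (h' x (conj Kx Bx)).
    by rewrite lerD2l lerN2 ler_wpM2r ?g0 // lerDr ltW.
  - move=> x Kx; have := g0 x Kx; rewrite le_eqVlt => /predU1P[gx|gx].
      exists [set y | K y -> f y < m]; first by apply: uf => //; exact: fm.
      exists 1 => // y [Ky /(_ Ky) fy]; apply: le_lt_trans fy.
      by rewrite mul1r lerBlDr lerDl g0.
    have gn : \forall y \near x, g x / 2 < g y.
      have := cg x Kx; move/cvgrPdist_lt => /(_ (g x / 2)); rewrite divr_gt0 // => /(_ isT).
      apply: filterS => y; rewrite ltr_norml => /andP[_]; lra.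
    have fn := uf x Kx (f x + 1) (ltr_pwDr ltr01 (lexx _)).
    exists [set y | g x / 2 < g y /\ (K y -> f y < f x + 1)].
      by apply: filterS2 gn fn => y.
    pose C := `|f x + 1 - m| / (g x / 2) + 1.
    have gx2 : 0 < g x / 2 by rewrite divr_gt0.
    have C0 : 0 < C by rewrite ltr_wpDl // divr_ge0 // ltW.
    exists C => // y [Ky [gy /(_ Ky) fy]].
    rewrite ltrBlDr; apply: (lt_le_trans fy).
    have : C * (g x / 2) <= C * g y by rewrite ler_wpM2l ?ltW.
    rewrite {1}/C mulrDl divfK ?gt_eqF // mul1r.
    by have := ler_norm (f x + 1 - m); lra.
by exists C => // x Kx; exact: h.
Qed.

End Compactness.

(** * Twice differentiable majorants *)

Section Localization.
Context {R : realType} {k : nat}.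
Local Notation E := 'rV[R]_k.
Implicit Types (Omega K : set E) (f g u : E -> R) (x y q : E).

(** The squared Euclidean distance: the norm on row vectors is the sup norm, which is not
    differentiable. *)
Definition sqd q y : R := \sum_i (y 0 i - q 0 i) ^+ 2.

Lemma sqd_ge0 q y : 0 <= sqd q y.
Proof. by apply: sumr_ge0 => i _; exact: sqr_ge0. Qed.

Lemma sqdxx q : sqd q q = 0.
Proof. by apply: big1 => i _; rewrite subrr expr0n. Qed.

Lemma C2_comp_posn Omega m f : open Omega -> isC2 Omega f -> isC2 Omega (posn m.+3 \o f).
Proof.
move=> oO; apply: (@C2_comp _ _ _ _ (fun s => m.+3%:R * posn m.+2 s)
  (fun s => m.+3%:R * (m.+2%:R * posn m.+1 s)) _ oO).
- by move=> s; exact: is_derive_posn.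
- by move=> s; exact: (@is_deriveZ R R R (posn m.+2) m.+3%:R s 1 _ (is_derive_posn m s)).
- by move=> s; exact: (cvgM (cvg_cst _) (cvgM (cvg_cst _) (@posn_continuous R m.+1 s))).
Qed.

Lemma C2_sum Omega (I : Type) (l : seq I) (F : I -> E -> R) : open Omega ->
  (forall i, isC2 Omega (F i)) -> isC2 Omega (fun x => \sum_(i <- l) F i x).
Proof.
move=> oO hF; elim: l => [|i l IH].
  by under eq_fun do rewrite big_nil; exact: C2_cst.
under eq_fun do rewrite big_cons; exact: (C2D oO (hF i) IH).
Qed.

Lemma C2_sqd Omega q : open Omega -> isC2 Omega (sqd q).
Proof.
move=> oO; apply: C2_sum => // i.
have h : isC2 Omega (fun y => y 0 i - q 0 i).
  by apply: (C2D oO (C2_coord Omega i) (C2_cst Omega (- q 0 i))).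
by under eq_fun do rewrite expr2; exact: (C2M oO h h).
Qed.

Lemma sqd_continuous q : continuous (sqd q).
Proof. by move=> x; have := C2_sqd q openT; rewrite isC2E => /(_ x I)[]. Qed.

Lemma nbhs_sqd_lt q e : 0 < e -> \forall y \near q, sqd q y < e.
Proof.
move=> e0; have := @sqd_continuous q q; rewrite /continuous_at sqdxx.
by move/cvgrPdist_lt => /(_ _ e0); apply: filterS => y; rewrite sub0r normrN ger0_norm ?sqd_ge0.
Qed.

Lemma nbhs_sqdP q (U : set E) : nbhs q U -> exists2 e, 0 < e & forall y, sqd q y < e -> U y.
Proof.
move=> /nbhs_ballP[e /= e0 eU]; exists (e ^+ 2); first by rewrite exprn_gt0.
move=> y h; apply: eU; split=> // i j; rewrite ord1 -ball_normE /= distrC.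
have : (y 0 j - q 0 j) ^+ 2 < e ^+ 2.
  apply: le_lt_trans h; rewrite /sqd (bigD1 j) //= lerDl sumr_ge0 // => l _.
  exact: sqr_ge0.
by rewrite ltr_norml expr2 => h2; apply/andP; split; nra.
Qed.

Definition usc_at u x := forall a, u x < a -> \forall y \near x, u y < a.

Lemma C2_dominate_compact K (Cl : set E) u : compact K -> closed Cl -> K `&` Cl = set0 ->
  (forall x, K x -> usc_at u x) ->
  exists g, [/\ isC2 setT g, forall x, 0 <= g x, forall x, Cl x -> g x = 0 &
                forall x, K x -> u x <= g x].
Proof.
move=> cK cC KC uu.
apply: (compact_ind (Q := fun A => exists g, [/\ isC2 setT g, forall x, 0 <= g x,
  forall x, Cl x -> g x = 0 & forall x, A x -> u x <= g x]) cK).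
- by exists (fun=> 0); split => //; exact: C2_cst.
- by move=> A B AB [g [g1 g2 g3 g4]]; exists g; split => // x /AB /g4.
- move=> A B [g [g1 g2 g3 g4]] [h [h1 h2 h3 h4]]; exists (g \+ h); split.
  + by apply: C2D => //; exact: openT.
  + by move=> x; rewrite addr_ge0.
  + by move=> x Cx /=; rewrite g3 // h3 // addr0.
  + by move=> x [/g4|/h4] le /=; apply: le_trans le _; rewrite ?lerDl ?lerDr.
move=> x Kx.
have nC : \forall y \near x, ~ Cl y.
  apply: open_nbhs_nbhs; split; first exact: closed_openC.
  by move=> Cx; have : (K `&` Cl) x by []; rewrite KC.
have un := uu x Kx (u x + 1) (ltr_pwDr ltr01 (lexx _)).
have [e e0 he] := nbhs_sqdP nC.
(* On [sqd x y < e / 2] the bump is at least (1 / 2)^3, which the factor 8 compensates. *)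
pose m : R := 8 * (`|u x| + 1).
have m0 : 0 <= m by rewrite mulr_ge0 // addr_ge0.
exists [set y | sqd x y < e / 2 /\ u y < u x + 1].
  have e20 : 0 < e / 2 by rewrite divr_gt0.
  by have := nbhs_sqd_lt x e20; apply: filterS2 un => y.
exists (fun y => m * posn 3 (1 - sqd x y / e)); split.
- have oT := @openT E.
  apply: (C2M oT (C2_cst setT m)); apply: (@C2_comp_posn _ 0 (fun y => 1 - sqd x y / e) oT).
  apply: (C2D oT (C2_cst setT 1)).
  have := C2M oT (C2_sqd x oT) (C2_cst setT (- e^-1)).
  by apply: C2_eq => // y _ /=; rewrite mulrN.
- by move=> y; rewrite mulr_ge0 // posn_ge0.
- move=> y Cy; rewrite posn_le0 ?mulr0 // subr_le0 ler_pdivlMr // mul1r.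
  by rewrite leNgt; apply/negP => /he.
- move=> y [sy uy]; have h : 1 / 2 <= 1 - sqd x y / e.
    have : sqd x y / e <= 1 / 2 by rewrite ler_pdivrMr // ltW // mulrC mulrA mulr1.
    lra.
  rewrite posn_gt0; last by lra.
  have p : (1 / 2) ^+ 3 <= (1 - sqd x y / e) ^+ 3 by rewrite lerXn2r ?nnegrE //; lra.
  have : m * (1 / 2) ^+ 3 <= m * (1 - sqd x y / e) ^+ 3 by rewrite ler_wpM2l.
  apply: le_trans; rewrite /m.
  have -> : 8 * (`|u x| + 1) * (1 / 2) ^+ 3 = `|u x| + 1 by field.
  by apply: (le_trans (ltW uy)); rewrite lerD2r ler_norm.
Qed.

End Localization.

Section Cutoff.
Context {R : realType} {k : nat}.
Local Notation E := 'rV[R]_k.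
Implicit Types (Omega K : set E) (f g u : E -> R) (x y q : E).

(** An exhaustion of [Omega] by compact sets, each in the interior of the next. It starts with the
    empty set, so that the shells between consecutive sets cover [Omega]. *)
Definition exhaust Omega (j : nat) : set E :=
  if j is i.+1 then
    [set x | `|x| <= i%:R /\ forall q, ~ Omega q -> i.+1%:R^-1 <= `|x - q|]
  else set0.

Lemma exhaust_closed Omega j : closed (exhaust Omega j).
Proof.
case: j => [|i]; first exact: closed0.
have -> : exhaust Omega i.+1 = (fun x : E => `|x|) @^-1` [set t | t <= i%:R] `&`
   \bigcap_(q in ~` Omega) ((fun x : E => `|x - q|) @^-1` [set t | i.+1%:R^-1 <= t]).
  by apply/seteqP; split => x [].
apply: closedI.
  by apply: closed_comp; [move=> x _; exact: norm_continuous | exact: closed_le].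
apply: closed_bigI => q _; apply: closed_comp; last exact: closed_ge.
move=> x _; apply: (continuous_comp (f := fun x : E => x - q) (g := fun x : E => `|x|)).
  exact: (cvgB (@cvg_id _ (nbhs x)) (cvg_cst q)).
exact: norm_continuous.
Qed.

Lemma exhaust_compact Omega j : compact (exhaust Omega j).
Proof.
apply: bounded_closed_compact; last exact: exhaust_closed.
case: j => [|i]; first by exists 0; split; [exact: num_real | move=> M _ x []].
exists i%:R; split; first exact: num_real.
by move=> M iM x [h _]; apply: le_trans h (ltW iM).
Qed.

Lemma exhaust_interior Omega j : exhaust Omega j `<=` (exhaust Omega j.+1)^°.
Proof.
case: j => [//|i] x [xi hx].
have e0 : 0 < (i.+1%:R^-1 - i.+2%:R^-1 : R).
  by rewrite subr_gt0 ltf_pV2 ?posrE ?ltr0n // ltr_nat.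
apply/nbhs_ballP; exists (Num.min 1 (i.+1%:R^-1 - i.+2%:R^-1)) => /=.
  by rewrite lt_min ltr01.
move=> y; rewrite -ball_normE /= lt_min => /andP[h1 h2]; split.
  have : `|y| <= `|x| + `|x - y| by have := ler_normB x (x - y); rewrite subKr.
  by rewrite -natr1; lra.
move=> q nq; have : `|x - q| <= `|x - y| + `|y - q|.
  by rewrite (le_trans _ (ler_normD _ _)) // addrA subrK.
move: (hx q nq) h2; move: (i.+1%:R^-1) (i.+2%:R^-1) => a b; lra.
Qed.

Lemma exhaust_sub Omega j : exhaust Omega j.+1 `<=` Omega.
Proof.
move=> x [_ h]; apply: contrapT => /h; rewrite subrr normr0 leNgt invr_gt0.
by rewrite ltr0n.
Qed.

Lemma exhaust_mono Omega i j : (i <= j)%N -> exhaust Omega i `<=` exhaust Omega j.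
Proof.
elim: j => [|j IH]; first by rewrite leqn0 => /eqP->.
rewrite leq_eqVlt => /predU1P[->//|ij] x /(IH ij) /exhaust_interior.
exact: interior_subset.
Qed.

Lemma exhaust_cover Omega x : open Omega -> Omega x ->
  exists j, (exhaust Omega j)^° x.
Proof.
move=> oO Ox; have /nbhs_ballP[e /= e0 eO] := open_nbhs_nbhs (conj oO Ox).
pose i := (Num.truncn (`|x| + e^-1)).+1.
have hi : `|x| + e^-1 < i%:R by exact: truncnS_gt.
exists i.+2; apply: exhaust_interior; split.
  by apply/ltW/(le_lt_trans _ hi); rewrite lerDl invr_ge0 ltW.
move=> q nq; rewrite leNgt; apply/negP => lt; apply: nq; apply: eO.
rewrite -ball_normE /=; apply: lt_trans lt _.
rewrite invf_plt ?posrE ?ltr0n //.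
by rewrite -natr1 ltr_pwDr // ltW // (le_lt_trans _ hi) // lerDr.
Qed.

(** On each shell of the exhaustion u is dominated by a nonnegative function that vanishes two steps
    further in; the sum of these functions is locally finite. *)
Lemma C2_dominate Omega u : open Omega -> (forall x, Omega x -> usc_at u x) ->
  exists2 G, isC2 Omega G & forall x, Omega x -> u x <= G x.
Proof.
move=> oO uu; pose L := exhaust Omega.
have /choice[g hg] : forall j, exists g, [/\ isC2 setT g, forall x, 0 <= g x,
    forall x, L j.-1 x -> g x = 0 & forall x, L j.+1 x -> ~ (L j)^° x -> u x <= g x].
  move=> j; have [||||g [g1 g2 g3 g4]] :=
      @C2_dominate_compact _ _ (L j.+1 `&` ~` (L j)^°) (L j.-1) u.
  - apply: compact_closedI; first exact: exhaust_compact.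
    exact/open_closedC/open_interior.
  - exact: exhaust_closed.
  - apply/seteqP; split => // x [[_ nx] Lx]; apply: nx.
    case: j Lx => [//|j] Lx; exact: exhaust_interior.
  - by move=> x [/exhaust_sub Ox _]; exact: uu.
  by exists g; split => // x Lx nx; apply: g4.
have /choice[N hN] : forall x, exists n, Omega x -> (L n)^° x.
  move=> x; have [Ox|nO] := pselect (Omega x); last by exists 0%N.
  by have [n] := exhaust_cover oO Ox; exists n.
(* On [L n] every g_j with j > n vanishes, so the partial sums are stationary from n on and
   [P (N x) x] does not depend on the choice of [N]. *)
pose P n x := \sum_(0 <= j < n.+1) g j x.
have PE n m x : (n <= m)%N -> L n x -> P m x = P n x.
  move=> nm Lx.
  have E : \sum_(n.+1 <= j < m.+1) g j x = 0.
    rewrite big_nat; apply: big1 => j /andP[nj _]; have [_ _ + _] := hg j; apply.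
    by apply: exhaust_mono Lx; case: j nj.
  by rewrite /P (big_cat_nat (n := n.+1)) //= E addr0.
exists (fun x => P (N x) x).
  apply: C2_local => x Ox; exists (L (N x))^°.
    by split; [exact: open_interior | exact: hN].
  have oI := @open_interior _ (L (N x)).
  have iO : (L (N x))^° `<=` Omega.
    move=> y /interior_subset; rewrite /L; case: (N x) => [//|j]; exact: exhaust_sub.
  apply: (C2_eq oI (f := P (N x))).
    move=> y Iy; have Ly := interior_subset Iy.
    have Ly' := interior_subset (hN y (iO _ Iy)).
    by case/orP: (leq_total (N x) (N y)) => le; [rewrite [RHS](PE _ _ _ le) | rewrite [LHS](PE _ _ _ le)].
  apply: C2_subset (@subsetT _ _) _; rewrite /P; apply: C2_sum; first exact: openT.
  by move=> j; have [] := hg j.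
move=> x Ox.
have ex : exists n, `[< (L n)^° x >] by exists (N x); apply/asboolP; exact: hN.
(* The least n with x in the interior of [L n] locates the shell of x; the function dominating u
   there has index n - 1. *)
case: (ex_minnP ex) => n /asboolP Ln nmin.
case: n Ln nmin => [|n] Ln nmin; first by have := interior_subset Ln.
have nn : ~ (L n)^° x by move=> h; have := nmin n; rewrite asboolT // ltnn => /(_ isT).
have nN : (n.+1 <= N x)%N by apply: nmin; apply/asboolP; exact: hN.
have [_ _ _ h4] := hg n.
apply: (le_trans (h4 x (interior_subset Ln) nn)).
rewrite /P (bigD1_seq n) ?mem_index_iota ?iota_uniq //=; last by rewrite ltnW // ltnS ltnW.
by rewrite lerDl sumr_ge0 // => j _; have [_ ->] := hg j.
Qed.

(** A twice differentiable step from 1 on s <= 1 / 2 to 0 on s >= 1: the inner cube is at least 1 in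
    the first range and 0 in the second. *)
Definition cutoff (s : R) : R := 1 - posn 3 (1 - posn 3 (2 - 2 * s)).

Lemma cutoff1 s : s <= 1 / 2 -> cutoff s = 1.
Proof.
move=> h; rewrite /cutoff [X in 1 - X]posn_le0 ?subr0 // subr_le0 posn_gt0; last lra.
by rewrite exprn_ege1 //; lra.
Qed.

Lemma cutoff0 s : 1 <= s -> cutoff s = 0.
Proof.
move=> h; rewrite /cutoff [posn 3 (2 - _)]posn_le0; last by lra.
by rewrite subr0 posn_gt0 // expr1n subrr.
Qed.

Lemma cutoff_itv s : 0 <= cutoff s <= 1.
Proof.
rewrite /cutoff; apply/andP; split; last by rewrite lerBlDr lerDl posn_ge0.
rewrite subr_ge0; have h := posn_ge0 3 (2 - 2 * s).
have [t0|t0] := leP (1 - posn 3 (2 - 2 * s)) 0; first by rewrite posn_le0.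
by rewrite (posn_gt0 3 (ltW t0)) exprn_ile1 ?(ltW t0) //; lra.
Qed.

(** Subsolutions are tested by functions above u on all of [Omega]. A function touching only near p,
    raised by a constant, is glued by a cutoff to a global majorant [G] of u; where both have
    positive weight both lie above u. *)
Lemma subsolution_local Omega (F : set 'M[R]_k) u psi p :
  open Omega -> subsolutions F Omega u -> isC2 Omega psi -> Omega p ->
  (\forall y \near p, u y - psi y <= u p - psi p) -> F (hessian psi p).
Proof.
move=> oO [uu hF] C2psi Op hmax.
have uu' x : Omega x -> usc_at u x.
  move=> Ox a ua; have := uu x Ox a ua; have := open_nbhs_nbhs (conj oO Ox).
  by apply: filterS2 => y Oy; apply.
have [G C2G uG] := C2_dominate oO uu'.
have [e e0 he] := nbhs_sqdP (filterI hmax (open_nbhs_nbhs (conj oO Op))).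
pose chi y := cutoff (sqd p y / e).
have C2chi : isC2 Omega chi.
  have c1 : isC2 Omega (fun y => sqd p y / e).
    exact: (C2M oO (C2_sqd p oO) (C2_cst Omega e^-1)).
  have c2 : isC2 Omega (fun y => 2 - 2 * (sqd p y / e)).
    have := C2D oO (C2_cst Omega 2) (C2M oO (C2_cst Omega (-2)) c1).
    by apply: (C2_eq oO) => y _ /=; rewrite mulNr.
  have c3 := @C2_comp_posn _ _ _ 0 _ oO c2.
  have c4 : isC2 Omega (fun y => 1 - posn 3 (2 - 2 * (sqd p y / e))).
    have := C2D oO (C2_cst Omega 1) (C2M oO (C2_cst Omega (-1)) c3).
    by apply: (C2_eq oO) => y _ /=; rewrite mulN1r.
  have c5 := @C2_comp_posn _ _ _ 0 _ oO c4.
  have := C2D oO (C2_cst Omega 1) (C2M oO (C2_cst Omega (-1)) c5).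
  by apply: (C2_eq oO) => y _ /=; rewrite mulN1r.
pose psi1 y := psi y + (u p - psi p).
have C2psi1 : isC2 Omega psi1 by exact: (C2D oO C2psi (C2_cst Omega (u p - psi p))).
pose phi y := G y + chi y * (psi1 y - G y).
have C2phi : isC2 Omega phi.
  have := C2D oO C2G (C2M oO C2chi (C2D oO C2psi1 (C2M oO (C2_cst Omega (-1)) C2G))).
  by apply: (C2_eq oO) => y _ /=; rewrite mulN1r.
have chi1 : \forall y \near p, chi y = 1.
  have e2 : 0 < e / 2 by rewrite divr_gt0.
  apply: filterS (nbhs_sqd_lt p e2) => y lt; apply: cutoff1.
  by rewrite ler_pdivrMr // mul1r mulrC ltW.
have phipsi : \near p, phi p = psi1 p.
  by apply: filterS chi1 => y; rewrite /phi => ->; rewrite mul1r addrC subrK.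
have phess i j : hess phi p i j = hess psi p i j.
  rewrite (hess_near i j phipsi) (hessD i j oO C2psi (C2_cst Omega (u p - psi p)) Op).
  by rewrite hess_cst addr0.
rewrite hessian_hess; under eq_mx do rewrite -phess; rewrite -hessian_hess.
apply: hF => //; first by move: C2phi; rewrite isC2E.
- move=> x Ox; rewrite /phi.
  have [lt|ge] := ltP (sqd p x) e; last first.
    by rewrite /chi cutoff0 ?mul0r ?addr0 ?uG // ler_pdivlMr // mul1r.
  have [h1 _] := he _ lt.
  have h2 : u x <= psi1 x by rewrite /psi1; lra.
  have /andP[c0 c1] := cutoff_itv (sqd p x / e); have h3 := uG x Ox.
  rewrite -/(chi x) in c0 c1; nra.
- have -> := nbhs_singleton phipsi; rewrite /psi1; lra.
Qed.

End Cutoff.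

(** * Polynomials and harmonic extension *)

Section Polynomials.
Context {R : realType} {n : nat}.
Local Notation E := 'rV[R]_n.
Variable x0 : E.
Implicit Types (f g h : E -> R) (x : E).

(* Functions that are homogeneous polynomials in [x - x0]. *)
Inductive hpoly : nat -> (E -> R) -> Prop :=
| hpoly_cst c : hpoly 0%N (fun=> c)
| hpoly_zero m : hpoly m (fun=> 0)
| hpoly_add m f g : hpoly m f -> hpoly m g -> hpoly m (fun x => f x + g x)
| hpoly_mul m i f : hpoly m f -> hpoly m.+1 (fun x => (x 0 i - x0 0 i) * f x).

Inductive polyn : (E -> R) -> Prop :=
| polyn_hpoly m f : hpoly m f -> polyn f
| polyn_add f g : polyn f -> polyn g -> polyn (fun x => f x + g x).

Lemma C2_center i : isC2 setT (fun x : E => x 0 i - x0 0 i).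
Proof. exact: (C2D openT (C2_coord setT i) (C2_cst setT (- x0 0 i))). Qed.

Lemma hpoly_C2 m f : hpoly m f -> isC2 setT f.
Proof.
elim=> {m f} [c|m|m f g _ cf _ cg|m i f _ cf].
- exact: C2_cst.
- exact: C2_cst.
- exact: (C2D openT cf cg).
- exact: (C2M openT (C2_center i) cf).
Qed.

Lemma polyn_C2 f : polyn f -> isC2 setT f.
Proof.
elim=> {f} [m f /hpoly_C2//|f g _ cf _ cg].
exact: (C2D openT cf cg).
Qed.

Lemma pd_center i j : pd i (fun x : E => x 0 j - x0 0 j) = fun=> (j == i)%:R.
Proof.
apply/funext => x.
have := pdD (C2_C1 (C2_coord setT j)) (C2_C1 (C2_cst setT (- x0 0 j))) i (I : setT x).
by rewrite pd_coord pd_cst addr0.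
Qed.

Lemma pd_mul_center m i j f : hpoly m f ->
  pd i (fun x => (x 0 j - x0 0 j) * f x) =
  fun x => (x 0 j - x0 0 j) * pd i f x + (j == i)%:R * f x.
Proof.
move=> /hpoly_C2 cf; apply/funext => x.
have := pdM (C2_C1 (C2_center j)) (C2_C1 cf) i (I : setT x).
by rewrite pd_center [f x * _]mulrC.
Qed.

Lemma pd_add f g i : isC2 setT f -> isC2 setT g ->
  pd i (fun x => f x + g x) = fun x => pd i f x + pd i g x.
Proof.
move=> cf cg; apply/funext => x.
exact: (pdD (C2_C1 cf) (C2_C1 cg) i (I : setT x)).
Qed.

Lemma hpoly_scale m (c : R) f : hpoly m f -> hpoly m (fun x => c * f x).
Proof.
elim=> {m f} [d|m|m f g _ hf _ hg|m i f _ hf].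
- exact: hpoly_cst.
- by under eq_fun do rewrite mulr0; exact: hpoly_zero.
- by under eq_fun do rewrite mulrDr; exact: hpoly_add.
- by under eq_fun do rewrite mulrCA; exact: hpoly_mul.
Qed.

(** As 0.-1 = 0, the degree alone would not tell that the derivative of a constant vanishes; the
    second conjunct does. *)
Lemma pd_hpoly m f i : hpoly m f -> hpoly m.-1 (pd i f) /\ (m = 0%N -> pd i f = fun=> 0).
Proof.
elim=> {m f} [c|m|m f g hf [hf1 hf2] hg [hg1 hg2]|m j f hf [hf1 hf2]].
- by rewrite pd_cst; split=> //; exact: hpoly_zero.
- by rewrite pd_cst; split=> //; exact: hpoly_zero.
- rewrite pd_add; [|exact: hpoly_C2 hf|exact: hpoly_C2 hg].
  split; first exact: hpoly_add.
  by move=> m0; rewrite hf2 // hg2 //; apply/funext => x; rewrite addr0.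
- split=> //; rewrite (pd_mul_center i j hf); apply: hpoly_add; last exact: hpoly_scale.
  case: m hf hf1 hf2 => [|m] hf hf1 hf2; last exact: hpoly_mul.
  by rewrite hf2 //; under eq_fun do rewrite mulr0; exact: hpoly_zero.
Qed.

Lemma hpoly_sum m (I : Type) (l : seq I) (F : I -> E -> R) :
  (forall i, hpoly m (F i)) -> hpoly m (fun x => \sum_(i <- l) F i x).
Proof.
move=> hF; elim: l => [|i l IH].
  by under eq_fun do rewrite big_nil; exact: hpoly_zero.
by under eq_fun do rewrite big_cons; exact: (hpoly_add (hF i) IH).
Qed.

Lemma euler m f x : hpoly m f -> \sum_i (x 0 i - x0 0 i) * pd i f x = m%:R * f x.
Proof.
elim=> {m f} [c|m|m f g hf IHf hg IHg|m j f hf IH].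
- by rewrite mul0r; apply: big1 => i _; rewrite pd_cst mulr0.
- by rewrite mulr0; apply: big1 => i _; rewrite pd_cst mulr0.
- rewrite mulrDr -IHf -IHg -big_split; apply: eq_bigr => i _ /=.
  by rewrite (pd_add i (hpoly_C2 hf) (hpoly_C2 hg)) mulrDr.
- under eq_bigr => i _ do rewrite (pd_mul_center i j hf) mulrDr mulrCA.
  rewrite big_split /= -mulr_sumr IH (bigD1 j) //= eqxx mul1r big1 ?addr0.
    by rewrite -natr1; ring.
  by move=> i /negbTE ij; rewrite eq_sym ij mul0r mulr0.
Qed.

Lemma hess_hpoly m f i j : hpoly m f ->
  hpoly m.-2 (fun x => hess f x i j) /\ ((m < 2)%N -> forall x, hess f x i j = 0).
Proof.
move=> hf; under eq_fun do rewrite hessE.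
have [h1 h1'] := pd_hpoly j hf; have [h2 h2'] := pd_hpoly i h1.
split; first by rewrite -[X in hpoly _ X]/(pd i (pd j f)).
move=> m2 x; rewrite hessE h2' //.
by case: m m2 {hf h1 h1' h2 h2'} => [|[]].
Qed.

Variable V : 'M[R]_n.
Hypothesis Vu : V \in unitmx.
Hypothesis n_gt0 : (0 < n)%N.
Let W := invmx V.
Let N := W *m W^T.

(** In the coordinates y = (x - x0) V^-1, [lap] is the Euclidean Laplacian and [ell] is |y|^2. *)
Definition lap f x : R := \sum_i \sum_j (V^T *m V) i j * hess f x i j.

Definition ell x : R := \sum_i (((x - x0) *m W) 0 i) ^+ 2.

Lemma lapD f g x : isC2 setT f -> isC2 setT g ->
  lap (fun x => f x + g x) x = lap f x + lap g x.
Proof.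
move=> cf cg; rewrite /lap -big_split; apply: eq_bigr => i _ /=.
rewrite -big_split; apply: eq_bigr => j _ /=.
have -> : hess (fun x => f x + g x) x i j = hess f x i j + hess g x i j.
  exact: (hessD i j openT cf cg (I : setT x)).
by rewrite mulrDr.
Qed.

Lemma hess_scale c f x i j : isC2 setT f -> hess (fun x => c * f x) x i j = c * hess f x i j.
Proof.
move=> cf; apply: etrans (hessM i j openT (C2_cst setT c) cf (I : setT x)) _.
by rewrite hess_cst !pd_cst /=; ring.
Qed.

Lemma lapZ c f x : isC2 setT f -> lap (fun x => c * f x) x = c * lap f x.
Proof.
move=> cf; rewrite /lap mulr_sumr; apply: eq_bigr => i _.
by rewrite mulr_sumr; apply: eq_bigr => j _; rewrite hess_scale // mulrCA.
Qed.

Lemma lap_hpoly m f : hpoly m f -> hpoly m.-2 (lap f) /\ ((m < 2)%N -> forall x, lap f x = 0).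
Proof.
move=> hf; split.
  by apply: hpoly_sum => i; apply: hpoly_sum => j; apply: hpoly_scale; exact: (hess_hpoly i j hf).1.
move=> m2 x; apply: big1 => i _; apply: big1 => j _.
by rewrite (hess_hpoly i j hf).2 // mulr0.
Qed.

Lemma ellE x : ell x = \sum_i \sum_j N i j * ((x 0 i - x0 0 i) * ((x 0 j - x0 0 j) * 1)).
Proof.
have -> : ell x = ((x - x0) *m N *m (x - x0)^T) 0 0.
  rewrite /N mulmxA -[_ *m W^T *m _]mulmxA -trmx_mul mxE.
  by apply: eq_bigr => i _; rewrite [X in _ * X]mxE expr2.
rewrite mxE exchange_big /=; apply: eq_bigr => j _.
rewrite mxE mulr_suml; apply: eq_bigr => i _; rewrite !mxE; ring.
Qed.

Lemma hpoly_ell : hpoly 2%N ell.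
Proof.
have -> : ell = fun x => \sum_i \sum_j N i j * ((x 0 i - x0 0 i) * ((x 0 j - x0 0 j) * 1)).
  by apply/funext => x; exact: ellE.
apply: hpoly_sum => i; apply: hpoly_sum => j; apply/hpoly_scale/hpoly_mul/hpoly_mul; exact: hpoly_cst.
Qed.

Lemma ell_ge0 x : 0 <= ell x.
Proof. by apply: sumr_ge0 => i _; exact: sqr_ge0. Qed.

Lemma ell_center : ell x0 = 0.
Proof. by rewrite /ell subrr mul0mx; apply: big1 => i _; rewrite mxE expr0n. Qed.

Lemma N_sym i j : N i j = N j i.
Proof.
have : N^T = N by rewrite /N trmx_mul trmxK.
by move/matrixP/(_ j i); rewrite mxE.
Qed.

Lemma PN : V^T *m V *m N = 1%:M.
Proof.
rewrite /N -mulmxA [V *m _]mulmxA mulmxV // mul1mx -trmx_mul mulVmx //.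
by rewrite trmx1.
Qed.

Lemma pd_sum (l : seq 'I_n) (F : 'I_n -> E -> R) i : (forall j, isC2 setT (F j)) ->
  pd i (fun x => \sum_(j <- l) F j x) = fun x => \sum_(j <- l) pd i (F j) x.
Proof.
move=> hF; elim: l => [|j l IH].
  by under eq_fun do rewrite big_nil; rewrite pd_cst; under [RHS]eq_fun do rewrite big_nil.
under eq_fun do rewrite big_cons; rewrite pd_add ?IH //; last exact: (C2_sum l openT hF).
by under [RHS]eq_fun do rewrite big_cons.
Qed.

Lemma pd_scale c f i : isC2 setT f -> pd i (fun x => c * f x) = fun x => c * pd i f x.
Proof.
move=> cf; apply/funext => x.
apply: etrans (pdM (C2_C1 (C2_cst setT c)) (C2_C1 cf) i (I : setT x)) _.
by rewrite pd_cst mulr0 addr0.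
Qed.

Lemma pd_ell i : pd i ell = fun x => \sum_j 2 * N i j * (x 0 j - x0 0 j).
Proof.
have hc : hpoly 0%N (fun x : E => 1) by exact: hpoly_cst.
have h1 j : hpoly 1%N (fun x : E => (x 0 j - x0 0 j) * 1) by exact: (hpoly_mul j hc).
have h2 j l : hpoly 2%N (fun x : E => (x 0 j - x0 0 j) * ((x 0 l - x0 0 l) * 1)) by exact: (hpoly_mul j (h1 l)).
have h3 j : hpoly 2%N (fun x : E => \sum_l N j l * ((x 0 j - x0 0 j) * ((x 0 l - x0 0 l) * 1))).
  by apply: hpoly_sum => l; exact: hpoly_scale.
have -> : ell = fun x => \sum_i \sum_j N i j * ((x 0 i - x0 0 i) * ((x 0 j - x0 0 j) * 1)).
  by apply/funext => x; exact: ellE.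
rewrite pd_sum => [|j]; last exact: hpoly_C2 (h3 j).
apply/funext => x.
transitivity (\sum_a \sum_b N a b * ((x 0 a - x0 0 a) * (b == i)%:R + (a == i)%:R * (x 0 b - x0 0 b))).
  apply: eq_bigr => a _; rewrite pd_sum => [|b]; last exact: hpoly_C2 (hpoly_scale _ (h2 a b)).
  apply: eq_bigr => b _; rewrite pd_scale; last exact: hpoly_C2 (h2 a b).
  rewrite (pd_mul_center i a (h1 b)) (pd_mul_center i b hc) pd_cst.
  by rewrite mulr0 add0r !mulr1.
transitivity (\sum_a N a i * (x 0 a - x0 0 a) + \sum_b N i b * (x 0 b - x0 0 b)).
  under eq_bigr => a _ do (under eq_bigr => b _ do rewrite mulrDr; rewrite big_split /=).
  rewrite big_split /=; congr (_ + _).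
    apply: eq_bigr => a _; rewrite (bigD1 i) //= eqxx mulr1 big1 ?addr0 // => b /negbTE bi.
    by rewrite bi !mulr0.
  rewrite exchange_big /=; apply: eq_bigr => b _.
  rewrite (bigD1 i) //= eqxx mul1r big1 ?addr0 // => a /negbTE ai.
  by rewrite ai mul0r mulr0.
by rewrite -big_split; apply: eq_bigr => a _ /=; rewrite [N a i]N_sym; ring.
Qed.

Lemma hess_ell i j x : hess ell x i j = 2 * N i j.
Proof.
rewrite hessE pd_ell pd_sum => [|l]; last exact: (C2M openT (C2_cst setT _) (C2_center l)).
rewrite (bigD1 i) //= big1 ?addr0 => [|l /negbTE li]; last first.
  by rewrite pd_scale ?pd_center ?li ?mulr0 //; exact: C2_center.
by rewrite pd_scale ?pd_center ?eqxx ?mulr1 1?N_sym //; exact: C2_center.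
Qed.

(** Leibniz rule: V^T V is inverse to N and the Hessian of [ell] is 2 N, so the Laplacian of [ell]
    is 2 n. The gradient of [ell] becomes 2 (x - x0) under V^T V, so Euler's identity turns each of
    the two cross terms into 2 m g. *)
Lemma lap_ell_mul m g x : hpoly m g ->
  lap (fun x => ell x * g x) x = (2 * n%:R + 4 * m%:R) * g x + ell x * lap g x.
Proof.
move=> hg.
have P_sym i j : (V^T *m V) i j = (V^T *m V) j i.
  have : (V^T *m V)^T = V^T *m V by rewrite trmx_mul trmxK.
  by move/matrixP/(_ j i); rewrite mxE.
have tr : \sum_i \sum_j (V^T *m V) i j * (2 * N i j) = 2 * n%:R.
  have -> : n%:R = \tr (V^T *m V *m N) by rewrite PN mxtrace1.
  rewrite mulr_sumr; apply: eq_bigr => i _; rewrite [X in 2 * X]mxE mulr_sumr.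
  by apply: eq_bigr => j _; rewrite [N j i]N_sym; ring.
have cross : \sum_i \sum_j (V^T *m V) i j * (pd i ell x * pd j g x) = 2 * (m%:R * g x).
  rewrite -(euler x hg) exchange_big /= mulr_sumr; apply: eq_bigr => j _.
  have -> : \sum_i (V^T *m V) i j * (pd i ell x * pd j g x) =
     (\sum_i (V^T *m V) j i * pd i ell x) * pd j g x.
    by rewrite mulr_suml; apply: eq_bigr => i _; rewrite P_sym mulrA.
  rewrite mulrA; congr (_ * _).
  have pE i : pd i ell x = 2 * \sum_l N i l * (x 0 l - x0 0 l).
    by rewrite pd_ell mulr_sumr; apply: eq_bigr => l _; rewrite mulrA.
  under eq_bigr => i _ do rewrite pE mulrCA mulr_sumr.
  rewrite -mulr_sumr; congr (_ * _); rewrite exchange_big /=.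
  under eq_bigr => l _.
    under eq_bigr => i _ do rewrite mulrA.
    rewrite -mulr_suml (_ : \sum_i _ = (V^T *m V *m N) j l); last by rewrite mxE.
    rewrite PN mxE; over.
  rewrite (bigD1 j) //= eqxx mul1r big1 ?addr0 // => i /negbTE ij.
  by rewrite eq_sym ij mul0r.
have cross' : \sum_i \sum_j (V^T *m V) i j * (pd i g x * pd j ell x) = 2 * (m%:R * g x).
  rewrite -cross exchange_big /=; apply: eq_bigr => i _; apply: eq_bigr => j _.
  by rewrite P_sym [pd j g x * _]mulrC.
have -> : lap (fun x => ell x * g x) x =
    \sum_i \sum_j (V^T *m V) i j * (2 * N i j) * g x +
    ell x * lap g x +
    (\sum_i \sum_j (V^T *m V) i j * (pd i ell x * pd j g x) +
     \sum_i \sum_j (V^T *m V) i j * (pd i g x * pd j ell x)).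
  rewrite /lap mulr_sumr -!big_split; apply: eq_bigr => i _ /=.
  rewrite mulr_sumr -!big_split; apply: eq_bigr => j _ /=.
  have -> : hess (fun x => ell x * g x) x i j = _ :=
    hessM i j openT (hpoly_C2 hpoly_ell) (hpoly_C2 hg) (I : setT x).
  by rewrite hess_ell; ring.
rewrite cross cross'.
have -> : \sum_i \sum_j (V^T *m V) i j * (2 * N i j) * g x = 2 * n%:R * g x.
  by rewrite -tr mulr_suml; apply: eq_bigr => i _; rewrite mulr_suml.
by ring.
Qed.

End Polynomials.

(** * Dirichlet problem with polynomial data and maximum principle *)

Section Harmonic.
Context {R : realType} {n : nat}.
Local Notation E := 'rV[R]_n.
Variables (x0 : E) (V : 'M[R]_n).
Hypothesis Vu : V \in unitmx.
Hypothesis n_gt0 : (0 < n)%N.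
Implicit Types (f g h : E -> R) (x : E).
Local Notation hpoly := (hpoly x0).
Local Notation polyn := (polyn x0).
Local Notation lap := (lap V).
Local Notation ell := (ell x0 V).

Lemma hpoly_ell_mul m g : hpoly m g -> hpoly m.+2 (fun x => ell x * g x).
Proof.
move=> hg.
have -> : (fun x => ell x * g x) = fun x => \sum_i \sum_j
    (invmx V *m (invmx V)^T) i j * ((x 0 i - x0 0 i) * ((x 0 j - x0 0 j) * g x)).
  apply/funext => x; rewrite ellE mulr_suml; apply: eq_bigr => i _.
  by rewrite mulr_suml; apply: eq_bigr => j _; ring.
apply: hpoly_sum => i; apply: hpoly_sum => j; apply: hpoly_scale.
exact: (hpoly_mul i (hpoly_mul j hg)).
Qed.

(* By Euler's identity [lap (ell * g) = (2 n + 4 m) g + ell * lap g] for [g]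
   homogeneous of degree [m]; applying [lap] to the equation lowers its degree by
   2 and keeps its form, with a larger [al]. *)
Lemma lap_ell_solve m (al : R) h : 0 <= al -> hpoly m h ->
  exists2 g, hpoly m g & forall x, al * g x + lap (fun x => ell x * g x) x = h x.
Proof.
elim/ltn_ind: m al h => m IH al h al0 hh.
pose be : R := al + (2 * n%:R + 4 * m%:R).
have be0 : 0 < be.
  have n0 : 0 < n%:R :> R by rewrite ltr0n.
  have m0 : 0 <= m%:R :> R by [].
  rewrite /be; lra.
have [m2|m2] := ltnP m 2.
  exists (fun x => be^-1 * h x); first exact: hpoly_scale.
  move=> x; have hg := hpoly_scale be^-1 hh.
  rewrite (lap_ell_mul Vu x hg) (lap_hpoly V hg).2 // mulr0 addr0 -mulrDl mulrA divff ?mul1r //.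
  exact: lt0r_neq0.
case: m m2 IH hh @be be0 => [//|[//|m]] _ IH hh be be0.
have hl : hpoly m (lap h) := (lap_hpoly V hh).1.
(* The equation reads be g + ell (lap g) = h. Its Laplacian is the same kind of equation for g1 =
   lap g, and g is then recovered as (h - ell g1) / be. *)
have [|g1 hg1 E1] := IH m _ be (lap h) (ltW be0) hl; first by rewrite ltnS leqnSn.
pose g x := be^-1 * (h x + (-1) * (ell x * g1 x)).
have he : hpoly m.+2 (fun x => (-1) * (ell x * g1 x)) by exact: hpoly_scale (hpoly_ell_mul hg1).
have hg : hpoly m.+2 g by exact: hpoly_scale (hpoly_add hh he).
exists g => // x.
have lg : lap g x = g1 x.
  rewrite /g (lapZ V be^-1 x (hpoly_C2 (hpoly_add hh he))).
  rewrite (lapD V x (hpoly_C2 hh) (hpoly_C2 he)) (lapZ V (-1) x (hpoly_C2 (hpoly_ell_mul hg1))).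
  by rewrite -E1 mulN1r addrK mulKf // lt0r_neq0.
rewrite (lap_ell_mul Vu x hg) lg addrA -mulrDl -/be /g mulVKf ?lt0r_neq0 //.
by rewrite mulN1r subrK.
Qed.

Definition extends f := exists H, [/\ polyn H, forall x, lap H x = 0 &
  forall x, ell x = 1 -> H x = f x].

(** Choose g with lap (ell g) = lap f, of degree lower by 2. Then f - ell g is harmonic and equals f
    - g on the boundary; adding the harmonic extension of g restores the boundary values. *)
Lemma hpoly_extends m f : hpoly m f -> extends f.
Proof.
elim/ltn_ind: m f => m IH f hf.
have [m2|m2] := ltnP m 2.
  by exists f; split=> // [|x]; [exact: polyn_hpoly hf | exact: (lap_hpoly V hf).2].
case: m m2 IH hf => [//|[//|m]] _ IH hf.
have hl : hpoly m (lap f) := (lap_hpoly V hf).1.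
have [g hg Eg] := lap_ell_solve (lexx 0) hl.
have [|H [pH lH HE]] := IH m _ g hg; first by rewrite ltnS leqnSn.
have he : hpoly m.+2 (fun x => (-1) * (ell x * g x)) by exact: hpoly_scale (hpoly_ell_mul hg).
have hfe := hpoly_add hf he.
exists (fun x => (f x + (-1) * (ell x * g x)) + H x); split.
- exact: (polyn_add (polyn_hpoly hfe) pH).
- move=> x; rewrite (lapD V x (hpoly_C2 hfe) (polyn_C2 pH)) lH addr0.
  rewrite (lapD V x (hpoly_C2 hf) (hpoly_C2 he)) (lapZ V (-1) x (hpoly_C2 (hpoly_ell_mul hg))).
  by rewrite -Eg mul0r add0r mulN1r subrr.
- by move=> x e1; rewrite HE // e1 mul1r mulN1r subrK.
Qed.

Lemma polyn_extends f : polyn f -> extends f.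
Proof.
elim=> {f} [m f|f g _ [F [pF lF FE]] _ [G [pG lG GE]]]; first exact: hpoly_extends.
exists (fun x => F x + G x); split; first exact: polyn_add.
- by move=> x; rewrite (lapD V x (polyn_C2 pF) (polyn_C2 pG)) lF lG addr0.
- by move=> x e1; rewrite FE // GE.
Qed.

(** Second-order expansion along lines with a cubic remainder; for polynomials it follows by
    structural induction. *)
Definition taylor f := forall z v : E, exists2 M : R, 0 <= M & forall s : R, `|s| <= 1 ->
  `|f (z + s *: v) - f z - s * (\sum_i v 0 i * pd i f z) -
    s ^+ 2 * (2^-1 * \sum_i \sum_j v 0 i * v 0 j * hess f z i j)| <= M * `|s| ^+ 3.

Lemma taylorD f g : isC2 setT f -> isC2 setT g -> taylor f -> taylor g ->
  taylor (fun x => f x + g x).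
Proof.
move=> cf cg hf hg z v; have [M M0 hM] := hf z v; have [K K0 hK] := hg z v.
exists (M + K); first exact: addr_ge0.
move=> s s1; rewrite mulrDl; apply: (le_trans _ (lerD (hM s s1) (hK s s1))).
apply: (le_trans _ (ler_normD _ _)).
have -> : \sum_i v 0 i * pd i (fun x => f x + g x) z =
    \sum_i v 0 i * pd i f z + \sum_i v 0 i * pd i g z.
  by rewrite -big_split; apply: eq_bigr => i _; rewrite (pd_add i cf cg) mulrDr.
have -> : \sum_i \sum_j v 0 i * v 0 j * hess (fun x => f x + g x) z i j =
    \sum_i \sum_j v 0 i * v 0 j * hess f z i j + \sum_i \sum_j v 0 i * v 0 j * hess g z i j.
  rewrite -big_split; apply: eq_bigr => i _; rewrite -big_split; apply: eq_bigr => j _ /=.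
  have -> : hess (fun x => f x + g x) z i j = hess f z i j + hess g z i j :=
    hessD i j openT cf cg (I : setT z).
  by rewrite mulrDr.
rewrite le_eqVlt; apply/orP; left; apply/eqP; congr `|_|; ring.
Qed.

Lemma hpoly_taylor m f : hpoly m f -> taylor f.
Proof.
elim=> {m f} [c|m|m f g hf tf hg tg|m k f hf tf].
- move=> z v; exists 0 => // s _; rewrite mul0r normr_le0 subrr sub0r.
  rewrite big1 => [|i _]; last by rewrite pd_cst mulr0.
  rewrite big1 => [|i _]; last by apply: big1 => j _; rewrite hess_cst mulr0.
  by rewrite !mulr0 subr0 oppr0.
- move=> z v; exists 0 => // s _; rewrite mul0r normr_le0 subrr sub0r.
  rewrite big1 => [|i _]; last by rewrite pd_cst mulr0.
  rewrite big1 => [|i _]; last by apply: big1 => j _; rewrite hess_cst mulr0.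
  by rewrite !mulr0 subr0 oppr0.
- exact: taylorD (hpoly_C2 hf) (hpoly_C2 hg) tf tg.
- move=> z v; have [M M0 hM] := tf z v.
  set D1 := \sum_i v 0 i * pd i f z in hM.
  set D2 := \sum_i \sum_j v 0 i * v 0 j * hess f z i j in hM.
  pose a := z 0 k - x0 0 k.
  have -> : \sum_i v 0 i * pd i (fun x => (x 0 k - x0 0 k) * f x) z = a * D1 + v 0 k * f z.
    under eq_bigr => i _ do rewrite (pd_mul_center i k hf) mulrDr.
    rewrite big_split /= mulr_sumr; congr (_ + _).
      by apply: eq_bigr => i _; rewrite mulrCA.
    rewrite (bigD1 k) //= eqxx mul1r big1 ?addr0 // => i /negbTE ik.
    by rewrite eq_sym ik mul0r mulr0.
  have -> : \sum_i \sum_j v 0 i * v 0 j * hess (fun x => (x 0 k - x0 0 k) * f x) z i j =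
      a * D2 + 2 * (v 0 k * D1).
    have hE i j : hess (fun x => (x 0 k - x0 0 k) * f x) z i j =
        a * hess f z i j + ((k == i)%:R * pd j f z + pd i f z * (k == j)%:R).
      apply: etrans (hessM i j openT (C2_center x0 k) (hpoly_C2 hf) (I : setT z)) _.
      have -> : hess (fun x : E => x 0 k - x0 0 k) z i j = 0.
        by rewrite hessE (pd_center x0 j k) pd_cst.
      by rewrite (pd_center x0 i k) (pd_center x0 j k) /= -/a; ring.
    have S1 : \sum_i \sum_j v 0 i * v 0 j * ((k == i)%:R * pd j f z) = v 0 k * D1.
      rewrite (bigD1 k) //= eqxx [X in _ + X]big1 ?addr0 => [|i /negbTE ik]; last first.
        by apply: big1 => j _; rewrite eq_sym ik mul0r mulr0.
      by rewrite /D1 mulr_sumr; apply: eq_bigr => j _; rewrite mul1r mulrA.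
    have S2 : \sum_i \sum_j v 0 i * v 0 j * (pd i f z * (k == j)%:R) = v 0 k * D1.
      rewrite -S1 exchange_big /=; apply: eq_bigr => i _; apply: eq_bigr => j _; ring.
    transitivity (a * D2 + (\sum_i \sum_j v 0 i * v 0 j * ((k == i)%:R * pd j f z) +
        \sum_i \sum_j v 0 i * v 0 j * (pd i f z * (k == j)%:R))); last by rewrite S1 S2; ring.
    rewrite /D2 mulr_sumr -!big_split; apply: eq_bigr => i _ /=.
    by rewrite mulr_sumr -!big_split; apply: eq_bigr => j _ /=; rewrite hE; ring.
  exists (`|a| * M + `|v 0 k| * M + `|v 0 k * (2^-1 * D2)|).
    by rewrite !addr_ge0 // mulr_ge0.
  move=> s s1; have := hM s s1; set r := (X in `|X| <= _) => hr.
  rewrite !mxE.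
  have -> : (z 0 k + s * v 0 k - x0 0 k) * f (z + s *: v) - (z 0 k - x0 0 k) * f z -
      s * (a * D1 + v 0 k * f z) - s ^+ 2 * (2^-1 * (a * D2 + 2 * (v 0 k * D1))) =
      a * r + s * (v 0 k * r) + v 0 k * (2^-1 * D2) * s ^+ 3.
    by rewrite /r /a; field.
  apply: (le_trans (ler_normD _ _)); rewrite [X in _ <= X]mulrDl lerD //; last first.
    by rewrite normrM normrX.
  apply: (le_trans (ler_normD _ _)); rewrite [X in _ <= X]mulrDl lerD //.
    by rewrite normrM -mulrA ler_wpM2l.
  rewrite !normrM -[X in _ <= X]mul1r -[X in _ <= 1 * X]mulrA.
  by rewrite ler_pM // ?mulr_ge0 // ler_wpM2l.
Qed.

Lemma polyn_taylor f : polyn f -> taylor f.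
Proof.
elim=> {f} [m f|f g pf tf pg tg]; first exact: hpoly_taylor.
exact: taylorD (polyn_C2 pf) (polyn_C2 pg) tf tg.
Qed.

(** [lap] is the sum of the second derivatives along the rows of V. Adding the expansions at z + s v
    and z - s v cancels the first-order term and shows each of them nonpositive. *)
Lemma polyn_max_lap f z : polyn f -> (\forall x \near z, f x <= f z) -> lap f z <= 0.
Proof.
move=> pf hmax.
suff dir (v : E) : \sum_i \sum_j v 0 i * v 0 j * hess f z i j <= 0.
  have -> : lap f z = \sum_l \sum_i \sum_j (row l V) 0 i * (row l V) 0 j * hess f z i j.
    rewrite exchange_big /=; apply: eq_bigr => i _; rewrite exchange_big /=; apply: eq_bigr => j _.
    by rewrite -mulr_suml mxE; congr (_ * _); apply: eq_bigr => l _; rewrite !mxE.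
  by apply: sumr_le0 => l _; exact: dir.
set D2 := \sum_i _; rewrite leNgt; apply/negP => D2_gt0.
have [M M0 hM] := polyn_taylor pf z v.
have [e e0 he] : exists2 e : R, 0 < e & forall s, `|s| < e -> f (z + s *: v) <= f z.
  have c : (fun s : R => z + s *: v) @ 0 --> z.
    rewrite -[X in _ --> X]addr0 -[X in _ + X](scale0r v).
    apply: cvgD; first exact: cvg_cst.
    by apply: cvgZr_tmp; exact: cvg_id.
  have /nbhs_ballP[e /= e0 he] := c _ hmax.
  by exists e => // s se; apply: he; rewrite -ball_normE /= sub0r normrN.
(* With this s the remainder bound 2 M s is at most D2 / 2, contradicting D2 <= 2 M s. *)
pose s : R := Num.min (e / 2) (Num.min 1 (D2 / (4 * (M + 1)))).
have M1 : 0 < 4 * (M + 1) by rewrite mulr_gt0 // ltr_wpDl.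
have s0 : 0 < s by rewrite !lt_min divr_gt0 // ltr01 divr_gt0.
have se : s < e.
  have : s <= e / 2 by rewrite /s ge_min lexx.
  lra.
have s1 : s <= 1 by rewrite /s !ge_min lexx orbT.
have sD : s * (4 * (M + 1)) <= D2.
  by rewrite -ler_pdivlMr // /s !ge_min lexx !orbT.
have ns : `|s| = s by rewrite gtr0_norm.
have nms : `|- s| = s by rewrite normrN.
have := hM s; have := hM (- s); rewrite nms ns => /(_ s1) + /(_ s1).
have := he s; have := he (- s); rewrite nms ns => /(_ se) + /(_ se).
rewrite -/D2 !ler_norml.
set A := \sum_i _; set f1 := f (z + s *: v); set f2 := f _ => h1 h2 /andP[h3 _] /andP[h4 _].
have key : s ^+ 2 * D2 <= 2 * (M * s ^+ 3).
  by move: h1 h2 h3 h4; rewrite sqrrN; lra.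
have : D2 <= 2 * (M * s).
  have s2 : 0 < s ^+ 2 by rewrite exprn_gt0.
  rewrite -(ler_pM2l s2); apply: (le_trans key); rewrite le_eqVlt; apply/orP; left.
  by apply/eqP; ring.
have : 0 <= M * s by rewrite mulr_ge0 // ltW.
by move: sD D2_gt0; lra.
Qed.

Lemma ell_continuous : continuous ell.
Proof.
move=> x; have := hpoly_C2 (hpoly_ell x0 V); rewrite isC2E => /(_ x I)[] //.
Qed.

Lemma ell_compact (A : set R) : closed A -> A `<=` [set t | t <= 1] ->
  compact (ell @^-1` A).
Proof.
move=> cA A1; apply: bounded_closed_compact; last first.
  by apply: closed_comp => // x _; exact: ell_continuous.
pose K : R := `|x0| + \sum_i \sum_j `|V i j|.
exists K; split; first exact: num_real.
move=> M KM x /A1 /= e1; apply: (le_trans _ (ltW KM)).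
have -> : x = x0 + (x - x0) by rewrite addrC subrK.
apply: (le_trans (ler_normD _ _)); rewrite lerD2l.
set z := (x - x0) *m invmx V.
have -> : x - x0 = z *m V by rewrite /z mulmxKV.
have z1 i : `|z 0 i| <= 1.
  have : (z 0 i) ^+ 2 <= 1.
    apply: le_trans e1; rewrite /ell (bigD1 i) //= lerDl sumr_ge0 // => l _.
    exact: sqr_ge0.
  by move=> h; rewrite ler_norml; apply/andP; split; nra.
have S0 : 0 <= \sum_i \sum_j `|V i j| by apply: sumr_ge0 => i _; exact: sumr_ge0.
have -> : `|z *m V| = mx_norm (z *m V) by [].
rewrite mx_normrE; apply/bigmax_leP; split=> // -[a j] _ /=.
rewrite ord1 mxE; apply: (le_trans (ler_norm_sum _ _ _)).
apply: ler_sum => i _; rewrite normrM; apply: (le_trans (_ : _ <= `|V i j|)).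
  by rewrite -[X in _ <= X]mul1r ler_wpM2r.
by rewrite (bigD1 j) //= lerDl sumr_ge0.
Qed.

(** Weak maximum principle: H + e ell has positive Laplacian 2 n e, so it has no interior
    maximum. *)
Lemma harmonic_le H b : polyn H -> (forall x, lap H x = 0) ->
  (forall x, ell x = 1 -> H x <= b) -> forall x, ell x <= 1 -> H x <= b.
Proof.
move=> pH lH Hb x xB; rewrite leNgt; apply/negP => bH.
(* On the boundary H + e ell is at most b + e, which is less than H x, so the maximum would be
   interior. *)
pose e := (H x - b) / 2.
have e0 : 0 < e by rewrite divr_gt0 // subr_gt0.
pose f y := H y + e * ell y.
have pf : polyn f by apply: polyn_add => //; exact: (polyn_hpoly (hpoly_scale e (hpoly_ell x0 V))).
have cB : compact (ell @^-1` [set t | t <= 1]) by apply: ell_compact => //; exact: closed_le.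
have cf : continuous f.
  by move=> y; have := polyn_C2 pf; rewrite isC2E => /(_ y I)[].
have [z zB zmax] : exists2 z, (ell @^-1` [set t | t <= 1]) z &
    forall y, (ell @^-1` [set t | t <= 1]) y -> f y <= f z.
  apply: usc_max => //; first by exists x.
  by move=> y _ a fa; have := cf y; move/cvgr_lt => /(_ a fa); apply: filterS.
have fx : H x <= f z.
  by apply: (le_trans _ (zmax x xB)); rewrite lerDl mulr_ge0 ?ell_ge0 // ltW.
have z1 : ell z < 1.
  rewrite lt_neqAle; apply/andP; split; last exact: zB.
  apply/eqP => e1; have := Hb z e1; move: fx; rewrite /f e1 mulr1 /e; lra.
have : lap f z <= 0.
  apply: polyn_max_lap => //.
  have := @ell_continuous z; move/cvgr_lt => /(_ 1 z1).
  by apply: filterS => y y1; apply: zmax; exact: ltW.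
rewrite /f (lapD V z (polyn_C2 pH) (hpoly_C2 (hpoly_scale e (hpoly_ell x0 V)))) lH add0r.
rewrite (lapZ V e z (hpoly_C2 (hpoly_ell x0 V))).
have := lap_ell_mul Vu z (hpoly_cst x0 1).
have -> : (fun x => ell x * 1) = ell by apply/funext => y; rewrite mulr1.
have l1 : lap (fun=> 1) z = 0 by exact: (lap_hpoly V (hpoly_cst x0 1)).2.
have nR : 0 < n%:R :> R by rewrite ltr0n.
move=> ->; rewrite l1 !mulr0 !addr0 mulr1 leNgt => /negP; apply.
by rewrite mulr_gt0 // mulr_gt0.
Qed.

Lemma harmonic_ge H b : polyn H -> (forall x, lap H x = 0) ->
  (forall x, ell x = 1 -> b <= H x) -> forall x, ell x <= 1 -> b <= H x.
Proof.
move=> pH lH Hb x xB.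
have pN : polyn (fun x => -1 * H x).
  elim: pH => {lH Hb} [m f hf|f g _ pf _ pg]; first exact: polyn_hpoly (hpoly_scale (-1) hf).
  by under eq_fun do rewrite mulrDr; exact: polyn_add.
rewrite -lerN2 -[- H x]mulN1r; apply: (harmonic_le pN) => // y.
  by rewrite (lapZ V (-1) y (polyn_C2 pH)) lH mulr0.
by move=> y1; rewrite mulN1r lerN2 Hb.
Qed.

Lemma polyn_cst c : polyn (fun=> c).
Proof. exact: polyn_hpoly (hpoly_cst x0 c). Qed.

Lemma polyn_scale c f : polyn f -> polyn (fun x => c * f x).
Proof.
elim=> {f} [m f hf|f g _ pf _ pg]; first exact: polyn_hpoly (hpoly_scale c hf).
by under eq_fun do rewrite mulrDr; exact: polyn_add.
Qed.

Lemma polyn_center i f : polyn f -> polyn (fun x => (x 0 i - x0 0 i) * f x).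
Proof.
elim=> {f} [m f hf|f g _ pf _ pg]; first exact: polyn_hpoly (hpoly_mul i hf).
by under eq_fun do rewrite mulrDr; exact: polyn_add.
Qed.

Lemma polyn_mul f g : polyn f -> polyn g -> polyn (fun x => f x * g x).
Proof.
move=> pf pg; elim: pf => {f} [m f hf|f f' _ pf _ pf'].
  elim: hf => {m f} [c|m|m f f' _ pf _ pf'|m i f _ pf].
  - exact: polyn_scale.
  - by under eq_fun do rewrite mul0r; exact: polyn_cst.
  - by under eq_fun do rewrite mulrDl; exact: polyn_add.
  - by under eq_fun do rewrite -mulrA; exact: polyn_center.
by under eq_fun do rewrite mulrDl; exact: polyn_add.
Qed.

Lemma polyn_exp f m : polyn f -> polyn (fun x => f x ^+ m).
Proof.
move=> pf; elim: m => [|m IH]; first by under eq_fun do rewrite expr0; exact: polyn_cst.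
by under eq_fun do rewrite exprS; exact: polyn_mul.
Qed.

Lemma polyn_sub f g : polyn f -> polyn g -> polyn (fun x => f x - g x).
Proof.
move=> pf pg; have := polyn_add pf (polyn_scale (-1) pg).
by under eq_fun do rewrite mulN1r.
Qed.

Lemma polyn_sqd y : polyn (sqd y).
Proof.
rewrite /sqd; elim: (index_enum _) => [|i l IH].
  by under eq_fun do rewrite big_nil; exact: polyn_cst.
under eq_fun do rewrite big_cons; apply: polyn_add => //.
apply: polyn_exp.
have -> : (fun x : E => x 0 i - y 0 i) = fun x => (x 0 i - x0 0 i) * 1 + (x0 0 i - y 0 i).
  by apply/funext => x; ring.
by apply: polyn_add; [apply: polyn_center; exact: polyn_cst | exact: polyn_cst].
Qed.

End Harmonic.

(** * Polynomial selection of times *)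

Section Selection.
Context {R : realType} {n : nat}.
Local Notation E := 'rV[R]_n.
Variable x0 : E.
Local Notation polyn := (polyn x0).

Lemma bernoulli (y : R) m : 0 <= y -> 1 + m%:R * y <= (1 + y) ^+ m.
Proof.
move=> y0; elim: m => [|m IH]; first by rewrite mul0r addr0 expr0.
rewrite exprS; apply: (@le_trans _ _ ((1 + y) * (1 + m%:R * y))); last first.
  by rewrite ler_wpM2l // addr_ge0.
have : 0 <= m%:R * y * y by rewrite !mulr_ge0.
by rewrite -[m.+1%:R]natr1; lra.
Qed.

Lemma bernoulliN (y : R) m : 0 <= y <= 1 -> 1 - m%:R * y <= (1 - y) ^+ m.
Proof.
move=> /andP[y0 y1]; elim: m => [|m IH]; first by rewrite mul0r subr0 expr0.
rewrite exprS; apply: (@le_trans _ _ ((1 - y) * (1 - m%:R * y))); last first.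
  by rewrite ler_wpM2l // subr_ge0.
have : 0 <= m%:R * y * y by rewrite !mulr_ge0.
by rewrite -[m.+1%:R]natr1; lra.
Qed.

Lemma pow2_small (e : R) : 0 < e -> exists m, (2^-1 : R) ^+ m <= e.
Proof.
move=> e0; pose m := (Num.truncn e^-1).+1; exists m.
rewrite exprVn -[X in _ <= X]invrK lef_pV2 ?posrE ?exprn_gt0 ?invr_gt0 //.
have h : e^-1 < m%:R by exact: truncnS_gt.
have := @bernoulli 1 m ler01; rewrite mulr1 (_ : 1 + 1 = 2) // => b.
by apply: ltW (lt_le_trans h _); apply: le_trans b; rewrite lerDr.
Qed.

(* [(1 - s^m)^(K^m)] tends to 1 for [s K <= 1/2] and to 0 for [s K >= 2]. *)
Lemma peak (S : set E) (y : E) (U : set E) : compact S -> S y -> nbhs y U ->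
  exists2 U', nbhs y U' & U' `<=` U /\ forall e : R, 0 < e -> exists2 p, polyn p &
    forall x, S x -> [/\ 0 <= p x <= 1, U' x -> 1 - e <= p x & ~ U x -> p x <= e].
Proof.
move=> cS Sy yU.
have [z Sz zmax] : exists2 z, S z & forall x, S x -> sqd y x <= sqd y z.
  apply: usc_max => //; first by exists y.
  by move=> x _ a xa; have := @sqd_continuous R n y x; move/cvgr_lt => /(_ a xa); apply: filterS.
pose r : R := sqd y z + 1.
have r0 : 0 < r by rewrite ltr_wpDl ?sqd_ge0.
have [d d0 dU] := nbhs_sqdP yU.
(* With s = [sqd y] / r, which is at most 1 on S, this K gives K s >= 2 outside U, and the radius
   [c] below gives K s <= 1 / 2 on U'. *)
pose K := (Num.truncn (2 * r / d)).+1.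
have K0 : 0 < K%:R :> R by rewrite ltr0n.
have hK : 2 * r / d < K%:R by exact: truncnS_gt.
pose c : R := Num.min d (r / (2 * K%:R)).
have c0 : 0 < c by rewrite lt_min d0 divr_gt0 // mulr_gt0.
(* U' is fixed before e: in [polyn_selection] the accuracy is chosen only after the cover. *)
exists [set x | sqd y x < c]; first exact: nbhs_sqd_lt.
split=> [x xc|e e0]; first by apply: dU; rewrite (lt_le_trans xc) // ge_min lexx.
have [m hm] := pow2_small e0.
pose s x := r^-1 * sqd y x.
exists (fun x => (1 - s x ^+ m) ^+ (K ^ m)%N).
  apply/polyn_exp/polyn_sub; first exact: polyn_cst.
  by apply/polyn_exp/polyn_scale; exact: polyn_sqd.
move=> x Sx.
have s0 : 0 <= s x by rewrite mulr_ge0 ?sqd_ge0 // invr_ge0 ltW.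
have s1 : s x <= 1.
  by rewrite /s mulrC ler_pdivrMr // mul1r (le_trans (zmax x Sx)) // lerDl.
have sm0 : 0 <= s x ^+ m by rewrite exprn_ge0.
have sm1 : s x ^+ m <= 1 by rewrite exprn_ile1.
have i0 : 0 <= 1 - s x ^+ m by rewrite subr_ge0.
have i1 : 1 - s x ^+ m <= 1 by rewrite lerBlDr lerDl.
have KE : (K ^ m)%N%:R * s x ^+ m = (K%:R * s x) ^+ m by rewrite natrX -exprMn.
have Ks0 : 0 <= K%:R * s x by rewrite mulr_ge0 // ltW.
split; first by rewrite exprn_ge0 // exprn_ile1.
- move=> /= xc; apply: (le_trans _ (@bernoulliN _ (K ^ m)%N _)); last by rewrite sm0.
  rewrite KE lerD2l lerN2; apply: le_trans hm; rewrite lerXn2r ?nnegrE //.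
  have : sqd y x <= r / (2 * K%:R) by apply/ltW/(lt_le_trans xc); rewrite ge_min lexx orbT.
  rewrite ler_pdivlMr ?mulr_gt0 // => h.
  rewrite /s mulrCA -ler_pdivlMl ?invr_gt0 // invrK.
  by lra.
- move=> nU; have xd : d <= sqd y x by rewrite leNgt; apply/negP => /dU.
  have Ks2 : 2 <= K%:R * s x.
    have h : 2 * r < K%:R * d by rewrite -ltr_pdivrMr.
    rewrite /s mulrCA mulrC ler_pdivlMr //; apply/ltW/(lt_le_trans h).
    by rewrite ler_wpM2l // ltW.
  apply: le_trans hm.
  have B := @bernoulli (s x ^+ m) (K ^ m)%N sm0.
  set a := (1 - s x ^+ m) ^+ (K ^ m)%N.
  have a0 : 0 <= a by rewrite exprn_ge0.
  (* Since (1 - s^m)(1 + s^m) <= 1, an upper bound for a follows from a lower bound for the power of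
     1 + s^m, to which Bernoulli's inequality applies. *)
  have prod1 : a * (1 + s x ^+ m) ^+ (K ^ m)%N <= 1.
    rewrite -exprMn exprn_ile1 //; first by rewrite mulr_ge0 // addr_ge0.
    have -> : (1 - s x ^+ m) * (1 + s x ^+ m) = 1 - s x ^+ m * s x ^+ m by ring.
    by rewrite lerBlDr lerDl mulr_ge0.
  have p2 : 2 ^+ m <= (1 + s x ^+ m) ^+ (K ^ m)%N.
    apply: (le_trans _ B); rewrite KE; apply: (@le_trans _ _ ((K%:R * s x) ^+ m)).
      by rewrite lerXn2r ?nnegrE.
    by rewrite lerDr.
  have t0 : (0 : R) < 2 ^+ m by rewrite exprn_gt0.
  rewrite exprVn -[X in _ <= X]mul1r ler_pdivlMr //.
  by apply: le_trans prod1; rewrite ler_wpM2l.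
Qed.

(** Each x has a time t that is good in a whole neighbourhood. A selection is improved there by
    mixing it with the constant t, weighted by a peak polynomial; convexity in t controls the value
    at the mixed time. *)
Lemma polyn_selection (S : set E) (w : R -> E -> R) (phi : E -> R) :
  compact S ->
  (forall x, S x -> {for x, continuous phi}) ->
  (forall t x, 0 < t < 1 -> S x -> usc_at (w t) x) ->
  (forall x s t l, S x -> 0 < s < 1 -> 0 < t < 1 -> 0 <= l <= 1 ->
    w (l * s + (1 - l) * t) x <= l * w s x + (1 - l) * w t x) ->
  (forall x, S x -> exists2 t, 0 < t < 1 & w t x < phi x) ->
  exists tau a b, [/\ polyn tau, 0 < a, b < 1, forall x, S x -> a <= tau x <= b &
    forall x, S x -> w (tau x) x < phi x].
Proof.
move=> cS cphi uw cw ex.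
have [S0|S0] := pselect (S !=set0); last first.
  exists (fun=> 1/2), (1/2), (1/2); split; try lra; first exact: polyn_cst.
    by move=> x Sx; exfalso; apply: S0; exists x.
  by move=> x Sx; exfalso; apply: S0; exists x.
pose G tau x := w (tau x) x - phi x.
have uG t x : 0 < t < 1 -> S x -> forall a, w t x - phi x < a -> \forall y \near x, w t y - phi y < a.
  move=> t01 Sx a lt; pose e := (a - (w t x - phi x)) / 2.
  have e0 : 0 < e by rewrite divr_gt0 // subr_gt0.
  have h1 := uw t x t01 Sx (w t x + e) (ltr_pwDr e0 (lexx _)).
  have := cphi x Sx; move/cvgr_gt => /(_ (phi x - e)).
  rewrite ltrBlDr ltrDl => /(_ e0) h2.
  by apply: filterS2 h1 h2 => y; rewrite /e; lra.
have bd t : 0 < t < 1 -> exists M, forall x, S x -> w t x - phi x <= M.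
  move=> t01; have [z Sz zmax] : exists2 z, S z & forall x, S x -> w t x - phi x <= w t z - phi z.
    apply: usc_max => // x Sx a lt.
    by have := uG t x t01 Sx a lt; apply: filterS.
  by exists (w t z - phi z).
(* Any polynomial [tau0] can be changed to have gap at least eta on A up to e, while values
   elsewhere rise by at most e above any level L >= -eta. Hence improvements on several sets can be
   made in succession, with e split in two. *)
pose Q (A : set E) := exists a b M eta, [/\ 0 < a, b < 1, 0 < eta &
  forall e tau0 a0 b0 M0, 0 < e -> polyn tau0 -> 0 < a0 <= a -> b <= b0 < 1 -> M <= M0 ->
   (forall x, S x -> a0 <= tau0 x <= b0) -> (forall x, S x -> G tau0 x <= M0) ->
   exists tau, polyn tau /\ forall x, S x ->
    [/\ a0 <= tau x <= b0, G tau x <= M0,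
        forall L, - eta <= L -> G tau0 x <= L -> G tau x <= L + e &
        A x -> G tau x <= - eta + e]].
have : Q S.
  apply: (compact_ind cS).
  - exists (1/2), (1/2), 0, 1; split; try lra.
    move=> e tau0 a0 b0 M0 e0 p0 a00 b01 hM h1 h2; exists tau0; split=> // x Sx; split=> //.
    + exact: h1.
    + exact: h2.
    + by move=> L _ hL; apply: (le_trans hL); rewrite lerDl ltW.
  - move=> A B AB [a [b [M [eta [a0 b1 eta0 h]]]]]; exists a, b, M, eta; split=> //.
    move=> e tau0 a0' b0 M0 e0 p0 a00 b01 hM h1 h2.
    have [tau [pt ht]] := h e tau0 a0' b0 M0 e0 p0 a00 b01 hM h1 h2.
    by exists tau; split=> // x Sx; have [k1 k2 k3 k4] := ht x Sx; split=> // /AB.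
  - move=> A B [a [b [M [eta [a0 b1 eta0 hA]]]]] [a' [b' [M' [eta' [a0' b1' eta0' hB]]]]].
    exists (Num.min a a'), (Num.max b b'), (Num.max M M'), (Num.min eta eta'); split.
    + by rewrite lt_min a0.
    + by rewrite gt_max b1.
    + by rewrite lt_min eta0.
    move=> e tau0 c d M0 e0 p0.
    rewrite le_min ge_max ge_max => /and3P[c0 ca ca'] /andP[/andP[bd' bd''] d1] /andP[hM hM'] h1 h2.
    have e2 : 0 < e / 2 by rewrite divr_gt0.
    have c1 : 0 < c <= a by rewrite c0.
    have c2 : 0 < c <= a' by rewrite c0.
    have d2 : b <= d < 1 by rewrite bd'.
    have d3 : b' <= d < 1 by rewrite bd''.
    have [tau [pt ht]] := hA _ tau0 c d M0 e2 p0 c1 d2 hM h1 h2.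
    have t1 x : S x -> c <= tau x <= d by move=> Sx; have [] := ht x Sx.
    have t2 x : S x -> G tau x <= M0 by move=> Sx; have [] := ht x Sx.
    have [tau' [pt' ht']] := hB _ tau c d M0 e2 pt c2 d3 hM' t1 t2.
    exists tau'; split=> // x Sx.
    have [k1 k2 k3 k4] := ht x Sx; have [l1 l2 l3 l4] := ht' x Sx.
    have m1 : Num.min eta eta' <= eta by rewrite ge_min lexx.
    have m2 : Num.min eta eta' <= eta' by rewrite ge_min lexx orbT.
    split=> //.
    + move=> L L1 L2; have h3 : G tau x <= L + e / 2 by apply: k3 => //; lra.
      have h4 : G tau' x <= L + e / 2 + e / 2 by apply: l3 => //; lra.
      by lra.
    + move=> [Ax|Bx]; last by have := l4 Bx; lra.
      have h4 : G tau' x <= (- Num.min eta eta' + e / 2) + e / 2.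
        by apply: l3; [lra | have := k4 Ax; lra].
      by lra.
  move=> y Sy; have [t t01 lt] := ex y Sy.
  have [M hM] := bd t t01.
  pose eta := (phi y - w t y) / 2.
  have eta0 : 0 < eta by rewrite divr_gt0 // subr_gt0.
  have yU : nbhs y [set x | w t x - phi x < - eta] by apply: uG => //; rewrite /eta; lra.
  have [U' yU' [U'U hp]] := peak cS Sy yU.
  exists U' => //; exists t, t, M, eta; case/andP: (t01) => t0 t1; split=> //.
  move=> e tau0 a0 b0 M0 e0 p0 /andP[a00 a0t] /andP[tb b01] MM0 h1 h2.
  (* k bounds both M + eta and M0 + eta, so a peak of accuracy e / k makes either error at most
     e. *)
  pose k : R := `|M0| + eta + 1.
  have k0 : 0 < k by rewrite ltr_wpDl // addr_ge0 // ltW.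
  have ek0 : 0 < e / k by rewrite divr_gt0.
  have [p pp hpx] := hp _ ek0.
  have ekE : e / k * k = e by rewrite divfK // gt_eqF.
  have M0k : M0 + eta <= k by rewrite /k; have := ler_norm M0; lra.
  exists (fun x => p x * t + (1 - p x) * tau0 x); split.
    apply: polyn_add; first exact: (polyn_mul pp (polyn_cst x0 t)).
    exact: (polyn_mul (polyn_sub (polyn_cst x0 1) pp) p0).
  move=> x Sx; have [/andP[q0 q1] hU' hU] := hpx x Sx.
  have /andP[u0 u1] := h1 x Sx; have G0 := h2 x Sx; have Gt := hM x Sx.
  have q1' : 0 <= 1 - p x by rewrite subr_ge0.
  have Gle : G (fun x => p x * t + (1 - p x) * tau0 x) x <=
      p x * (w t x - phi x) + (1 - p x) * G tau0 x.
    have t0' : 0 < tau0 x < 1 by rewrite (lt_le_trans a00) // (le_lt_trans u1).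
    have q01 : 0 <= p x <= 1 by rewrite q0.
    by have := cw x t (tau0 x) (p x) Sx t01 t0' q01; rewrite /G; lra.
  have key : p x <= e / k -> p x * (M + eta) <= e.
    move=> pe; rewrite -ekE; apply: (@le_trans _ _ (p x * k)); last by rewrite ler_wpM2r // ltW.
    by rewrite ler_wpM2l //; lra.
  split.
  - apply/andP; split; nra.
  - apply: (le_trans Gle); nra.
  - move=> L hL hG; apply: (le_trans Gle).
    have g1 : (1 - p x) * G tau0 x <= (1 - p x) * L by rewrite ler_wpM2l.
    (* Where t is good, mixing cannot exceed L; where it is not, its weight is at most e / k. *)
    have [Ux|nU] := pselect (w t x - phi x < - eta).
      have : p x * (w t x - phi x) <= p x * L by rewrite ler_wpM2l //; lra.
      by move: g1; lra.
    have := key (hU nU); have : p x * (w t x - phi x) <= p x * M by rewrite ler_wpM2l.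
    have : p x * (- eta) <= p x * L by rewrite ler_wpM2l.
    by move: g1; lra.
  - move=> U'x; apply: (le_trans Gle); have Ux := U'U _ U'x; rewrite /= in Ux.
    have h3 : p x * (w t x - phi x) <= p x * (- eta) by rewrite ler_wpM2l // ltW.
    have h4 : (1 - p x) * (G tau0 x + eta) <= e.
      apply: (@le_trans _ _ ((1 - p x) * k)); first by rewrite ler_wpM2l //; lra.
      by rewrite -ekE ler_wpM2r ?(ltW k0) //; have := hU' U'x; lra.
    by move: h3 h4; lra.
move=> [a [b [M [eta [a0 b1 eta0 h]]]]].
have h01 : 0 < (1 / 2 : R) < 1 by lra.
have [M0 hM0] := bd _ h01.
have [|||||||tau [pt ht]] := h (eta / 2) (fun=> 1 / 2) (Num.min a (1 / 2)) (Num.max b (1 / 2)) (Num.max M M0).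
- by rewrite divr_gt0.
- exact: polyn_cst.
- by rewrite lt_min ge_min a0 lexx; lra.
- by rewrite le_max gt_max b1 lexx; lra.
- by rewrite le_max lexx.
- by move=> x Sx; rewrite ge_min le_max !lexx !orbT.
- by move=> x Sx; rewrite le_max hM0 ?orbT.
exists tau, (Num.min a (1 / 2)), (Num.max b (1 / 2)); split=> //.
- by rewrite lt_min a0; lra.
- by rewrite gt_max b1; lra.
- by move=> x Sx; have [] := ht x Sx.
- move=> x Sx; have [_ _ _ /(_ Sx)] := ht x Sx; rewrite /G; lra.
Qed.

End Selection.

(** * Touching from above *)

Section Touching.
Context {R : realType} {k : nat}.
Local Notation E := 'rV[R]_k.

(** By [penalization], for large C the function u - psi - C g is smaller on K minus I than at p0, so
    its maximum over K lies in the open set I and the local test applies. *)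
Lemma touch (Omega K I : set E) (F : set 'M[R]_k) (u psi g : E -> R) p0 :
  open Omega -> subsolutions F Omega u -> compact K -> K `<=` Omega -> open I -> I `<=` K ->
  isC2 Omega psi -> isC2 Omega g -> (forall p, K p -> 0 <= g p) ->
  K p0 -> g p0 = 0 ->
  (forall p, K p -> ~ I p -> g p = 0 -> u p - psi p < u p0 - psi p0) ->
  exists C, 0 < C /\ exists2 p, I p & F (hessian (fun p => psi p + C * g p) p).
Proof.
move=> oO su cK KO oI IK cpsi cg g0 Kp0 gp0 hbad.
have contC f : isC2 Omega f -> forall p, Omega p -> {for p, continuous f}.
  by rewrite isC2E => h p /h[].
have usc p : K p -> forall a, u p - psi p < a -> \forall y \near p, Omega y -> u y - psi y < a.
  move=> Kp a lt; pose e := (a - (u p - psi p)) / 2.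
  have e0 : 0 < e by rewrite divr_gt0 // subr_gt0.
  have h1 := su.1 p (KO _ Kp) (u p + e) (ltr_pwDr e0 (lexx _)).
  have := contC _ cpsi p (KO _ Kp); move/cvgr_gt => /(_ (psi p - e)).
  rewrite ltrBlDr ltrDl => /(_ e0) h2.
  by apply: filterS2 h1 h2 => y hu hp Oy; have := hu Oy; rewrite /e in hp *; lra.
have cB : compact (K `&` ~` I) by apply: compact_closedI => //; exact: open_closedC.
have [C C0 hC] : exists2 C, 0 < C & forall p, (K `&` ~` I) p -> (u p - psi p) - C * g p < u p0 - psi p0.
  apply: penalization => //.
  - move=> p [Kp _] a lt; have := usc p Kp a lt.
    by apply: filterS => y h [Ky _]; apply: h; exact: KO.
  - by move=> p [Kp _]; apply: contC cg _ _; exact: KO.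
  - by move=> p [Kp _]; exact: g0.
  - by move=> p [Kp nI]; exact: hbad.
have [p Kp pmax] : exists2 p, K p & forall y, K y -> (u y - psi y) - C * g y <= (u p - psi p) - C * g p.
  apply: usc_max => //; first by exists p0.
  move=> p Kp a lt; pose e := (a - (u p - psi p - C * g p)) / 2.
  have e0 : 0 < e by rewrite divr_gt0 // subr_gt0.
  have h1 := usc p Kp (u p - psi p + e) (ltr_pwDr e0 (lexx _)).
  have cCg := contC _ (C2M oO (C2_cst Omega C) cg) p (KO _ Kp).
  move/cvgr_gt : cCg => /(_ (C * g p - e)).
  rewrite ltrBlDr ltrDl => /(_ e0) h2.
  apply: filterS2 h1 h2 => y hu hp Ky; have := hu (KO _ Ky); rewrite /= in hp.
  by rewrite /e in hp *; lra.
have Ip : I p.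
  apply: contrapT => nI; have := hC p (conj Kp nI); have := pmax p0 Kp0.
  by rewrite gp0 mulr0 subr0 => h1 h2; have := le_lt_trans h1 h2; rewrite ltxx.
exists C; split=> //; exists p => //.
have c2 : isC2 Omega (fun p => psi p + C * g p).
  exact: (C2D oO cpsi (C2M oO (C2_cst Omega C) cg)).
apply: (subsolution_local oO su c2 (KO _ Kp)).
have := open_nbhs_nbhs (conj oI Ip); apply: filterS => y Iy.
by have := pmax y (IK _ Iy); lra.
Qed.

End Touching.

(** * Functions of the space variable on the cylinder *)

Section Cylinder.
Context {R : realType} {n : nat}.
Local Notation E := 'rV[R]_n.
Local Notation E1 := 'rV[R]_(1 + n).
Implicit Types (D : set E) (f : E -> R) (p : E1).

Lemma ord0_lshift : 0 = lshift n 0 :> 'I_(1 + n).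
Proof. exact: val_inj. Qed.

Lemma spacetime_time t (x : E) : spacetime t x 0 0 = t.
Proof. by rewrite /spacetime ord0_lshift row_mxEl mxE eqxx mulr1n. Qed.

Lemma spacetime_space t (x : E) : rsubmx (spacetime t x) = x.
Proof. exact: row_mxKr. Qed.

Lemma spacetimeE p : p = spacetime (p 0 0) (rsubmx p).
Proof.
rewrite /spacetime -[LHS]hsubmxK; congr row_mx.
by rewrite [LHS]mx11_scalar mxE ord0_lshift; congr ((p _ _)%:M); exact: val_inj.
Qed.

Lemma cylinderE D p : cylinder D p <-> 0 < p 0 0 < 1 /\ D (rsubmx p).
Proof.
split=> [[t [x [t01 Dx ->]]]|[t01 Dx]].
  by rewrite spacetime_time spacetime_space.
by exists (p 0 0), (rsubmx p); split=> //; exact: spacetimeE.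
Qed.

Lemma space_continuous : continuous (fun p : E1 => rsubmx p : E).
Proof. by move=> p; apply/differentiable_continuous/differentiable_rsubmx. Qed.

Lemma time_continuous : continuous (fun p : E1 => p 0 0).
Proof. exact: coord_continuous. Qed.

Lemma spacetime_continuous t : continuous (fun x : E => spacetime t x : E1).
Proof.
move=> x U /nbhs_ballP[e /= e0 eU]; apply/nbhs_ballP; exists e => // y [_ xy].
apply: eU; split=> // i j; rewrite ord1.
case: (split_ordP j) => l ->; first by rewrite !row_mxEl; exact: ballxx.
by rewrite !row_mxEr; exact: xy.
Qed.

Lemma cylinder_open D : open D -> open (cylinder D).
Proof.
move=> oD.
have -> : cylinder D = (fun p : E1 => p 0 0) @^-1` [set t | 0 < t] `&`
    ((fun p : E1 => p 0 0) @^-1` [set t | t < 1] `&` (fun p : E1 => rsubmx p : E) @^-1` D).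
  apply/seteqP; split => p /=; first by move/cylinderE => [/andP[h1 h2] Dp].
  by move=> [h1 [h2 Dp]]; apply/cylinderE; rewrite h1.
have ct (A : set R) : open A -> open ((fun p : E1 => p 0 0) @^-1` A).
  by move=> oA; apply: open_comp => // p _; exact: time_continuous.
apply: openI; first by apply: ct; exact: open_gt.
apply: openI; first by apply: ct; exact: open_lt.
by apply: open_comp => // p _; exact: space_continuous.
Qed.

Lemma pull_lineE f p v h : f (rsubmx (h *: v + p)) = f (h *: rsubmx v + rsubmx p).
Proof. by congr f; apply/rowP => i; rewrite !mxE. Qed.

Lemma rsubmx_delta i : rsubmx (delta_mx 0 (rshift 1 i) : E1) = delta_mx 0 i :> E.
Proof. by apply/rowP => j; rewrite !mxE (inj_eq (@rshift_inj _ _)). Qed.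

Lemma rsubmx_delta0 : rsubmx (delta_mx 0 (lshift n 0) : E1) = 0 :> E.
Proof. by apply/rowP => j; rewrite !mxE eq_rlshift andbF. Qed.

Lemma derive_pull f p v : 'D_v (fun q : E1 => f (rsubmx q)) p = 'D_(rsubmx v) f (rsubmx p).
Proof.
rewrite /derive; set g1 := fun t => t^-1 *: _; set g2 := fun t => t^-1 *: _.
suff -> : g1 = g2 by [].
by apply/funext => t; rewrite /g1 /g2 /= pull_lineE.
Qed.

Lemma derivable_pull f p v :
  derivable f (rsubmx p) (rsubmx v) -> derivable (fun q : E1 => f (rsubmx q)) p v.
Proof.
rewrite /derivable; set g1 := fun t => t^-1 *: _; set g2 := fun t => t^-1 *: _.
suff -> : g1 = g2 by [].
by apply/funext => t; rewrite /g1 /g2 /= pull_lineE.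
Qed.

Lemma pd_pullr f i : pd (rshift 1 i) (fun q : E1 => f (rsubmx q)) = fun q => pd i f (rsubmx q).
Proof.
apply/funext => p; rewrite !pdE; apply: etrans (derive_pull _ _ _) _.
by rewrite rsubmx_delta.
Qed.

Lemma pd_pulll f : pd (lshift n 0) (fun q : E1 => f (rsubmx q)) = fun=> 0.
Proof.
apply/funext => p; rewrite !pdE; apply: etrans (derive_pull _ _ _) _.
by rewrite rsubmx_delta0 derive0.
Qed.

Lemma C1_pull D f : C1 D f -> C1 (cylinder D) (fun q => f (rsubmx q)).
Proof.
move=> [cf df].
have c0 g : C0 D g -> C0 (cylinder D) (fun q => g (rsubmx q)).
  move=> cg p /cylinderE[_ Dp].
  by apply: (continuous_comp (@space_continuous p)); exact: cg.
split; first exact: c0.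
move=> j; case: (split_ordP j) => i ->.
  rewrite ord1 pd_pulll; split; last exact: (C1_cst _ 0).1.
  by move=> p _; apply: derivable_pull; rewrite rsubmx_delta0; exact: derivable0.
rewrite pd_pullr; split; last exact: c0 (df i).2.
by move=> p /cylinderE[_ Dp]; apply: derivable_pull; rewrite rsubmx_delta; exact: (df i).1.
Qed.

Lemma C2_pull D f : isC2 D f -> isC2 (cylinder D) (fun q => f (rsubmx q)).
Proof.
move=> /C2P[c1 c2]; apply/C2P; split; first exact: C1_pull.
move=> j; case: (split_ordP j) => i ->; last by rewrite pd_pullr; exact: C1_pull.
by rewrite ord1 pd_pulll; exact: C1_cst.
Qed.

Lemma hess_pull f p i j :
  hess (fun q => f (rsubmx q)) p (rshift 1 i) (rshift 1 j) = hess f (rsubmx p) i j.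
Proof. by rewrite !hessE !pd_pullr. Qed.

Lemma hess_pull0l f p j : hess (fun q => f (rsubmx q)) p (lshift n 0) j = 0.
Proof.
rewrite hessE; case: (split_ordP j) => i ->; last by rewrite pd_pullr pd_pulll.
by rewrite ord1 pd_pulll pd_cst.
Qed.

Lemma hess_pull0r f p j : hess (fun q => f (rsubmx q)) p j (lshift n 0) = 0.
Proof. by rewrite hessE pd_pulll pd_cst. Qed.

End Cylinder.

(** * Convexity in time *)

Section TimeConvexity.
Context {R : realType} {n : nat}.
Local Notation E := 'rV[R]_n.
Local Notation E1 := 'rV[R]_(1 + n).
Implicit Types (D : set E) (f : E -> R) (p : E1) (x : E).

Lemma spacetime_continuous2 : continuous (fun q : R * E => spacetime q.1 q.2 : E1).
Proof.
move=> [t x] U /nbhs_ballP[e /= e0 eU]; apply/nbhs_ballP; exists e => //.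
move=> [s y] [/= ts [_ xy]]; apply: eU; split=> // i j; rewrite ord1.
case: (split_ordP j) => l ->; last by rewrite !row_mxEr; exact: xy.
by rewrite !row_mxEl !ord1 !mxE eqxx !mulr1n.
Qed.

Lemma compact_box (a b : R) (A : set E) : compact A ->
  compact [set p : E1 | a <= p 0 0 <= b /\ A (rsubmx p)].
Proof.
move=> cA.
have -> : [set p : E1 | a <= p 0 0 <= b /\ A (rsubmx p)] =
    (fun q : R * E => spacetime q.1 q.2 : E1) @` ([set t | t \in `[a, b]] `*` A).
  apply/seteqP; split=> [p [h1 h2]|_ [[t x] [/= h1 h2] <-]].
    by exists (p 0 0, rsubmx p); [split=> //=; rewrite in_itv | rewrite /= -spacetimeE].
  by rewrite spacetime_time spacetime_space; split=> //; move: h1; rewrite in_itv.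
apply: continuous_compact; last by apply: compact_setX => //; exact: segment_compact.
by apply: continuous_subspaceT => q; exact: spacetime_continuous2.
Qed.

Lemma open_box (a b : R) (A : set E) : open A ->
  open [set p : E1 | a < p 0 0 < b /\ A (rsubmx p)].
Proof.
move=> oA.
have -> : [set p : E1 | a < p 0 0 < b /\ A (rsubmx p)] =
    (fun p : E1 => p 0 0) @^-1` [set t | a < t] `&`
    ((fun p : E1 => p 0 0) @^-1` [set t | t < b] `&` (fun p : E1 => rsubmx p : E) @^-1` A).
  apply/seteqP; split => p /=; first by move=> [/andP[h1 h2] Dp].
  by move=> [-> [-> Dp]].
have ct (B : set R) : open B -> open ((fun p : E1 => p 0 0) @^-1` B).
  by move=> oB; apply: open_comp => // p _; exact: time_continuous.
apply: openI; first by apply: ct; exact: open_gt.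
apply: openI; first by apply: ct; exact: open_lt.
by apply: open_comp => // p _; exact: space_continuous.
Qed.

Lemma ell_eq0 (x0 : E) (V : 'M[R]_n) x : V \in unitmx -> ell x0 V x = 0 -> x = x0.
Proof.
move=> Vu /eqP; rewrite psumr_eq0 => [|i _]; last exact: sqr_ge0.
move/allP => h; apply/eqP; rewrite -subr_eq0 -[x - x0](mulmxKV Vu).
rewrite (_ : _ *m invmx V = 0) ?mul0mx //; apply/rowP => i; rewrite [RHS]mxE.
by have := h i (mem_index_enum _); rewrite sqrf_eq0 => /eqP.
Qed.

(** Shrinking is done by scaling V, which only multiplies [lap] by r^2. *)
Lemma small_ellipsoid (x0 : E) (V : 'M[R]_n) (U : set E) : V \in unitmx -> nbhs x0 U ->
  exists2 r : R, 0 < r & forall x, ell x0 (r *: V) x <= 1 -> U x.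
Proof.
move=> Vu /nbhs_ballP[e /= e0 eU].
pose K : R := 1 + \sum_i \sum_j `|V i j|.
have S0 : 0 <= \sum_i \sum_j `|V i j| by apply: sumr_ge0 => i _; exact: sumr_ge0.
have K0 : 0 < K by rewrite ltr_pwDl.
have [r [r0 rK]] : exists r : R, 0 < r /\ r * K = e / 2.
  exists (e / (2 * K)); split; first by rewrite divr_gt0 // mulr_gt0.
  by field; rewrite gt_eqF.
exists r => // x hx; apply: eU; split=> // i j; rewrite ord1 -ball_normE /= distrC.
have rVu : r *: V \in unitmx by rewrite unitmxZ // unitfE gt_eqF.
set z := (x - x0) *m invmx (r *: V).
have zE : x - x0 = z *m (r *: V) by rewrite /z mulmxKV.
have z1 l : `|z 0 l| <= 1.
  have : (z 0 l) ^+ 2 <= 1.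
    apply: le_trans hx; rewrite /ell (bigD1 l) //= lerDl sumr_ge0 // => m _.
    exact: sqr_ge0.
  by move=> h; rewrite ler_norml; apply/andP; split; nra.
have -> : x 0 j - x0 0 j = (z *m (r *: V)) 0 j by rewrite -zE !mxE.
rewrite mxE; apply: (le_lt_trans (ler_norm_sum _ _ _)).
apply: (@le_lt_trans _ _ (r * \sum_i \sum_j `|V i j|)); last first.
  have : r * \sum_i \sum_j `|V i j| <= r * K by rewrite ler_wpM2l ?(ltW r0) // lerDr ler01.
  by move: e0; rewrite rK; lra.
rewrite mulr_sumr; apply: ler_sum => l _.
rewrite [(r *: V) l j]mxE !normrM (gtr0_norm r0) mulrCA.
rewrite ler_wpM2l ?(ltW r0) //; apply: (@le_trans _ _ `|V l j|).
  by rewrite -[X in _ <= X]mul1r ler_wpM2r.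
by rewrite (bigD1 j) //= lerDl sumr_ge0.
Qed.

Lemma open_ell (x0 : E) (V : 'M[R]_n) : open [set x | ell x0 V x < 1].
Proof.
rewrite -[X in open X]/(ell x0 V @^-1` [set t | t < 1]).
by apply: open_comp; [move=> x _; exact: ell_continuous | exact: open_lt].
Qed.

(** If u exceeded the chord at tm, the chord plus a concave parabola vanishing at t1 and t2,
    penalized by [ell] to stay near the line x = x1, would touch u from above with a negative
    time-time entry. *)
Lemma time_convex D (c : R) (u : E1 -> R) x1 t1 t2 tm (A B : R) :
  (1 <= n)%N -> open D -> (n%:R - 1) / 2 * pi <= c ->
  subsolutions (calF c) (cylinder D) u -> D x1 ->
  0 < t1 -> t1 < tm -> tm < t2 -> t2 < 1 ->
  u (spacetime t1 x1) <= A + B * t1 -> u (spacetime t2 x1) <= A + B * t2 ->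
  u (spacetime tm x1) <= A + B * tm.
Proof.
move=> n1 oD hc su Dx t10 t1m tm2 t21 u1 u2; rewrite leNgt; apply/negP => lt.
have V1u : (1%:M : 'M[R]_n) \in unitmx by exact: unitmx1.
have [r r0 rD] := small_ellipsoid V1u (open_nbhs_nbhs (conj oD Dx)).
set V := r *: 1%:M in rD.
have Vu : V \in unitmx by rewrite unitmxZ // unitfE gt_eqF.
set gap := u (spacetime tm x1) - (A + B * tm).
have gap0 : 0 < gap by rewrite subr_gt0.
(* Normalized so that the parabola equals half of the gap at tm. *)
pose q : R := 2 * ((tm - t1) * (t2 - tm)).
have q0 : 0 < q by rewrite /q !mulr_gt0 // subr_gt0.
pose ka := gap / q.
have ka0 : 0 < ka by rewrite divr_gt0.
pose psi p : R := (A - ka * t1 * t2) + ((B + ka * (t1 + t2)) * p 0 0 + (- ka) * (p 0 0 * p 0 0)).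
have psiE p : psi p = A + B * p 0 0 + ka * ((p 0 0 - t1) * (t2 - p 0 0)) by rewrite /psi; ring.
have cT : isC2 setT (fun p : E1 => p 0 0) by exact: C2_coord.
have cTT := C2M openT cT cT.
have c1 := C2M openT (C2_cst setT (B + ka * (t1 + t2))) cT.
have c2 := C2M openT (C2_cst setT (- ka)) cTT.
have c12 := C2D openT c1 c2.
have c3 := C2D openT (C2_cst setT (A - ka * t1 * t2)) c12.
have hpsi p : hess psi p 0 0 = - (2 * ka).
  apply: etrans (hessD 0 0 openT (C2_cst setT (A - ka * t1 * t2)) c12 (I : setT p)) _.
  rewrite hess_cst add0r.
  apply: etrans (hessD 0 0 openT c1 c2 (I : setT p)) _.
  rewrite (hessM 0 0 openT (C2_cst setT _) cT (I : setT p)).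
  rewrite (hessM 0 0 openT (C2_cst setT _) cTT (I : setT p)).
  rewrite (hessM 0 0 openT cT cT (I : setT p)) !hess_cst !hess_coord !pd_cst !pd_coord eqxx /=.
  by ring.
pose g p := ell x1 V (rsubmx p).
have oO := cylinder_open oD.
have cpsi : isC2 (cylinder D) psi by exact: C2_subset (@subsetT _ _) c3.
have cell : isC2 D (ell x1 V) by exact: C2_subset (@subsetT _ _) (hpoly_C2 (hpoly_ell x1 V)).
have cg : isC2 (cylinder D) g by exact: C2_pull cell.
pose K := [set p : E1 | t1 <= p 0 0 <= t2 /\ (ell x1 V @^-1` [set t | t <= 1]) (rsubmx p)].
pose In := [set p : E1 | t1 < p 0 0 < t2 /\ [set x | ell x1 V x < 1] (rsubmx p)].
have cK : compact K by apply: compact_box; apply: ell_compact => //; exact: closed_le.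
have KO : K `<=` cylinder D.
  move=> p [/andP[h1 h2] h3]; apply/cylinderE; split; last exact: rD.
  by rewrite (lt_le_trans t10 h1) (le_lt_trans h2 t21).
have oI : open In by apply: open_box; exact: open_ell.
have IK : In `<=` K by move=> p [/andP[h1 h2] h3]; split; [rewrite !ltW | exact: ltW].
have g0 p : K p -> 0 <= g p by move=> _; exact: ell_ge0.
have [|||C [C0 [p Ip]]] := touch (p0 := spacetime tm x1) oO su cK KO oI IK cpsi cg g0.
- by split; rewrite ?spacetime_time ?spacetime_space /= ?ell_center ?ler01 // !ltW.
- by rewrite /g spacetime_space ell_center.
- move=> p [/andP[h1 h2] h3] nI gp; have px := ell_eq0 Vu gp.
  have -> : u (spacetime tm x1) - psi (spacetime tm x1) = gap / 2.
    rewrite psiE spacetime_time /ka /q.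
    have -> : gap / (2 * ((tm - t1) * (t2 - tm))) * ((tm - t1) * (t2 - tm)) = gap / 2.
      by field; rewrite !subr_eq0 !gt_eqF.
    by rewrite /gap; lra.
  have pE := spacetimeE p; rewrite px in pE.
  have pt : p 0 0 = t1 \/ p 0 0 = t2.
    have [e1|n1'] := eqVneq (p 0 0) t1; first by left.
    have [e2|n2'] := eqVneq (p 0 0) t2; first by right.
    exfalso; apply: nI; split; last by rewrite /= px ell_center.
    by rewrite !lt_neqAle h1 h2 n2' eq_sym n1'.
  rewrite psiE pE spacetime_time.
  by case: pt => ->; rewrite subrr ?mul0r ?mulr0; lra.
move=> calFp; have := calF_time_ge0 n1 hc calFp.
rewrite hessian_hess mxE leNgt => /negP; apply.
have -> : hess (fun p => psi p + C * g p) p 0 0 = hess psi p 0 0 + C * hess g p 0 0.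
  have Op := KO _ (IK _ Ip).
  apply: etrans (hessD 0 0 oO cpsi (C2M oO (C2_cst _ C) cg) Op) _.
  by rewrite (hessM 0 0 oO (C2_cst _ C) cg Op) hess_cst !pd_cst /=; ring.
rewrite hpsi ord0_lshift hess_pull0l mulr0 addr0 oppr_lt0.
by rewrite mulr_gt0.
Qed.

Lemma time_convex_combination D (c : R) (u : E1 -> R) x1 s t l :
  (1 <= n)%N -> open D -> (n%:R - 1) / 2 * pi <= c ->
  subsolutions (calF c) (cylinder D) u -> D x1 ->
  0 < s < 1 -> 0 < t < 1 -> 0 <= l <= 1 ->
  u (spacetime (l * s + (1 - l) * t) x1) <= l * u (spacetime s x1) + (1 - l) * u (spacetime t x1).
Proof.
move=> n1 oD hc su Dx.
wlog: s t l / s < t => [H|st] hs ht hl.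
  have [st|ts|->] := ltgtP s t; first exact: H.
    have hl' : 0 <= 1 - l <= 1 by lra.
    have := H t s (1 - l) ts ht hs hl'.
    have -> : (1 - (1 - l)) = l by ring.
    by rewrite [(1 - l) * t + _]addrC [(1 - l) * u _ + _]addrC.
  have -> : l * t + (1 - l) * t = t by ring.
  have -> // : l * u (spacetime t x1) + (1 - l) * u (spacetime t x1) = u (spacetime t x1) by ring.
case/andP: hl => l0 l1.
have [->|ln0] := eqVneq l 0; first by rewrite !mul0r !add0r subr0 !mul1r.
have [->|ln1] := eqVneq l 1; first by rewrite subrr !mul0r !addr0 !mul1r.
have lp : 0 < l by rewrite lt_neqAle eq_sym ln0.
have lq : l < 1 by rewrite lt_neqAle ln1.
pose us := u (spacetime s x1); pose ut := u (spacetime t x1).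
pose B := (ut - us) / (t - s); pose A := us - B * s.
have ts0 : t - s != 0 by rewrite subr_eq0 gt_eqF.
have tE : A + B * t = ut by rewrite /A /B; field.
have -> : l * us + (1 - l) * ut = A + B * (l * s + (1 - l) * t).
  by rewrite /A /B; field.
case/andP: hs => s0 s1; case/andP: ht => t0 t1.
apply: (time_convex (t1 := s) (t2 := t) n1 oD hc su Dx) => //; rewrite -?/us -?/ut ?tE //; try nra.
by rewrite /A subrK.
Qed.

(** The time 1 / 2 is a convex combination of t and of 1 / 4 or 3 / 4, with weight at least 1 / 3 on
    t. Convexity then bounds the value at t below. *)
Lemma time_has_lbound D (c : R) (u : E1 -> R) x1 :
  (1 <= n)%N -> open D -> (n%:R - 1) / 2 * pi <= c ->
  subsolutions (calF c) (cylinder D) u -> D x1 ->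
  has_lbound [set u (spacetime t x1) | t in [set t | 0 < t < 1]].
Proof.
move=> n1 oD hc su Dx.
pose w t := u (spacetime t x1).
pose M := `|w (1 / 2)| + `|w (3 / 4)| + `|w (1 / 4)|.
exists (- (3 * M)) => _ [t /= /andP[t0 t1] <-]; rewrite -/(w t).
have conv := @time_convex_combination D c u x1 _ _ _ n1 oD hc su Dx.
have n2 := ler_norm (- w (1 / 2)); have n3 := ler_norm (w (3 / 4)); have n4 := ler_norm (w (1 / 4)).
rewrite normrN in n2.
have p2 := normr_ge0 (w (1 / 2)); have p3 := normr_ge0 (w (3 / 4)); have p4 := normr_ge0 (w (1 / 4)).
have ht : 0 < t < 1 by rewrite t0.
suff [s [l [hs hl hE hw]]] : exists s l, [/\ 0 < s < 1, 1 / 3 <= l <= 1,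
    l * t + (1 - l) * s = 1 / 2 & w s <= M - `|w (1 / 2)|].
  have hl' : 0 <= l <= 1 by lra.
  have := conv t s l ht hs hl'; rewrite hE -/(w _) -/(w _) -/(w _) => h.
  case/andP: hl => l3 l1; rewrite leNgt; apply/negP => lt.
  have M0 : 0 <= M by rewrite !addr_ge0.
  have h1 : (1 - l) * w s <= M - `|w (1 / 2)|.
    have ml : (1 - l) * (M - `|w (1 / 2)|) <= M - `|w (1 / 2)|.
      have : 0 <= l * (M - `|w (1 / 2)|) by rewrite mulr_ge0 //; rewrite /M; lra.
      lra.
    by apply: le_trans ml; rewrite ler_wpM2l // subr_ge0.
  have h2 : l * w t < l * - (3 * M) by rewrite ltr_pM2l //; lra.
  have h3 : M <= l * (3 * M) by nra.
  lra.
have [t2|t2] := leP t (1 / 2).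
  have d0 : 0 < 3 / 4 - t by lra.
  exists (3 / 4), ((1 / 4) / (3 / 4 - t)); split.
  - lra.
  - by rewrite ler_pdivlMr // ler_pdivrMr //; apply/andP; split; lra.
  - by field; apply: lt0r_neq0; lra.
  - by rewrite /M; lra.
have d0 : 0 < t - 1 / 4 by lra.
exists (1 / 4), ((1 / 4) / (t - 1 / 4)); split.
- lra.
- by rewrite ler_pdivlMr // ler_pdivrMr //; apply/andP; split; lra.
- by field; apply: lt0r_neq0; lra.
- by rewrite /M; lra.
Qed.

End TimeConvexity.

(** * Touching along the graph of a harmonic polynomial *)

Section GraphHessian.
Context {R : realType} {n : nat}.
Local Notation E := 'rV[R]_n.

(** Symmetry is preserved by sums and products. It serves to isolate D^2 [phi] from the symmetric
    matrix obtained by touching. *)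
Lemma hess_polyn_sym (x0 : E) f : polyn x0 f -> forall x i j, hess f x i j = hess f x j i.
Proof.
pose ok (f1 : E -> R) := isC2 setT f1 /\ forall x i j, hess f1 x i j = hess f1 x j i.
have okD f1 g : ok f1 -> ok g -> ok (f1 \+ g).
  move=> [cf hf] [cg hg]; split; first exact: C2D openT cf cg.
  move=> x i j; rewrite (hessD i j openT cf cg (I : setT x)).
  by rewrite (hessD j i openT cf cg (I : setT x)) hf hg.
have okM f1 g : ok f1 -> ok g -> ok (f1 \* g).
  move=> [cf hf] [cg hg]; split; first exact: C2M openT cf cg.
  move=> x i j; rewrite (hessM i j openT cf cg (I : setT x)).
  by rewrite (hessM j i openT cf cg (I : setT x)) hf hg; ring.
have okc c : ok (fun=> c) by split=> [|x i j]; [exact: C2_cst | rewrite !hess_cst].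
move=> pf; suff [] : ok f by [].
elim: pf => {f} [m f hf|f1 f2 _ ok1 _ ok2]; last exact: (okD _ _ ok1 ok2).
elim: hf => {m f} [c|m|m f1 f2 _ ok1 _ ok2|m i f _ okf]; [exact: okc|exact: okc|exact: (okD _ _ ok1 ok2)|].
apply: (okM (fun x => x 0 i - x0 0 i) f _ okf); split; first exact: C2_center.
by move=> x j l; rewrite !hessE !pd_center !pd_cst.
Qed.

Lemma lap_ell (x0 : E) (V : 'M[R]_n) x : V \in unitmx -> lap V (ell x0 V) x = 2 * n%:R.
Proof.
move=> Vu; have := lap_ell_mul Vu x (hpoly_cst x0 1).
have -> : (fun y : E => ell x0 V y * 1) = ell x0 V by apply/funext => y; rewrite mulr1.
have -> : lap V (fun=> 1) x = 0.
  by apply: big1 => i _; apply: big1 => j _; rewrite hess_cst mulr0.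
by move=> ->; rewrite !mulr0 !addr0 mulr1.
Qed.

Lemma sum_row_form (V M : 'M[R]_n) :
  \sum_l (row l V *m M *m (row l V)^T) 0 0 = \sum_i \sum_j (V^T *m V) i j * M i j.
Proof.
transitivity (\sum_l \sum_j \sum_i V l i * V l j * M i j).
  apply: eq_bigr => l _; rewrite mxE; apply: eq_bigr => j _; rewrite mxE mulr_suml.
  by apply: eq_bigr => i _; rewrite !mxE; ring.
rewrite exchange_big /=; under eq_bigr => j _ do rewrite exchange_big /=.
rewrite exchange_big /=; apply: eq_bigr => i _; apply: eq_bigr => j _.
by rewrite -mulr_suml mxE; congr (_ * _); apply: eq_bigr => l _; rewrite !mxE.
Qed.

(* [w] is tangent to a graph [t = H x] with gradient [G], hence annihilates the
   rank-one part of the Hessian of [(t - H x)^2]. *)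
Lemma graph_form (M : 'M[R]_n) (G v : E) (k : R) :
  let w := row_mx (\sum_i v 0 i * G 0 i)%:M v in
  let g := row_mx 1%:M (- G) in
  (w *m (block_mx 0 0 0 M + k *: (g^T *m g)) *m w^T) 0 0 = (v *m M *m v^T) 0 0.
Proof.
move=> w g; have gw : g *m w^T = 0.
  rewrite /g /w tr_row_mx mul_row_col mul1mx tr_scalar_mx mulNmx.
  apply/eqP; rewrite subr_eq0; apply/eqP/matrixP => i j; rewrite !ord1 !mxE eqxx mulr1n.
  by apply: eq_bigr => l _; rewrite mxE mulrC.
rewrite mulmxDr mulmxDl -scalemxAr -scalemxAl mulmxA -[_ *m g *m _]mulmxA gw mulmx0 scaler0 addr0.
by rewrite /w mul_row_block !mulmx0 !addr0 !add0r tr_row_mx mul_row_col mul0mx add0r.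
Qed.

End GraphHessian.

Section InfimumTouching.
Context {R : realType} {n : nat}.
Local Notation E := 'rV[R]_n.
Local Notation E1 := 'rV[R]_(1 + n).

Lemma graph_hessian D (psi H : E -> R) (C : R) p : open D -> isC2 D psi -> isC2 D H ->
  cylinder D p ->
  let x := rsubmx p in let s := p 0 0 - H x in
  let g := row_mx 1%:M (- \row_j pd j H x) in
  hessian (fun q : E1 => psi (rsubmx q) + C * ((q 0 0 - H (rsubmx q)) * (q 0 0 - H (rsubmx q)))) p =
  block_mx 0 0 0 (\matrix_(i, j) (hess psi x i j - 2 * C * s * hess H x i j)) +
  (2 * C) *: (g^T *m g).
Proof.
move=> oD cpsi cH Op x s g; have oO := cylinder_open oD.
pose T (q : E1) : R := q 0 (0 : 'I_(1 + n)).
have cT : isC2 (cylinder D) T by exact: C2_coord.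
have cHp := C2_pull cH.
have cN := C2M oO (C2_cst (cylinder D) (-1)) cHp.
have ch := C2D oO cT cN.
pose h (q : E1) : R := q 0 0 - H (rsubmx q).
have hE : T \+ (fun=> -1) \* (fun q : E1 => H (rsubmx q)) = h.
  by apply/funext => q; rewrite /h /T /= mulN1r.
rewrite hE in ch.
have hessh i j : hess h p i j = - hess (fun q : E1 => H (rsubmx q)) p i j.
  rewrite -hE; apply: etrans (hessD i j oO cT cN Op) _; rewrite hess_coord add0r.
  apply: etrans (hessM i j oO (C2_cst (cylinder D) (-1)) cHp Op) _.
  by rewrite hess_cst !pd_cst /=; ring.
have pdh i : pd i h p = g 0 i.
  rewrite -hE; apply: etrans (pdD (C2_C1 cT) (C2_C1 cN) i Op) _; rewrite pd_coord.
  rewrite (pdM (C2_C1 (C2_cst (cylinder D) (-1))) (C2_C1 cHp) i Op) pd_cst mulr0 addr0 mulN1r.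
  case: (split_ordP i) => j ->.
    by rewrite !ord1 pd_pulll row_mxEl mxE ord0_lshift !eq_refl subr0.
  by rewrite pd_pullr row_mxEr !mxE ord0_lshift eq_lrshift add0r.
have cg := C2M oO ch ch.
have cCg := C2M oO (C2_cst (cylinder D) C) cg.
have cpp := C2_pull cpsi.
have gE i j : hess (fun q : E1 => psi (rsubmx q) + C * (h q * h q)) p i j =
    hess (fun q : E1 => psi (rsubmx q)) p i j +
    2 * C * (s * - hess (fun q : E1 => H (rsubmx q)) p i j + g 0 i * g 0 j).
  apply: etrans (hessD i j oO cpp cCg Op) _; congr (_ + _).
  apply: etrans (hessM i j oO (C2_cst (cylinder D) C) cg Op) _.
  rewrite hess_cst !pd_cst (hessM i j oO ch ch Op) hessh !pdh /= -/(h p).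
  by rewrite (_ : h p = s) //; ring.
rewrite hessian_hess; apply/matrixP => i j; rewrite [LHS]mxE gE [RHS]mxE.
have -> : ((2 * C) *: (g^T *m g)) i j = 2 * C * (g 0 i * g 0 j).
  by rewrite mxE mxE big_ord1 mxE.
rewrite mulrDr addrA; congr (_ + _).
case: (split_ordP i) => a ->; case: (split_ordP j) => b ->.
- by rewrite block_mxEul mxE !ord1 !hess_pull0l; ring.
- by rewrite block_mxEur mxE !ord1 !hess_pull0l; ring.
- by rewrite block_mxEdl mxE !ord1 !hess_pull0r; ring.
- by rewrite block_mxEdr mxE !hess_pull; rewrite -/x; ring.
Qed.

(** Neither [C] nor [H] survives in the conclusion. The contact point x is merely somewhere in the
    ellipsoid, so both uses shrink it around x0 and argue by continuity. *)
Lemma infimum_touch D (c d : R) (u : E1 -> R) x0 (V : 'M[R]_n) (phi : E -> R) :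
  (1 <= n)%N -> open D -> (n%:R - 1) / 2 * pi <= c ->
  subsolutions (calF c) (cylinder D) u -> D x0 -> isC2 D phi ->
  (forall x, D x -> inf [set u (spacetime t x) | t in [set t | 0 < t < 1]] <= phi x) ->
  phi x0 = inf [set u (spacetime t x0) | t in [set t | 0 < t < 1]] ->
  V \in unitmx -> (forall x, ell x0 V x <= 1 -> D x) -> 0 < d ->
  exists x A (b : 'I_n -> R), [/\ ell x0 V x < 1, calF c A,
    forall i j, hess phi x i j = hess phi x j i &
    \sum_i (row_mx (b i)%:M (row i V) *m A *m (row_mx (b i)%:M (row i V))^T) 0 0 =
      lap V phi x + 2 * n%:R * d].
Proof.
move=> n1 oD hc su Dx0 cphi vphi phi0 Vu VD d0.
have oO := cylinder_open oD.
have cell : isC2 D (ell x0 V) by exact: C2_subset (@subsetT _ _) (hpoly_C2 (hpoly_ell x0 V)).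
have cdell := C2M oD (C2_cst D d) cell.
(* On the boundary the infimum is at most [phi], hence less than [phi1] by d, so some time beats
   [phi1]; at x0 nothing is added. *)
pose phi1 x := phi x + d * ell x0 V x.
have cphi1 : isC2 D phi1 := C2D oD cphi cdell.
pose S := ell x0 V @^-1` [set t | t = 1].
have SD x : S x -> D x by move=> e1; apply: VD; rewrite e1.
have cS : compact S by apply: ell_compact => // t /= ->.
have [||||tau [a [b [ptau a0 b1 tab tauphi]]]] := @polyn_selection R n x0 S (fun t x => u (spacetime t x)) phi1 cS.
- by move=> x /SD Dx; move: cphi1; rewrite isC2E => /(_ x Dx)[].
- move=> t x t01 Sx al ual; have Cx : cylinder D (spacetime t x) by exists t, x; split=> //; exact: SD.
  have near1 : \forall y \near x, cylinder D (spacetime t y) -> u (spacetime t y) < al.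
    exact: (spacetime_continuous (su.1 _ Cx _ ual)).
  have near2 := open_nbhs_nbhs (conj oD (SD _ Sx)).
  by apply: filterS2 near1 near2 => y h Dy; apply: h; exists t, y.
- by move=> x s t l /SD Dx; exact: time_convex_combination n1 oD hc su Dx.
- move=> x Sx; have : inf [set u (spacetime t x) | t in [set t | 0 < t < 1]] < phi1 x.
    by apply: le_lt_trans (vphi x (SD _ Sx)) _; rewrite /phi1 Sx mulr1 ltrDl.
  have ne : [set u (spacetime t x) | t in [set t | 0 < t < 1]] !=set0.
    by exists (u (spacetime (1 / 2) x)), (1 / 2) => //=; lra.
  by move/(inf_lt ne) => [_ [t t01 <-] lt]; exists t.
have [H [pH lH Htau]] := polyn_extends Vu n1 ptau.
(* The maximum principle keeps the graph of H at the times [a, b], inside (0, 1). *)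
have Hb x : ell x0 V x <= 1 -> H x <= b.
  by apply: (harmonic_le Vu n1 pH lH) => y y1; rewrite Htau //; case/andP: (tab _ y1).
have Ha x : ell x0 V x <= 1 -> a <= H x.
  by apply: (harmonic_ge Vu n1 pH lH) => y y1; rewrite Htau //; case/andP: (tab _ y1).
have cH : isC2 D H by exact: C2_subset (@subsetT _ _) (polyn_C2 pH).
pose psi (p : E1) := phi1 (rsubmx p : E).
pose h (p : E1) : R := p 0 0 - H (rsubmx p).
pose g p := h p * h p.
have cpsi : isC2 (cylinder D) psi by exact: C2_pull cphi1.
have ch : isC2 (cylinder D) h.
  have := C2D oO (C2_coord (cylinder D) (0 : 'I_(1 + n))) (C2M oO (C2_cst (cylinder D) (-1)) (C2_pull cH)).
  apply: C2_eq => // p _; by rewrite /= mulN1r.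
have cg : isC2 (cylinder D) g by exact: (C2M oO ch ch).
(* The time interval contains [a, b] in its interior, so the graph of H leaves [In] only over the
   boundary [ell = 1]. *)
pose K := [set p : E1 | a / 2 <= p 0 0 <= (1 + b) / 2 /\ (ell x0 V @^-1` [set t | t <= 1]) (rsubmx p)].
pose In := [set p : E1 | a / 2 < p 0 0 < (1 + b) / 2 /\ [set x | ell x0 V x < 1] (rsubmx p)].
have cK : compact K by apply: compact_box; apply: ell_compact => //; exact: closed_le.
have KO : K `<=` cylinder D.
  move=> p [h1 h2]; apply/cylinderE; split; last exact: VD.
  by lra.
have oI : open In by apply: open_box; exact: open_ell.
have IK : In `<=` K by move=> p [/andP[h1 h2] h3]; split; [rewrite !ltW | exact: ltW].
have g0 p : K p -> 0 <= g p by move=> _; exact: sqr_ge0.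
have e00 : ell x0 V x0 <= 1 by rewrite ell_center ler01.
have a0' := Ha _ e00; have b0' := Hb _ e00.
have [|||C [C0 [p Ip]]] := touch (p0 := spacetime (H x0) x0) oO su cK KO oI IK cpsi cg g0.
- split; rewrite ?spacetime_time ?spacetime_space //=.
  by lra.
- by rewrite /g /h spacetime_space spacetime_time subrr mul0r.
- move=> p [hp1 hp2] nI gp.
  have pH0 : p 0 0 = H (rsubmx p).
    by apply/eqP; rewrite -subr_eq0; move/eqP: gp; rewrite mulf_eq0 orbb.
  have := Ha _ hp2; have := Hb _ hp2; rewrite -pH0 => hb ha.
  have S1 : S (rsubmx p).
    apply/eqP; rewrite eq_le hp2 leNgt; apply/negP => lt1; apply: nI; split=> //.
    by lra.
  (* At the reference point over x0, u - psi is nonnegative because u is at least the infimum there,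
     which equals [phi x0]. *)
  have : u p - psi p < 0.
    rewrite subr_lt0 [in u p](spacetimeE p) pH0 Htau //; exact: tauphi.
  move/lt_le_trans; apply; rewrite /psi spacetime_space /phi1 ell_center mulr0 addr0 subr_ge0 phi0.
  apply: ge_inf; first exact: time_has_lbound n1 oD hc su Dx0.
  by exists (H x0) => //=; lra.
move=> calFp; have Op := KO _ (IK _ Ip).
pose x : E := rsubmx p; pose s := p 0 0 - H x.
pose M : 'M[R]_n := \matrix_(i, j) (hess phi1 x i j - 2 * C * s * hess H x i j).
pose G : 'rV[R]_(1 + n) := row_mx 1%:M (- \row_j pd j H x).
have AE : hessian (fun q => psi q + C * g q) p = block_mx 0 0 0 M + (2 * C) *: (G^T *m G).
  exact: (graph_hessian C oD cphi1 cH Op).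
have Dx : D x by case/cylinderE: Op.
have hphi1 i j : hess phi1 x i j = hess phi x i j + d * hess (ell x0 V) x i j.
  apply: etrans (hessD i j oD cphi cdell Dx) _; congr (_ + _).
  apply: etrans (hessM i j oD (C2_cst D d) cell Dx) _.
  by rewrite hess_cst !pd_cst /=; ring.
have ell_polyn := polyn_hpoly (hpoly_ell x0 V).
(* The time components V_i . grad H make the vectors tangent to the graph of H. *)
exists x, (hessian (fun q => psi q + C * g q) p), (fun i => \sum_j (row i V) 0 j * (\row_j pd j H x) 0 j).
split=> //; first by case: Ip.
- move=> i j.
  have Ae k l : hessian (fun q => psi q + C * g q) p (rshift 1 k) (rshift 1 l) =
      M k l + 2 * C * (G 0 (rshift 1 k) * G 0 (rshift 1 l)).
    by rewrite AE mxE block_mxEdr; congr (_ + _); rewrite mxE mxE big_ord1 mxE.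
  case: calFp => /matrixP/(_ (rshift 1 i) (rshift 1 j)) + _.
  rewrite mxE !Ae ![M _ _]mxE !hphi1 (hess_polyn_sym pH x j i) (hess_polyn_sym ell_polyn x j i).
  by lra.
rewrite AE; under eq_bigr => i _ do rewrite graph_form.
rewrite sum_row_form.
have -> : \sum_i \sum_j (V^T *m V) i j * M i j =
    lap V phi x + d * lap V (ell x0 V) x - 2 * C * s * lap V H x.
  rewrite /lap !mulr_sumr -sumrN -!big_split /=; apply: eq_bigr => i _.
  rewrite !mulr_sumr -sumrN -!big_split /=; apply: eq_bigr => j _.
  by rewrite [M _ _]mxE hphi1; ring.
by rewrite lH mulr0 subr0 lap_ell // mulrC.
Qed.

End InfimumTouching.

(** * The angle inequality for the infimum *)

Section Main.
Context {R : realType} {n : nat}.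
Local Notation E := 'rV[R]_n.
Local Notation E1 := 'rV[R]_(1 + n).

Lemma C2_hess_continuous D (phi : E -> R) x i j : isC2 D phi -> D x ->
  {for x, continuous (fun y => hess phi y i j)}.
Proof.
move=> /C2P[_ /(_ j)[_ /(_ i)[_ h]]] Dx; have := h x Dx.
by congr (continuous_at _ _); apply/funext => y; rewrite hessE.
Qed.

Lemma cvg_sum_fin (T : topologicalType) (x : T) (I : Type) (l : seq I) (f : I -> T -> R) :
  (forall i, {for x, continuous (f i)}) -> {for x, continuous (fun y => \sum_(i <- l) f i y)}.
Proof.
move=> h; apply: cvg_big => [|i _]; last exact: h.
exact: add_continuous.
Qed.

Lemma lap_continuous D (V : 'M[R]_n) (phi : E -> R) x : isC2 D phi -> D x ->
  {for x, continuous (lap V phi)}.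
Proof.
move=> cphi Dx; apply: cvg_sum_fin => i; apply: cvg_sum_fin => j.
have h1 : {for x, continuous (fun _ : E => (V^T *m V) i j)} by exact: cst_continuous.
have h2 := C2_hess_continuous (i := i) (j := j) cphi Dx.
exact: (cvgM h1 h2).
Qed.

Lemma lap_scale_mx (r : R) (V : 'M[R]_n) (phi : E -> R) x :
  lap (r *: V) phi x = r ^+ 2 * lap V phi x.
Proof.
rewrite /lap [(r *: V)^T]linearZ mulr_sumr; apply: eq_bigr => i _; rewrite mulr_sumr; apply: eq_bigr => j _.
by rewrite -scalemxAr -scalemxAl scalerA mxE mulrA expr2.
Qed.

Lemma atan_shift (d : E) (a : R) : (1 <= n)%N -> \sum_i atan (d 0 i) < a -> a < n%:R * (pi / 2) ->
  exists2 s, 0 < s & \sum_i atan (d 0 i + s) = a.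
Proof.
move=> n1 lo hi.
pose f s := \sum_i atan (d 0 i + s).
have f0 : f 0 < a by rewrite /f; under eq_bigr do rewrite addr0.
have n0 : 0 < n%:R :> R. by rewrite ltr0n.
have pi0 := pi_gt0 R.
(* If every shifted entry is at least tan t then the sum of atan is at least n t >= a; this is the
   upper end for the intermediate value theorem. *)
pose t := Num.max 0 (a / n%:R).
have tpi : t < pi / 2 by rewrite gt_max divr_gt0 //= ltr_pdivrMr // mulrC.
have t0 : 0 <= t by rewrite le_max lexx.
pose b := tan t + \sum_i `|d 0 i|.
have tan0 : 0 <= tan t.
  rewrite leNgt; apply/negP => /lt_atan; rewrite tanK ?in_itv /= ?tpi ?andbT.
    by rewrite atan0 ltNge t0.
  by apply: lt_le_trans t0; rewrite oppr_lt0 divr_gt0.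
have b0 : 0 <= b by rewrite addr_ge0 // sumr_ge0.
have fb : a <= f b.
  have h : a <= \sum_(i < n) t.
    rewrite sumr_const card_ord -mulr_natl -ler_pdivrMl // mulrC.
    by rewrite /t le_max lexx orbT.
  apply: le_trans h _; apply: ler_sum => i _.
  rewrite -[t]tanK ?in_itv /= ?tpi ?andbT; last first.
    by apply: lt_le_trans t0; rewrite oppr_lt0 divr_gt0.
  apply: le_atan; rewrite /b (bigD1 i) //= addrCA lerDl.
  have s0 : 0 <= \sum_(j < n | j != i) `|d 0 j| by exact: sumr_ge0.
  by rewrite addrA addr_ge0 // -lerBlDl sub0r -normrN ler_norm.
have cf : continuous f.
  move=> s; apply: cvg_sum_fin => i.
  apply: continuous_comp; last exact: continuous_atan.
  by apply: cvgD; [exact: cst_continuous | exact: cvg_id].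
have mM : Num.min (f 0) (f b) <= a <= Num.max (f 0) (f b) by rewrite ge_min le_max (ltW f0) fb orbT.
have [s] := IVT b0 (continuous_subspaceT cf) mM.
rewrite in_itv /= => /andP[s0 _] fs; exists s => //.
rewrite lt_neqAle s0 andbT; apply/eqP => s0'; move: f0; rewrite {1}s0' fs ltxx //.
Qed.

(** Asymmetry at x0 would persist nearby by continuity, but [infimum_touch] finds points arbitrarily
    close to x0 where the Hessian is symmetric. *)
Lemma infimum_hess_sym D (c : R) (u : E1 -> R) x0 (phi : E -> R) :
  (1 <= n)%N -> open D -> (n%:R - 1) / 2 * pi <= c ->
  subsolutions (calF c) (cylinder D) u -> D x0 -> isC2 D phi ->
  (forall x, D x -> inf [set u (spacetime t x) | t in [set t | 0 < t < 1]] <= phi x) ->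
  phi x0 = inf [set u (spacetime t x0) | t in [set t | 0 < t < 1]] ->
  (hessian phi x0)^T = hessian phi x0.
Proof.
move=> n1 oD hc su Dx0 cphi vphi phi0; rewrite hessian_hess.
apply/matrixP => i j; rewrite !mxE; apply/eqP; rewrite -subr_eq0; apply/negP => /negP ne.
have cont : {for x0, continuous (fun y => hess phi y j i - hess phi y i j)}.
  exact: cvgB (C2_hess_continuous (i := j) (j := i) cphi Dx0) (C2_hess_continuous (i := i) (j := j) cphi Dx0).
have near1 : \forall y \near x0, hess phi y j i - hess phi y i j != 0.
  exact: (cont _ (open_nbhs_nbhs (conj (@open_neq R 0) ne))).
have near2 := open_nbhs_nbhs (conj oD Dx0).
have V1u : (1%:M : 'M[R]_n) \in unitmx by exact: unitmx1.
have [r r0 hr] := small_ellipsoid V1u (filterI near1 near2).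
have Vu : r *: (1%:M : 'M[R]_n) \in unitmx by rewrite unitmxZ // unitfE gt_eqF.
have VD x : ell x0 (r *: 1%:M) x <= 1 -> D x by case/hr.
have [x [A [b [ex _ sym _]]]] := infimum_touch n1 oD hc su Dx0 cphi vphi phi0 Vu VD ltr01.
by have [/negP] := hr x (ltW ex); rewrite sym subrr eqxx.
Qed.

Lemma infimum_angle D (c : R) (u : E1 -> R) x0 (phi : E -> R) :
  (1 <= n)%N -> open D -> (n%:R - 1) / 2 * pi <= c < (n%:R + 1) / 2 * pi ->
  subsolutions (calF c) (cylinder D) u -> D x0 -> isC2 D phi ->
  (forall x, D x -> inf [set u (spacetime t x) | t in [set t | 0 < t < 1]] <= phi x) ->
  phi x0 = inf [set u (spacetime t x0) | t in [set t | 0 < t < 1]] ->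
  c - pi / 2 <= lagrangian_angle (hessian phi x0).
Proof.
move=> n1 oD /andP[hc hc'] su Dx0 cphi vphi phi0.
have symB := infimum_hess_sym n1 oD hc su Dx0 cphi vphi phi0.
rewrite leNgt; apply/negP => lt.
(* For n = 1 and c <= 0, an angle below c - pi / 2 would be below -pi / 2. *)
have hs : (2 <= n)%N \/ 0 < c.
  have [n2|n2] := leqP 2 n; [by left | right].
  have n1' : n = 1%N by apply/eqP; rewrite eqn_leq n1 andbT -ltnS.
  rewrite ltNge; apply/negP => c0; move: lt symB; move: (hessian phi x0); rewrite n1' => B lt symB.
  have := lt_trans (lagrangian_angle_gt symB) lt; rewrite mul1r; lra.
set B := hessian phi x0 in lt symB.
have [Q [be [QQ BE]]] := symmetric_diagonalizes symB.
rewrite (lagrangian_angle_diag (conj QQ BE)) in lt.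
(* The eigenvalues are raised by a common s onto the critical level, to serve as base point m of a
   half-space. *)
have [s s0 hm] : exists2 s, 0 < s & \sum_i atan (be 0 i + s) = c - pi / 2.
  by apply: atan_shift n1 lt _; lra.
(* With rows sqrt (w_i) Q_i, the sum of the forms along the rows of V is the weighted sum of the
   half-space inequality. *)
pose m i := be 0 i + s; pose w i := (1 + m i ^+ 2)^-1; pose si i := Num.sqrt (w i).
have w0 i : 0 < w i by rewrite invr_gt0 ltr_pwDl // sqr_ge0.
have si0 i : 0 < si i by rewrite sqrtr_gt0.
have si2 i : si i ^+ 2 = w i by rewrite sqr_sqrtr // ltW.
pose V := diag_mx (\row_i si i) *m Q.
have rowV i : row i V = si i *: row i Q by rewrite row_mul row_diag_mx mxE -scalemxAl -rowE.
have Vu : V \in unitmx.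
  rewrite unitmx_mul (mulmx1_unit QQ).1 andbT unitmxE det_diag unitfE; apply/prodf_neq0 => i _.
  by rewrite mxE gt_eqF.
have lap0 : lap V phi x0 = \sum_i w i * be 0 i.
  have -> : lap V phi x0 = \sum_i \sum_j (V^T *m V) i j * B i j.
    by rewrite /B hessian_hess; apply: eq_bigr => i _; apply: eq_bigr => j _; rewrite mxE.
  rewrite -sum_row_form; apply: eq_bigr => i _; rewrite rowV linearZ /= -!scalemxAl -scalemxAr scalerA mxE -expr2 si2.
  congr (_ * _); have -> : (row i Q *m B *m (row i Q)^T) 0 0 = (Q *m B *m Q^T) i i.
    by rewrite -row_mul [LHS]mxE [RHS]mxE; apply: eq_bigr => j _; rewrite !mxE.
  by rewrite BE !mulmxA QQ mul1mx -mulmxA QQ mulmx1 mxE eqxx mulr1n.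
pose W := \sum_i w i.
have W0 : 0 < W.
  by rewrite /W (bigD1 (Ordinal n1)) //= ltr_wpDr // sumr_ge0 // => i _; exact: ltW.
(* At x0 the half-space inequality fails by s W. Half of this slack is spent on moving from x0 to
   the contact point. *)
have near1 : \forall y \near x0, lap V phi y < lap V phi x0 + s * W / 2.
  have := lap_continuous (V := V) cphi Dx0; move/cvgr_lt => /(_ (lap V phi x0 + s * W / 2)); apply.
  by rewrite ltrDl divr_gt0 ?mulr_gt0.
have [r r0 hr] := small_ellipsoid Vu (filterI near1 (open_nbhs_nbhs (conj oD Dx0))).
have rVu : r *: V \in unitmx by rewrite unitmxZ // unitfE gt_eqF.
have VD x : ell x0 (r *: V) x <= 1 -> D x by case/hr.
have n0 : 0 < n%:R :> R by rewrite ltr0n.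
(* The other half: 2 n d equals r^2 s W / 2, with r^2 the factor from scaling V. *)
pose d := r ^+ 2 * (s * W) / (4 * n%:R).
have d0 : 0 < d by rewrite divr_gt0 ?mulr_gt0 // exprn_gt0.
have [x [A [b [ex cA _ tot]]]] := infimum_touch n1 oD hc su Dx0 cphi vphi phi0 rVu VD d0.
have [lx _] := hr x (ltW ex).
(* Row i of r V is r [si i] times row i of Q, so the time component is divided by the same
   factor. *)
have := calF_halfspace (fun i => b i / (r * si i)) n1 hc hs cA QQ hm.
set q := fun i => (row_mx (b i / (r * si i))%:M (row i Q) *m A *m (row_mx (b i / (r * si i))%:M (row i Q))^T) 0 0.
have qE i : (row_mx (b i)%:M (row i (r *: V)) *m A *m (row_mx (b i)%:M (row i (r *: V)))^T) 0 0 =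
    r ^+ 2 * (w i * q i).
  have -> : row_mx (b i)%:M (row i (r *: V)) = (r * si i) *: row_mx (b i / (r * si i))%:M (row i Q).
    rewrite scale_row_mx scale_scalar_mx; congr (row_mx _%:M _).
      by field; rewrite !gt_eqF.
    by apply/rowP => j; rewrite -scalerA -rowV !mxE.
  by rewrite linearZ /= -!scalemxAl -scalemxAr scalerA mxE -si2 /q; ring.
rewrite (eq_bigr _ (fun i _ => qE i)) -mulr_sumr lap_scale_mx in tot.
have -> : \sum_i (q i - m i) / (1 + m i ^+ 2) = \sum_i w i * q i - (\sum_i w i * be 0 i + s * W).
  rewrite /W mulr_sumr -big_split -sumrB; apply: eq_bigr => i _ /=; rewrite -/(w i) /m; ring.
rewrite -lap0 => ge0.
have r20 : 0 < r ^+ 2 by rewrite exprn_gt0.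
have dE : 2 * n%:R * d = r ^+ 2 * (s * W / 2) by rewrite /d; field; rewrite gt_eqF.
rewrite dE -mulrDr in tot; move/(mulfI (lt0r_neq0 r20)) in tot.
by rewrite tot in ge0; lra.
Qed.

End Main.

(* The first conjunct says that v is real-valued on D: [inf] of a set that is
   not bounded below is 0 by convention. *)
Theorem corollary2p3 (R : realType) (n : nat) (D : set 'rV[R]_n) (c : R)
    (u : 'rV[R]_(1 + n) -> R) :
  (1 <= n)%N ->
  open D -> connected D ->
  (n%:R - 1) / 2 * pi <= c < (n%:R + 1) / 2 * pi ->
  subsolutions (calF c) (cylinder D) u ->
  (forall x, D x -> has_lbound [set u (spacetime t x) | t in [set t | 0 < t < 1]]) /\
  subsolutions (F_ (c - pi / 2)) D
    (fun x => inf [set u (spacetime t x) | t in [set t | 0 < t < 1]]).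
Proof.
move=> n1 oD _ hc su; have /andP[hc1 hc2] := hc.
split; first by move=> x; exact: time_has_lbound n1 oD hc1 su.
split=> [x Dx a|x0 phi Dx0 cphi vphi phi0].
  have ne : [set u (spacetime t x) | t in [set t | 0 < t < 1]] !=set0.
    by exists (u (spacetime (1 / 2) x)), (1 / 2) => //=; lra.
  (* A time t with u (t, x) < a keeps this property for nearby x, where u (t, .) bounds the infimum
     from above. *)
  move/(inf_lt ne) => [_ [t t01 <-] lt].
  have Cx : cylinder D (spacetime t x) by exists t, x.
  have near1 : \forall y \near x, cylinder D (spacetime t y) -> u (spacetime t y) < a.
    exact: (spacetime_continuous (su.1 _ Cx _ lt)).
  apply: filterS near1 => y h Dy; apply: le_lt_trans (h _); last by exists t, y.
  by apply: ge_inf; [exact: time_has_lbound n1 oD hc1 su Dy | exists t].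
rewrite -isC2E in cphi; split; last exact: infimum_angle n1 oD hc su Dx0 cphi vphi phi0.
exact: infimum_hess_sym n1 oD hc1 su Dx0 cphi vphi phi0.
Qed.
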